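(* (a) If $|4x(1-x)|\ge1$ and $r,r_1,\dots,r_M\in\mathbb Z_{>0}$, then, with $w=r+1+\sum_{j=1}^M r_j$ and $\Xi(x)=\{\xi_{0,0}(x),\xi_{0,1}(x),\xi_{1,0}(x),\xi_{1,1}(x)\}$, $$\sum_{k=1}^\infty\frac{\prod_{j=1}^M\mathsf H_k^{(r_j)}}{k^{r+1}\binom{4k}{2k}}\left[\frac{2^2}{x(1-x)}\right]^k\in\mathfrak G^{(1)}_{w;w}\left[\Xi(x);\Xi(x)\right],$$ where $\xi_{\ell,m}(x)=\frac{1+(-1)^\ell\sqrt x+(-1)^m\sqrt{1-x}}{2}$. (b) If $|4x(1-x)|>1$, then $$\sum_{k=1}^\infty\frac{\mathsf H_k}{(4k+1)\binom{4k}{2k}}\left[\frac{2^2}{x(1-x)}\right]^k=-\sum_{\ell,\ell',m,m'\in\{0,1\}}\frac{\sqrt{(1-x)x}\,\big[(-1)^\ell\sqrt{1-x}-(-1)^m\sqrt x\big]\,G(\xi_{\ell,m}(x),\xi_{\ell',m'}(x);1)}{4(2x-1)}$$ and $$\begin{aligned}\sum_{k=1}^\infty\frac{\mathsf H_k}{(4k+3)\binom{4k}{2k}}\left[\frac{2^2}{x(1-x)}\right]^k={}&\sum_{\ell,\ell',m,m'\in\{0,1\}}\frac{2[(1-x)x]^{3/2}\,G(\xi_{\ell,m}(x),\xi_{\ell',m'}(x);1)}{(-1)^\ell\sqrt{1-x}+(-1)^m\sqrt x-2\sqrt{(1-x)x}-(-1)^{\ell+m}}\\&+\sum_{\ell,\ell',m,m'\in\{0,1\}}\frac{\sqrt{(1-x)x}\,\big[(-1)^\ell\sqrt{1-x}-(-1)^m\sqrt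 x\big]\,G(\xi_{\ell,m}(x),\xi_{\ell',m'}(x);1)}{4(2x-1)}.\end{aligned}$$
   Context: Here $x$ is a complex number. Square roots of non-zero complex numbers are $\sqrt z=\sqrt{|z|}\,e^{\frac i2\arg z}$ with $-\pi<\arg z\le\pi$, and $z^{3/2}=(\sqrt z)^3$. Harmonic numbers: $\mathsf H_m^{(r)}=\sum_{k=1}^m k^{-r}$ and $\mathsf H_m=\mathsf H_m^{(1)}$ for $m\in\mathbb Z_{\ge0}$ and $r\in\mathbb Z_{>0}$. $M$ is a positive integer. Generalized polylogarithms (GPLs): $G(\alpha_1,\dots,\alpha_n;z)$ is defined recursively by $$G(\alpha_1,\dots,\alpha_n;z)=\int_0^z\frac{dx}{x-\alpha_1}\,G(\alpha_2,\dots,\alpha_n;x)\quad\text{if }|\alpha_1|+\cdots+|\alpha_n|\ne0,$$ $$G(\underbrace{0,\dots,0}_{n};z)=\frac{\log^n z}{n!},\qquad G(\text{empty};z)=1.$$ By this definition the expression diverges if $\alpha_1=z$; in that case $G(\alpha_1,\dots,\alpha_n;\alpha_1)$ is understood through Panzer's logarithmic regularization. For $z=\alpha_1=1$ this means: for $z\to1^-$ write $G(1,\alpha_2,\dots,\alpha_n;z)=\sum_i f_i(z)\log^i(1-z)$ with $f_i$ analytic near $z=1$, and set $G(1,\alpha_2,\dots,\alpha_n;1)=f_0(1)$. The $\mathbb Q$-vector space: for suitable $z\in\mathbb C$, $k,k_*\in\mathbb Z_{>0}$ and $S,S_*\subset\mathbb C$, $$\mathfrak G^{(z)}_{k;k_*}[S;S_*]=\sum_{j=k_*}^{k}\operatorname{span}_{\mathbb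 Q}\Big\{G(\alpha_1,\dots,\alpha_k;z)\ :\ \alpha_\ell\in\{0,1\}\cup S\text{ for }\ell\in\{1,\dots,k\}\setminus\{j\},\ \alpha_j\in S_*\Big\}.$$
   Formalization: In (a) at x=1/2, where ξ_{0,1}=ξ_{1,0}=1/2 lies on the integration path and such G diverge, membership is replaced by: the sum is the limit, as y→1/2 with |4y(1-y)|≥1, y≠1/2, of one fixed rational combination of admissible G at y. *)

(* Defs.v *)
From Stdlib Require Import Reals Factorial List QArith Qreals.
From Coquelicot Require Import Coquelicot.

Open Scope C_scope.

(* The value lies in (-PI, PI] for z <> 0. *)
Definition Carg (z : C) : R :=
  if Rle_dec 0 (Im z) then acos (Re z / Cmod z) else (- acos (Re z / Cmod z))%R.

Definition Csqrt (z : C) : C :=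
  sqrt (Cmod z) * (cos (Carg z / 2), sin (Carg z / 2)).

Definition Clog (z : C) : C := (ln (Cmod z), Carg z).

Definition harmonic (r m : nat) : R :=
  sum_n_m (fun k => / INR k ^ r)%R 1 m.

Definition harmonic_prod (rs : list nat) (k : nat) : R :=
  fold_right Rmult 1%R (map (fun r => harmonic r k) rs).

Definition analytic_near_1 (f : C -> C) : Prop :=
  exists (a : nat -> C) (rho : R), (0 < rho)%R /\
    forall z : C, (Cmod (z - 1) < rho)%R ->
      is_pseries (K := C_AbsRing) (V := C_NormedModule) a (z - 1) (f z).

(* h t = sum_{i <= N} f_i(t) log^i(1 - t) as t -> 1^-, with regularized value
   v = f_0(1). *)
Definition is_log_reg (h : R -> C) (v : C) : Prop :=
  exists (N : nat) (f : nat -> C -> C),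
    (forall i : nat, (i <= N)%nat -> analytic_near_1 (f i)) /\
    at_left 1 (fun t : R =>
      h t = sum_n (G := C_AbelianMonoid)
              (fun i => f i (RtoC t) * RtoC (ln (1 - t)) ^ i) N) /\
    v = f O (RtoC 1).

Definition log_reg (h : R -> C) : C :=
  iota (T := C_R_CompleteNormedModule) (is_log_reg h).

Definition sum_Cmod (s : list C) : R := fold_right (fun a m => Cmod a + m)%R 0%R s.

(* Integrals run along the straight segment from 0 to z, parametrized by
   x = z t, 0 < t < 1, and are improper at both ends.  For alpha_1 = z the
   regularization is taken along the same segment, as z t -> z; for z = 1 this
   is the expansion in powers of log(1 - z).  The value is only meaningful when
   no letter lies in the open segment. *)
Fixpoint GPL (s : list C) (z : C) {struct s} : C :=
  match s with
  | nil => 1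
  | a :: s' =>
      if Req_EM_T (sum_Cmod s) 0 then Clog z ^ length s / RtoC (INR (Factorial.fact (length s)))
      else
        let int (y : C) : C :=
          RInt_gen (V := C_R_CompleteNormedModule)
            (fun t : R => y / (y * t - a) * GPL s' (y * t))
            (at_right 0) (at_left 1) in
        if Ceq_dec a z then log_reg (fun t : R => int (z * t)) else int z
  end.

Definition Qcomb {A : Type} (f : A -> C) (c : list (Q * A)) : C :=
  fold_right (fun p v => RtoC (Q2R (fst p)) * f (snd p) + v) 0 c.

Definition Qspan (A : C -> Prop) (v : C) : Prop :=
  exists c : list (Q * C), List.Forall (fun p => A (snd p)) c /\ v = Qcomb (fun a => a) c.

(* Positions are numbered from 1 as in alpha_1, ..., alpha_k. *)
Definition admissible {T : Type} (zero one : T) (S Sstar : T -> Prop) (k j : nat)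
    (s : list T) : Prop :=
  length s = k /\
  (forall l : nat, (1 <= l <= k)%nat -> l <> j ->
     nth (l - 1) s zero = zero \/ nth (l - 1) s zero = one \/
     S (nth (l - 1) s zero)) /\
  Sstar (nth (j - 1) s zero).

Definition GPL_space (z : C) (k kstar : nat) (S Sstar : C -> Prop) (v : C) : Prop :=
  exists u : nat -> C,
    (forall j : nat, (kstar <= j <= k)%nat ->
       Qspan (fun g => exists s : list C,
                admissible (RtoC 0) (RtoC 1) S Sstar k j s /\ g = GPL s z) (u j)) /\
    v = sum_n_m (G := C_AbelianMonoid) u kstar k.

(* Variant for letters depending on a parameter y: v is the limit along the
   filter F of a fixed rational combination of G(alpha_1(y), ..., alpha_k(y); z). *)
Definition GPL_space_lim (F : (C -> Prop) -> Prop) (z : C) (k kstar : nat)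
    (S Sstar : (C -> C) -> Prop) (v : C) : Prop :=
  exists c : list (Q * list (C -> C)),
    List.Forall (fun p => exists j : nat, (kstar <= j <= k)%nat /\
              admissible (fun _ => RtoC 0) (fun _ => RtoC 1) S Sstar k j (snd p)) c /\
    filterlim (fun y : C => Qcomb (fun s => GPL (map (fun f => f y) s) z) c)
      F (locally (v : C_R_NormedModule)).

Definition xi (l m : nat) (x : C) : C :=
  (1 + (-1) ^ l * Csqrt x + (-1) ^ m * Csqrt (1 - x)) / 2.

Definition Xi (x : C) (a : C) : Prop :=
  a = xi 0 0 x \/ a = xi 0 1 x \/ a = xi 1 0 x \/ a = xi 1 1 x.

Definition Xi_fun (a : C -> C) : Prop :=
  a = xi 0 0 \/ a = xi 0 1 \/ a = xi 1 0 \/ a = xi 1 1.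

(* At x = 1/2 one has xi_{0,1} = xi_{1,0} = 1/2, which lies on the path of
   integration (0, 1), so GPLs with these letters diverge there; x = 1/2 is
   approached inside the domain |4 y (1 - y)| >= 1, where no other point has a
   letter on [0, 1]. *)
Definition to_half : (C -> Prop) -> Prop :=
  within (fun y : C => y <> 1 / 2 /\ (1 <= Cmod (4 * y * (1 - y)))%R)
    (locally ((1 / 2 : C) : C_R_NormedModule)).

Definition binom_4k_2k (k : nat) : R := Binomial.C (4 * k) (2 * k).

Definition sum01 (f : nat -> C) : C := f 0%nat + f 1%nat.

(* Main.v *)
Require Import Defs.
From Stdlib Require Import Reals Factorial List QArith Qreals Lra Lia.
From Coquelicot Require Import Coquelicot.


(** The summands are Beta integrals.  Put u = 4 / (x (1 - x)) and
    Z(t) = u t^2 (1 - t)^2.  Then u^k / binom(4k, 2k), divided by 2k or by 4k + 1,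
    is the integral of Z(t)^k over [0, 1] against dt/t or dt, so each sum is
    the integral of a generating function sum_k a_k Z(t)^k of its numerators.

    What makes polylogarithms with the letters xi appear is a factorization.
    Since 4 t (1 - t) = 1 - (2t - 1)^2, the equation Z(t) = 1 reads
    (2t - 1)^2 = 1 +- 2 sqrt x sqrt (1 - x) = (sqrt x +- sqrt (1 - x))^2, whose
    solutions are the four xi; see [one_minus_Z].  Hence
      dZ / Z = 2 dt / t + 2 dt / (t - 1),
      dZ / (1 - Z) = - sum_xi dt / (t - xi),
    and an iterated integral in the two forms on the left is a rational
    combination of iterated integrals in the forms dt / (t - a) with a in
    {0, 1} or a = xi.

    For the sums with k^(r+1), the products of harmonic numbers divided by k^r
    are nonnegative integer combinations of multiple harmonic sums.  Only two
    operations are needed to build those, division by k and summation over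
    j < k followed by division by k, and on generating functions they are
    integration against dZ / Z and dZ / (1 - Z).  The class [mhs] is generated by
    these operations; it is stable under multiplication by harmonic numbers
    ([mhs_mul_harmonic]), and by induction its generating functions are
    combinations of polylogarithms whose coefficients do not depend on x
    ([mhs_representable]).  One more integration, against dt / t, gives the sum
    ([series_coef_value]); its first letter 0 makes the value at 1 a convergent
    integral.

    Three points need care.  The integrals defining polylogarithms are improper
    at 0 and, after a letter 1, the inner functions blow up at 1: the bound
    K t / sqrt (1 - t) is reproduced by every letter and controls both ends
    ([GPL_reg]).  When |4 x (1 - x)| = 1 the variable Z reaches the unit circle
    at t = 1/2, where the generating function need not converge absolutely:
    identities are carried across t = 1/2 by the symmetry of Z under
    t -> 1 - t ([eq_of_same_derivative]), and after the last integration the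
    coefficients are O(k^(-5/4)), so that the integrated series converges
    uniformly on [0, 1] ([beta_integral_series]).  For x = 1/2 itself the same
    combination is used as for the other x, and the sum is continuous in x by
    dominated convergence ([eval_comb_GPL_space_lim]).

    For the sums with 4k + 1 and 4k + 3, sum_k H_k Z^k = - log (1 - Z) / (1 - Z),
    where - log (1 - Z) = - sum_xi G(xi; t), and 1 / (1 - Z) and
    t (1 - t) / (1 - Z) are split into partial fractions over the xi.  The
    denominators 4k + 3 come from 8 t (1 - t) - 1 in place of 1.  The residues
    then differ from the coefficients of the statement by the constant x (1 - x)
    ([second_coefficient]); this constant multiplies the sum of all
    G(xi, xi'; 1), which is log^2 (1 - Z) / 2 at t = 1 and vanishes because
    Z(1) = 0 ([pair_comb_1]). *)

(** * Limits of series *)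

Open Scope C_scope.
Open Scope R_scope.

Lemma filterlim_plus_fun {K : AbsRing} {V : NormedModule K} {T : Type}
    {F : (T -> Prop) -> Prop} {FF : Filter F} (f g : T -> V) (a b : V) :
  filterlim f F (locally a) -> filterlim g F (locally b) ->
  filterlim (fun y => plus (f y) (g y)) F (locally (plus a b)).
Proof.
  intros Hf Hg.
  exact (filterlim_comp_2 f g plus Hf Hg (filterlim_plus a b)).
Qed.

(** The Cauchy estimate for the partial sums between N and n, in the limit of n. *)
Lemma series_tail_le {K : AbsRing} {V : NormedModule K}
    (g : nat -> V) (M : nat -> R) (G : V) (m : R) (N : nat) :
  (forall n, norm (g n) <= M n) -> is_series g G -> is_series M m ->
  norm (minus G (sum_n g N)) <= m - sum_n M N.
Proof.
  intros Hle HG Hm.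
  refine (filterlim_le (F := eventually) (fun n => norm (minus (sum_n g n) (sum_n g N)))
    (fun n => sum_n M n - sum_n M N)
    (norm (minus G (sum_n g N))) (m - sum_n M N) _ _ _).
  - exists N. intros n Hn.
    destruct (Nat.eq_dec n N) as [->|Hne].
    + replace (minus (sum_n g N) (sum_n g N)) with (zero : V)
        by (symmetry; apply (plus_opp_r (G := V))).
      rewrite (norm_zero (V := V)). lra.
    + replace (minus (sum_n g n) (sum_n g N)) with (sum_n_m g (S N) n)
        by (apply (sum_n_m_sum_n (G := V)); lia).
      replace (sum_n M n - sum_n M N) with (sum_n_m M (S N) n)
        by (apply (sum_n_m_sum_n (G := R_AbelianGroup)); lia).
      apply Rle_trans with (1 := norm_sum_n_m g _ _).
      apply sum_n_m_le. exact Hle.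
  - apply filterlim_comp with (2 := filterlim_norm (minus G (sum_n g N))).
    apply filterlim_plus_fun; [exact HG | apply filterlim_const].
  - apply (filterlim_plus_fun (V := R_NormedModule) (sum_n M) (fun _ => - sum_n M N) m);
      [exact Hm | apply filterlim_const].
Qed.

(** Dominated convergence for series: beyond a fixed index both tails are smaller
    than the tail of the majorant, and the finite part converges term by term. *)
Lemma tannery {K : AbsRing} {V : NormedModule K} {T : Type}
    (F : (T -> Prop) -> Prop) {FF : Filter F}
    (f : nat -> T -> V) (l : nat -> V) (M : nat -> R) (S : T -> V) (L : V) :
  ex_series M ->
  F (fun y => forall n, norm (f n y) <= M n) ->
  (forall n, norm (l n) <= M n) ->
  (forall n, filterlim (f n) F (locally (l n))) ->
  F (fun y => is_series (fun n => f n y) (S y)) ->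
  is_series l L -> filterlim S F (locally L).
Proof.
  intros [m Hm] HfM HlM Hfl HS HL.
  apply filterlim_locally_ball_norm. intros eps.
  assert (He : 0 < eps / 3) by (generalize (cond_pos eps); lra).
  destruct (proj1 (filterlim_locally_ball_norm (U := R_NormedModule) (sum_n M) m) Hm (mkposreal _ He))
    as [N HN].
  specialize (HN N (le_n N)).
  assert (HN' : m - sum_n M N < eps / 3).
  { apply Rle_lt_trans with (Rabs (sum_n M N - m)).
    - rewrite Rabs_minus_sym. apply Rle_abs.
    - exact HN. }
  assert (Hsum : forall n, filterlim (fun y => sum_n (fun i => f i y) n) F
                   (locally (sum_n l n))).
  { induction n as [|n IH].
    - rewrite sum_O. apply filterlim_ext with (f 0%nat).
      + intros y. now rewrite sum_O.
      + apply Hfl.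
    - rewrite sum_Sn.
      apply filterlim_ext with (fun y => plus (sum_n (fun i => f i y) n) (f (Datatypes.S n) y)).
      + intros y. now rewrite sum_Sn.
      + apply filterlim_plus_fun; [exact IH | apply Hfl]. }
  generalize (proj1 (filterlim_locally_ball_norm _ _) (Hsum N) (mkposreal _ He)). intros HsN.
  generalize (filter_and _ _ (filter_and _ _ HfM HS) HsN).
  apply filter_imp. intros y [[H1 H2] H3].
  unfold ball_norm in *. simpl in H3.
  (* S y - L is split as tail of S y, difference of finite parts, tail of L. *)
  replace (minus (S y) L) with
    (plus (minus (S y) (sum_n (fun i => f i y) N))
       (plus (minus (sum_n (fun i => f i y) N) (sum_n l N))
             (opp (minus L (sum_n l N))))).
  2:{ rewrite (opp_minus (G := V)). rewrite plus_assoc, <- !(minus_trans (G := V)). reflexivity. }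
  generalize (series_tail_le _ _ _ _ N H1 H2 Hm) (series_tail_le _ _ _ _ N HlM HL Hm).
  intros H4 H5.
  eapply Rle_lt_trans; [apply (norm_triangle (V := V))|].
  eapply Rle_lt_trans; [apply Rplus_le_compat_l, (norm_triangle (V := V))|].
  rewrite (norm_opp (V := V)). lra.
Qed.


(** * Complex-valued functions of a real variable *)

(** The difference quotients are dominated by the majorant of the derivatives (mean
    value theorem), so differentiating term by term is [tannery] along h -> 0. *)
Lemma is_derive_series (f g : nat -> R -> R) (M : nat -> R) (F : R -> R) (l t0 d : R) :
  0 < d -> ex_series M ->
  (forall n t, Rabs (t - t0) < d -> is_derive (f n) t (g n t)) ->
  (forall n t, Rabs (t - t0) < d -> Rabs (g n t) <= M n) ->
  (forall t, Rabs (t - t0) < d -> is_series (fun n => f n t) (F t)) ->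
  is_series (fun n => g n t0) l -> is_derive F t0 l.
Proof.
  intros Hd HM Hder Hle HF Hl.
  assert (H0 : Rabs (t0 - t0) < d) by (rewrite Rminus_eq_0, Rabs_R0; exact Hd).
  assert (Hlim : filterlim (fun h => (F (t0 + h) - F t0) / h) (locally' 0) (locally l)).
  { apply (tannery (V := R_NormedModule) (locally' 0)
      (fun n h => (f n (t0 + h) - f n t0) / h) (fun n => g n t0) M).
    - exact HM.
    - exists (mkposreal _ Hd). intros h Hh Hh0 n. change R in h.
      change (Rabs (h - 0) < d) in Hh. rewrite Rminus_0_r in Hh.
      destruct (MVT_cor4 (f n) (g n) t0 (Rabs h)) with (b := t0 + h) as [c [Hc1 Hc2]].
      + intros c Hc. apply Hder. lra.
      + replace (t0 + h - t0) with h by ring. lra.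
      + change (Rabs ((f n (t0 + h) - f n t0) / h) <= M n).
        rewrite Hc1. replace (g n c * (t0 + h - t0) / h) with (g n c) by (field; exact Hh0).
        apply Hle. replace (t0 + h - t0) with h in Hc2 by ring. lra.
    - intros n. apply (Hle n t0 H0).
    - intros n. specialize (Hder n t0 H0). apply is_derive_Reals in Hder.
      apply filterlim_locally. intros eps.
      destruct (Hder eps (cond_pos eps)) as [delta Hdelta].
      exists delta. intros h Hh Hh0. change R in h.
      apply Hdelta; [exact Hh0|].
      change (Rabs (h - 0) < delta) in Hh. now rewrite Rminus_0_r in Hh.
    - exists (mkposreal _ Hd). intros h Hh Hh0. change R in h.
      change (Rabs (h - 0) < d) in Hh. rewrite Rminus_0_r in Hh.
      apply (is_series_ext (fun n => (/ h) * (f n (t0 + h) + - f n t0))).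
      { intros n. unfold Rdiv. apply Rmult_comm. }
      replace ((F (t0 + h) - F t0) / h) with (/ h * (F (t0 + h) - F t0)) by (field; exact Hh0).
      apply (is_series_scal (V := R_NormedModule) (/ h)).
      apply (is_series_minus (V := R_NormedModule)); apply HF; trivial.
      now replace (t0 + h - t0) with h by ring.
    - exact Hl. }
  apply is_derive_Reals. intros eps Heps.
  destruct (proj1 (filterlim_locally _ _) Hlim (mkposreal _ Heps)) as [delta Hdelta].
  exists delta. intros h Hh0 Hh. apply Hdelta; [|exact Hh0].
  change (Rabs (h - 0) < delta). now rewrite Rminus_0_r.
Qed.

Notation limC f F l := (filterlim f F (locally (T := C_UniformSpace) (l : C))).

(** Derivatives of functions from R to C are taken by components, which gives access
    to the mean value theorem and to the rules of one-variable real calculus. *)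
Definition derC (F : R -> C) (t : R) (l : C) : Prop :=
  is_derive (fun s => Re (F s)) t (Re l) /\ is_derive (fun s => Im (F s)) t (Im l).

Definition contC (F : R -> C) (t : R) : Prop :=
  continuous (fun s => Re (F s)) t /\ continuous (fun s => Im (F s)) t.

Lemma limC_iff {T : Type} (F : (T -> Prop) -> Prop) {FF : Filter F} (f : T -> C) (l : C) :
  limC f F l <->
  filterlim (fun y => Re (f y)) F (locally (Re l)) /\
  filterlim (fun y => Im (f y)) F (locally (Im l)).
Proof.
  split.
  - intros H. split.
    + apply filterlim_comp with (1 := H). apply filterlim_locally. intros eps.
      exists eps. intros y [Hy _]. exact Hy.
    + apply filterlim_comp with (1 := H). apply filterlim_locally. intros eps.
      exists eps. intros y [_ Hy]. exact Hy.
  - intros [H1 H2]. apply filterlim_locally. intros eps.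
    generalize (filter_and _ _ (proj1 (filterlim_locally _ _) H1 eps)
                               (proj1 (filterlim_locally _ _) H2 eps)).
    apply filter_imp. intros y [A B]. split; [exact A | exact B].
Qed.

Lemma sum_n_Re (a : nat -> C) n :
  Re (sum_n (G := C_AbelianMonoid) a n) = sum_n (fun k => Re (a k)) n.
Proof.
  induction n as [|n IH].
  - now rewrite !sum_O.
  - rewrite !sum_Sn, <- IH. reflexivity.
Qed.

Lemma sum_n_Im (a : nat -> C) n :
  Im (sum_n (G := C_AbelianMonoid) a n) = sum_n (fun k => Im (a k)) n.
Proof.
  induction n as [|n IH].
  - now rewrite !sum_O.
  - rewrite !sum_Sn, <- IH. reflexivity.
Qed.

Notation is_seriesC a v := (is_series (K := C_AbsRing) (V := C_NormedModule) a v).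

Lemma is_seriesC_iff (a : nat -> C) (v : C) :
  is_seriesC a v <->
  is_series (fun n => Re (a n)) (Re v) /\ is_series (fun n => Im (a n)) (Im v).
Proof.
  unfold is_series.
  split.
  - intros H.
    destruct (proj1 (limC_iff eventually (sum_n (G := C_AbelianMonoid) a) v) H) as [A B].
    split; [eapply filterlim_ext; [|exact A] | eapply filterlim_ext; [|exact B]];
      intros n; [apply sum_n_Re | apply sum_n_Im].
  - intros [A B].
    apply (limC_iff eventually (sum_n (G := C_AbelianMonoid) a) v).
    split; [eapply filterlim_ext; [|exact A] | eapply filterlim_ext; [|exact B]];
      intros n; symmetry; [apply sum_n_Re | apply sum_n_Im].
Qed.

Lemma Rabs_Re_le (z : C) : Rabs (Re z) <= Cmod z.
Proof. eapply Rle_trans; [apply Rmax_l | apply (Rmax_Cmod z)]. Qed.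

Lemma Rabs_Im_le (z : C) : Rabs (Im z) <= Cmod z.
Proof. eapply Rle_trans; [apply Rmax_r | apply (Rmax_Cmod z)]. Qed.

Lemma Cmod_le_abs (z : C) : Cmod z <= Rabs (Re z) + Rabs (Im z).
Proof.
  unfold Cmod. apply Rsqr_incr_0_var.
  - rewrite Rsqr_sqrt by nra. fold (Re z) (Im z).
    generalize (Rabs_pos (Re z)) (Rabs_pos (Im z)).
    unfold Rsqr. rewrite <- (pow2_abs (Re z)), <- (pow2_abs (Im z)). nra.
  - generalize (Rabs_pos (Re z)) (Rabs_pos (Im z)). lra.
Qed.

Lemma derC_ext_loc (F G : R -> C) (t : R) (l : C) :
  locally t (fun s => F s = G s) -> derC F t l -> derC G t l.
Proof.
  intros H [A B]. split; eapply is_derive_ext_loc; try eassumption;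
    eapply filter_imp; try exact H; intros s Hs; simpl; now rewrite Hs.
Qed.

Lemma derC_plus (F G : R -> C) (t : R) (l m : C) :
  derC F t l -> derC G t m -> derC (fun s => F s + G s)%C t (l + m)%C.
Proof.
  intros [A B] [A' B']. split.
  - exact (is_derive_plus (V := R_NormedModule) _ _ _ _ _ A A').
  - exact (is_derive_plus (V := R_NormedModule) _ _ _ _ _ B B').
Qed.

Lemma derC_const (c : C) (t : R) : derC (fun _ => c) t 0%C.
Proof. split; apply (is_derive_const (V := R_NormedModule)). Qed.

Lemma derC_scal (c : C) (F : R -> C) (t : R) (l : C) :
  derC F t l -> derC (fun s => c * F s)%C t (c * l)%C.
Proof.
  intros [A B]. split.
  - exact (is_derive_minus (V := R_NormedModule) _ _ _ _ _
             (is_derive_scal _ _ (Re c) _ A) (is_derive_scal _ _ (Im c) _ B)).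
  - exact (is_derive_plus (V := R_NormedModule) _ _ _ _ _
             (is_derive_scal _ _ (Re c) _ B) (is_derive_scal _ _ (Im c) _ A)).
Qed.

Lemma derC_minus (F G : R -> C) (t : R) (l m : C) :
  derC F t l -> derC G t m -> derC (fun s => F s - G s)%C t (l - m)%C.
Proof.
  intros [A B] [A' B']. split.
  - exact (is_derive_minus (V := R_NormedModule) _ _ _ _ _ A A').
  - exact (is_derive_minus (V := R_NormedModule) _ _ _ _ _ B B').
Qed.

Lemma derC_contC (F : R -> C) (t : R) (l : C) : derC F t l -> contC F t.
Proof.
  intros [A B]. split.
  - apply (ex_derive_continuous (V := R_NormedModule)). now exists (Re l).
  - apply (ex_derive_continuous (V := R_NormedModule)). now exists (Im l).
Qed.

Lemma contC_lim (F : R -> C) (t : R) : contC F t -> limC F (locally t) (F t).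
Proof. intros [A B]. apply limC_iff; [apply locally_filter|]. now split. Qed.

Lemma contC_mult (F G : R -> C) (t : R) :
  contC F t -> contC G t -> contC (fun s => F s * G s)%C t.
Proof.
  intros [A B] [A' B']. split.
  - apply (continuous_minus (V := R_NormedModule)
      (fun s => Re (F s) * Re (G s)) (fun s => Im (F s) * Im (G s)));
      apply (continuous_mult (K := R_AbsRing)); assumption.
  - apply (continuous_plus (V := R_NormedModule)
      (fun s => Re (F s) * Im (G s)) (fun s => Im (F s) * Re (G s)));
      apply (continuous_mult (K := R_AbsRing)); assumption.
Qed.

Lemma derC_0_const (F : R -> C) (a b : R) :
  (forall t, a < t < b -> derC F t 0%C) ->
  forall s t, a < s < b -> a < t < b -> F s = F t.
Proof.
  intros H.
  assert (W : forall f : R -> R, (forall t, a < t < b -> is_derive f t 0) ->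
     forall s t, a < s < b -> a < t < b -> f s = f t).
  { intros f Hf s t Hs Ht.
    destruct (MVT_gen f s t (fun _ => 0)) as [c [_ Hc]].
    - intros x Hx. apply Hf. revert Hx. unfold Rmin, Rmax. destruct (Rle_dec s t); lra.
    - intros x Hx. apply continuity_pt_filterlim.
      apply (ex_derive_continuous (V := R_NormedModule)). exists 0. apply Hf.
      revert Hx. unfold Rmin, Rmax. destruct (Rle_dec s t); lra.
    - lra. }
  intros s t Hs Ht. apply injective_projections.
  - apply (W (fun s => Re (F s))); trivial. intros u Hu. apply (H u Hu).
  - apply (W (fun s => Im (F s))); trivial. intros u Hu. apply (H u Hu).
Qed.

Lemma limC_unique {T : Type} (F : (T -> Prop) -> Prop) {FF : ProperFilter F}
    (f : T -> C) (l m : C) : limC f F l -> limC f F m -> l = m.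
Proof.
  intros H1 H2.
  exact (filterlim_locally_unique (V := C_R_NormedModule) f l m H1 H2).
Qed.

Lemma limC_plus {T : Type} (F : (T -> Prop) -> Prop) {FF : Filter F}
    (f g : T -> C) (l m : C) :
  limC f F l -> limC g F m -> limC (fun y => f y + g y)%C F (l + m)%C.
Proof.
  intros H1 H2. exact (filterlim_plus_fun (V := C_R_NormedModule) f g l m H1 H2).
Qed.

Lemma limC_scal {T : Type} (F : (T -> Prop) -> Prop) {FF : Filter F}
    (c : C) (f : T -> C) (l : C) :
  limC f F l -> limC (fun y => c * f y)%C F (c * l)%C.
Proof.
  intros H.
  apply filterlim_comp with (1 := H).
  exact (filterlim_scal_r (V := C_NormedModule) c l).
Qed.

Lemma limC_Cmod_0 {T : Type} (F : (T -> Prop) -> Prop) {FF : Filter F}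
    (f : T -> C) (B : T -> R) :
  F (fun y => Cmod (f y) <= B y) -> filterlim B F (locally 0) -> limC f F 0%C.
Proof.
  intros H1 H2. apply limC_iff; [exact FF|].
  split; apply filterlim_locally; intros eps;
    generalize (filter_and _ _ H1 (proj1 (filterlim_locally _ _) H2 eps));
    apply filter_imp; intros y [A1 A2]; change (Rabs (B y - 0) < eps) in A2;
    rewrite Rminus_0_r in A2; generalize (Rle_abs (B y)); intros A3.
  - change (Rabs (Re (f y) - 0) < eps). rewrite Rminus_0_r.
    generalize (Rabs_Re_le (f y)). lra.
  - change (Rabs (Im (f y) - 0) < eps). rewrite Rminus_0_r.
    generalize (Rabs_Im_le (f y)). lra.
Qed.

Lemma derC_series (c : nat -> C) (p q : nat -> R -> R) (M : nat -> R) (F : R -> C) (l : C) (t0 d : R) :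
  0 < d -> ex_series M ->
  (forall n t, Rabs (t - t0) < d -> is_derive (p n) t (q n t)) ->
  (forall n t, Rabs (t - t0) < d -> Cmod (c n) * Rabs (q n t) <= M n) ->
  (forall t, Rabs (t - t0) < d -> is_seriesC (fun n => c n * p n t)%C (F t)) ->
  is_seriesC (fun n => c n * q n t0)%C l -> derC F t0 l.
Proof.
  intros Hd HM Hder Hle HF Hl.
  assert (E : forall z r, Re (z * RtoC r) = Re z * r /\ Im (z * RtoC r) = Im z * r).
  { intros [a b] r. simpl. split; ring. }
  apply is_seriesC_iff in Hl.
  split.
  - apply (is_derive_series (fun n t => Re (c n) * p n t) (fun n t => Re (c n) * q n t) M _ _ _ d);
      trivial.
    + intros n t Ht. apply is_derive_scal. now apply Hder.
    + intros n t Ht. eapply Rle_trans; [|now apply (Hle n t)].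
      rewrite Rabs_mult. apply Rmult_le_compat_r; [apply Rabs_pos | apply Rabs_Re_le].
    + intros t Ht. specialize (HF t Ht). apply is_seriesC_iff in HF.
      eapply is_series_ext; [|apply HF]. intros n. apply E.
    + eapply is_series_ext; [|apply Hl]. intros n. apply E.
  - apply (is_derive_series (fun n t => Im (c n) * p n t) (fun n t => Im (c n) * q n t) M _ _ _ d);
      trivial.
    + intros n t Ht. apply is_derive_scal. now apply Hder.
    + intros n t Ht. eapply Rle_trans; [|now apply (Hle n t)].
      rewrite Rabs_mult. apply Rmult_le_compat_r; [apply Rabs_pos | apply Rabs_Im_le].
    + intros t Ht. specialize (HF t Ht). apply is_seriesC_iff in HF.
      eapply is_series_ext; [|apply HF]. intros n. apply E.
    + eapply is_series_ext; [|apply Hl]. intros n. apply E.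
Qed.


(** * Primitives with controlled growth at 1 *)

Lemma is_derive_continuous (f : R -> R) (x l : R) : is_derive f x l -> continuous f x.
Proof.
  intros H. apply (ex_derive_continuous (V := R_NormedModule) f). now exists l.
Qed.

Lemma is_derive_continuity_pt (f : R -> R) (x l : R) : is_derive f x l -> continuity_pt f x.
Proof.
  intros H. apply continuity_pt_filterlim. exact (is_derive_continuous f x l H).
Qed.

(** Both W - F and W + F are nondecreasing on the interval. *)
Lemma growth_le (F g W w : R -> R) (a b : R) :
  (forall t, a < t < b -> is_derive F t (g t)) ->
  (forall t, a < t < b -> is_derive W t (w t)) ->
  (forall t, a < t < b -> Rabs (g t) <= w t) ->
  forall s t, a < s < b -> a < t < b -> Rabs (F t - F s) <= Rabs (W t - W s).
Proof.
  intros HF HW Hle.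
  assert (Main : forall s t, a < s < b -> a < t < b -> s <= t ->
            Rabs (F t - F s) <= W t - W s).
  { intros s t Hs Ht Hst.
    assert (I : forall x, Rmin s t <= x <= Rmax s t -> a < x < b).
    { intros x. rewrite Rmin_left, Rmax_right by lra. lra. }
    assert (D1 : forall x, a < x < b -> is_derive (fun x => W x - F x) x (w x - g x)).
    { intros x Hx. apply (is_derive_minus (V := R_NormedModule)); auto. }
    assert (D2 : forall x, a < x < b -> is_derive (fun x => W x + F x) x (w x + g x)).
    { intros x Hx. apply (is_derive_plus (V := R_NormedModule)); auto. }
    destruct (MVT_gen (fun x => W x - F x) s t (fun x => w x - g x)) as [c [Hc1 Hc2]].
    - intros x Hx. apply D1, I. lra.
    - intros x Hx. exact (is_derive_continuity_pt _ _ _ (D1 x (I x Hx))).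
    - destruct (MVT_gen (fun x => W x + F x) s t (fun x => w x + g x)) as [d [Hd1 Hd2]].
      + intros x Hx. apply D2, I. lra.
      + intros x Hx. exact (is_derive_continuity_pt _ _ _ (D2 x (I x Hx))).
      + generalize (Hle c (I c Hc1)) (Hle d (I d Hd1)).
        intros L1 L2. apply Rabs_le_between in L1. apply Rabs_le_between in L2.
        apply Rabs_le. split; nra. }
  intros s t Hs Ht. destruct (Rle_dec s t) as [Hst|Hst].
  - eapply Rle_trans; [now apply Main | apply Rle_abs].
  - rewrite Rabs_minus_sym, (Rabs_minus_sym (W t)).
    eapply Rle_trans; [apply Main; trivial; lra | apply Rle_abs].
Qed.

(** The Cauchy criterion passes from W to F. *)
Lemma dominated_limit (F W : R -> R) (D : R -> Prop) (G : (R -> Prop) -> Prop)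
    {FG : ProperFilter G} (m : R) :
  (forall s t, D s -> D t -> Rabs (F t - F s) <= Rabs (W t - W s)) ->
  G D -> filterlim W G (locally m) -> exists l : R, filterlim F G (locally l).
Proof.
  intros H HD HW.
  apply (filterlim_locally_cauchy (U := R_CompleteSpace)). intros eps.
  destruct (proj2 (filterlim_locally_cauchy (U := R_CompleteSpace) (F := G) W)
              (ex_intro _ m HW) eps) as [P [HP1 HP2]].
  exists (fun t => D t /\ P t). split; [now apply filter_and|].
  intros u v [Du Pu] [Dv Pv].
  specialize (HP2 u v Pu Pv).
  change (Rabs (W v - W u) < eps) in HP2. change (Rabs (F v - F u) < eps).
  eapply Rle_lt_trans; [now apply H | exact HP2].
Qed.

Lemma at_right_0_unit : at_right 0 (fun t => 0 < t < 1).
Proof.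
  exists (mkposreal 1 Rlt_0_1). intros t Ht H0.
  change (Rabs (t - 0) < 1) in Ht. apply Rabs_lt_between in Ht. lra.
Qed.

Lemma at_left_1_unit : at_left 1 (fun t => 0 < t < 1).
Proof.
  exists (mkposreal 1 Rlt_0_1). intros t Ht H0.
  change (Rabs (t - 1) < 1) in Ht. apply Rabs_lt_between in Ht. lra.
Qed.

Lemma continuous_at_right (f : R -> R) (x : R) :
  continuous f x -> filterlim f (at_right x) (locally (f x)).
Proof.
  intros H. eapply filterlim_filter_le_1; [|exact H].
  intros P [d Hd]. exists d. intros y Hy _. now apply Hd.
Qed.

Lemma continuous_at_left (f : R -> R) (x : R) :
  continuous f x -> filterlim f (at_left x) (locally (f x)).
Proof.
  intros H. eapply filterlim_filter_le_1; [|exact H].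
  intros P [d Hd]. exists d. intros y Hy _. now apply Hd.
Qed.

(** The function (1 - t)^(-3/2).  It is what the size t (1 - t)^(-1/2) of a
    polylogarithm becomes after multiplication by the worst case 1 / (t (1 - t)) of
    a letter, and integrating it from 0 gives back the size t (1 - t)^(-1/2). *)
Definition inv_pow_3_2 (t : R) : R := / (sqrt (1 - t) * (1 - t)).

Lemma is_derive_inv_sqrt (K t : R) : t < 1 ->
  is_derive (fun t => K * (2 / sqrt (1 - t))) t (K * inv_pow_3_2 t).
Proof.
  intros Ht. unfold inv_pow_3_2.
  assert (H : 0 < sqrt (1 - t)) by (apply sqrt_lt_R0; lra).
  auto_derive.
  - change (1 + - t) with (1 - t). repeat split; lra.
  - change (1 + - t) with (1 - t).
    assert (E : sqrt (1 - t) * sqrt (1 - t) = 1 - t) by (apply sqrt_sqrt; lra).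
    revert H E. generalize (sqrt (1 - t)). intros s H <-. field. lra.
Qed.

(** The increments of the primitive based at 1/2 are at most those of
    2 K (1 - t)^(-1/2), so it has a limit at 0; subtracting that limit gives the primitive vanishing at 0. *)
Lemma primitive_real (g : R -> R) (K : R) :
  (forall t, 0 < t < 1 -> continuous g t) ->
  (forall t, 0 < t < 1 -> Rabs (g t) <= K * inv_pow_3_2 t) ->
  exists F : R -> R, (forall t, 0 < t < 1 -> is_derive F t (g t)) /\
    forall t, 0 < t < 1 -> Rabs (F t) <= K * (2 / sqrt (1 - t)) - K * 2.
Proof.
  intros Hc Hle.
  set (F0 := fun t => RInt g (1/2) t).
  assert (HF0 : forall t, 0 < t < 1 -> is_derive F0 t (g t)).
  { intros t Ht. apply (is_derive_RInt g F0 (1/2) t); [|now apply Hc].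
    exists (mkposreal (Rmin t (1 - t)) ltac:(apply Rmin_pos; lra)).
    intros y Hy. change (Rabs (y - t) < Rmin t (1 - t)) in Hy.
    generalize (Rmin_l t (1 - t)) (Rmin_r t (1 - t)). intros R1 R2.
    apply Rabs_lt_between in Hy.
    apply (RInt_correct (V := R_CompleteNormedModule) g).
    apply (ex_RInt_continuous (V := R_CompleteNormedModule)). intros z Hz. apply Hc.
    revert Hz. unfold Rmin, Rmax. destruct (Rle_dec (1/2) y); lra. }
  set (W := fun t => K * (2 / sqrt (1 - t))).
  assert (HW : forall t, t < 1 -> is_derive W t (K * inv_pow_3_2 t)).
  { intros t Ht. now apply is_derive_inv_sqrt. }
  assert (HFW : forall s t, 0 < s < 1 -> 0 < t < 1 -> Rabs (F0 t - F0 s) <= Rabs (W t - W s)).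
  { apply (growth_le F0 g W (fun t => K * inv_pow_3_2 t)); auto. intros t Ht. apply HW. lra. }
  assert (HW0 : filterlim W (at_right 0) (locally (K * 2))).
  { replace (K * 2) with (W 0).
    - apply continuous_at_right. apply (is_derive_continuous W 0 _ (HW 0 Rlt_0_1)).
    - unfold W. rewrite Rminus_0_r, sqrt_1. field. }
  destruct (dominated_limit F0 W (fun t => 0 < t < 1) (at_right 0) (K * 2) HFW
             at_right_0_unit HW0) as [l Hl].
  exists (fun t => F0 t - l). split.
  - intros t Ht. replace (g t) with (g t - 0) by ring.
    apply (is_derive_minus (V := R_NormedModule)); [now apply HF0 | apply (is_derive_const (V := R_NormedModule))].
  - intros t Ht.
    assert (Kpos : 0 <= K).
    { specialize (Hle t Ht). generalize (Rabs_pos (g t)).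
      assert (0 < inv_pow_3_2 t); [|nra].
      apply Rinv_0_lt_compat, Rmult_lt_0_compat; [apply sqrt_lt_R0|]; lra. }
    (* W is increasing, so its value at 0 bounds it from below. *)
  assert (WM : 2 * K <= W t).
    { unfold W. rewrite (Rmult_comm 2). apply Rmult_le_compat_l; [exact Kpos|].
      assert (S0 : 0 < sqrt (1 - t)) by (apply sqrt_lt_R0; lra).
      assert (S1 : sqrt (1 - t) <= 1) by (rewrite <- sqrt_1 at 2; apply sqrt_le_1_alt; lra).
      apply Rmult_le_reg_r with (sqrt (1 - t)); trivial.
      replace (2 / sqrt (1 - t) * sqrt (1 - t)) with 2 by (field; lra). lra. }
    rewrite <- (Rabs_pos_eq (K * (2 / sqrt (1 - t)) - K * 2)) by (unfold W in WM; lra).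
    refine (filterlim_le (F := at_right 0) (fun s => Rabs (F0 t - F0 s))
              (fun s => Rabs (W t - W s)) (Rabs (F0 t - l)) (Rabs (W t - K * 2)) _ _ _).
    + generalize at_right_0_unit. apply filter_imp. intros s Hs. now apply HFW.
    + apply filterlim_comp with (2 := filterlim_norm (V := R_NormedModule) (F0 t - l)).
      apply (filterlim_plus_fun (V := R_NormedModule)); [apply filterlim_const|].
      apply filterlim_comp with (1 := Hl). apply (filterlim_opp (V := R_NormedModule)).
    + apply filterlim_comp with (2 := filterlim_norm (V := R_NormedModule) (W t - K * 2)).
      apply (filterlim_plus_fun (V := R_NormedModule)); [apply filterlim_const|].
      apply filterlim_comp with (1 := HW0). apply (filterlim_opp (V := R_NormedModule)).
Qed.

Lemma inv_sqrt_le (t : R) : 0 < t < 1 -> 2 / sqrt (1 - t) - 2 <= 2 * (t / sqrt (1 - t)).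
Proof.
  intros Ht.
  assert (H : 0 < sqrt (1 - t)) by (apply sqrt_lt_R0; lra).
  assert (H2 : sqrt (1 - t) * sqrt (1 - t) = 1 - t) by (apply sqrt_sqrt; lra).
  apply Rmult_le_reg_r with (sqrt (1 - t)); trivial.
  replace ((2 / sqrt (1 - t) - 2) * sqrt (1 - t)) with (2 - 2 * sqrt (1 - t)) by (field; lra).
  replace (2 * (t / sqrt (1 - t)) * sqrt (1 - t)) with (2 * t) by (field; lra).
  nra.
Qed.

Lemma primitiveC (g : R -> C) (K : R) :
  (forall t, 0 < t < 1 -> contC g t) ->
  (forall t, 0 < t < 1 -> Cmod (g t) <= K * inv_pow_3_2 t) ->
  exists F : R -> C, (forall t, 0 < t < 1 -> derC F t (g t)) /\
    forall t, 0 < t < 1 -> Cmod (F t) <= 4 * K * (t / sqrt (1 - t)).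
Proof.
  intros Hc Hle.
  destruct (primitive_real (fun t => Re (g t)) K) as [F1 [A1 B1]].
  - intros t Ht. apply (Hc t Ht).
  - intros t Ht. eapply Rle_trans; [apply Rabs_Re_le | auto].
  - destruct (primitive_real (fun t => Im (g t)) K) as [F2 [A2 B2]].
    + intros t Ht. apply (Hc t Ht).
    + intros t Ht. eapply Rle_trans; [apply Rabs_Im_le | auto].
    + exists (fun t => (F1 t, F2 t)). split.
      * intros t Ht. split; [apply A1 | apply A2]; exact Ht.
      * intros t Ht. eapply Rle_trans; [apply Cmod_le_abs|]. simpl.
        specialize (B1 t Ht). specialize (B2 t Ht).
        generalize (inv_sqrt_le t Ht). intros HW.
        assert (Kpos : 0 <= K).
        { specialize (Hle t Ht). generalize (Cmod_ge_0 (g t)).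
          assert (0 < inv_pow_3_2 t); [|nra].
          apply Rinv_0_lt_compat, Rmult_lt_0_compat; [apply sqrt_lt_R0|]; lra. }
        nra.
Qed.

(** The majorant (1 - t)^(-1/2) is integrable up to 1. *)
Lemma limit_at_1 (F g : R -> C) (K : R) :
  (forall t, 0 < t < 1 -> derC F t (g t)) ->
  (forall t, 0 < t < 1 -> Cmod (g t) <= K / sqrt (1 - t)) ->
  exists l : C, limC F (at_left 1) l.
Proof.
  intros HF Hle.
  set (W := fun t => - 2 * K * sqrt (1 - t)).
  assert (HW : forall t, 0 < t < 1 -> is_derive W t (K / sqrt (1 - t))).
  { intros t Ht. unfold W.
    assert (H : 0 < sqrt (1 - t)) by (apply sqrt_lt_R0; lra).
    auto_derive; change (1 + - t) with (1 - t); [lra|]. field. lra. }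
  assert (HW1 : filterlim W (at_left 1) (locally 0)).
  { replace 0 with (W 1) by (unfold W; rewrite Rminus_eq_0, sqrt_0; ring).
    apply continuous_at_left. unfold W.
    apply (continuous_mult (K := R_AbsRing) (fun _ => - 2 * K) (fun t => sqrt (1 - t))).
    - apply continuous_const.
    - apply continuous_sqrt_comp.
      apply (continuous_minus (V := R_NormedModule) (fun _ => 1) (fun t => t));
      [apply continuous_const | apply continuous_id]. }
  assert (E : forall f df : R -> R, (forall t, 0 < t < 1 -> is_derive f t (df t)) ->
     (forall t, 0 < t < 1 -> Rabs (df t) <= K / sqrt (1 - t)) ->
     exists l, filterlim f (at_left 1) (locally l)).
  { intros f df H1 H2.
    apply (dominated_limit f W (fun t => 0 < t < 1) (at_left 1) 0); trivial.
    - now apply (growth_le f df W (fun t => K / sqrt (1 - t))).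
    - exact at_left_1_unit. }
  destruct (E (fun t => Re (F t)) (fun t => Re (g t))) as [l1 H1].
  - intros t Ht. apply (HF t Ht).
  - intros t Ht. eapply Rle_trans; [apply Rabs_Re_le | auto].
  - destruct (E (fun t => Im (F t)) (fun t => Im (g t))) as [l2 H2].
    + intros t Ht. apply (HF t Ht).
    + intros t Ht. eapply Rle_trans; [apply Rabs_Im_le | auto].
    + exists (l1, l2). apply limC_iff; [typeclasses eauto|]. now split.
Qed.


(** * Generalized polylogarithms as primitives *)

Lemma contC_at_left (F : R -> C) (t : R) : contC F t -> limC F (at_left t) (F t).
Proof.
  intros [A B]. apply limC_iff; [typeclasses eauto|].
  split; [apply (continuous_at_left (fun s => Re (F s))) |
          apply (continuous_at_left (fun s => Im (F s)))]; assumption.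
Qed.

Lemma contC_at_right (F : R -> C) (t : R) : contC F t -> limC F (at_right t) (F t).
Proof.
  intros [A B]. apply limC_iff; [typeclasses eauto|].
  split; [apply (continuous_at_right (fun s => Re (F s))) |
          apply (continuous_at_right (fun s => Im (F s)))]; assumption.
Qed.

Lemma filter_prod_and {T U : Type} (F : (T -> Prop) -> Prop) (G : (U -> Prop) -> Prop)
  (A : T -> Prop) (B : U -> Prop) :
  F A -> G B -> filter_prod F G (fun ab => A (fst ab) /\ B (snd ab)).
Proof. intros HA HB. apply (Filter_prod _ _ _ A B HA HB). intros x y Hx Hy. now split. Qed.

Lemma is_RInt_gen_primitive (f P : R -> C) (l : C) :
  (forall t, 0 < t < 1 -> derC P t (f t)) ->
  (forall t, 0 < t < 1 -> contC f t) ->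
  limC P (at_right 0) (RtoC 0) -> limC P (at_left 1) l ->
  is_RInt_gen (V := C_R_NormedModule) f (at_right 0) (at_left 1) l.
Proof.
  intros HP Hf H0 H1 Q HQ.
  assert (Hd : limC (fun ab : R * R => P (snd ab) + - (1) * P (fst ab))%C
                 (filter_prod (at_right 0) (at_left 1)) (l + - (1) * 0)%C).
  { apply limC_plus; [typeclasses eauto| |apply limC_scal; [typeclasses eauto|]].
    - apply filterlim_comp with (2 := H1). apply filterlim_snd.
    - apply filterlim_comp with (2 := H0). apply filterlim_fst. }
  replace (l + - (1) * 0)%C with l in Hd by ring.
  unfold filtermapi.
  generalize (filter_and (fun ab : R * R => Q (P (snd ab) + - (1) * P (fst ab))%C) _ (Hd Q HQ)
    (filter_prod_and _ _ _ _ at_right_0_unit at_left_1_unit)).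
  apply filter_imp. intros [a b] [HQab [Ha Hb]]. simpl in *.
  exists (P b + - (1) * P a)%C. split; [|exact HQab].
  assert (I : forall x, Rmin a b <= x <= Rmax a b -> 0 < x < 1).
  { intros x. unfold Rmin, Rmax. destruct (Rle_dec a b); lra. }
  replace (P b + - (1) * P a)%C with (Re (P b) - Re (P a), Im (P b) - Im (P a)).
  - apply (is_RInt_fct_extend_pair (U := R_NormedModule) (V := R_NormedModule)).
    + apply (is_RInt_derive (V := R_CompleteNormedModule) (fun s => Re (P s)) (fun s => Re (f s)));
        intros x Hx; [apply HP | apply Hf]; now apply I.
    + apply (is_RInt_derive (V := R_CompleteNormedModule) (fun s => Im (P s)) (fun s => Im (f s)));
        intros x Hx; [apply HP | apply Hf]; now apply I.
  - apply injective_projections; simpl; unfold Re, Im; ring.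
Qed.

(** The integral that defines the polylogarithm at y runs over the segment t -> y t,
    0 < t < 1.  A primitive F along [0, y] pulls back to one along this segment,
    whatever the behaviour of the integrand at the two ends. *)
Lemma GPL_cons_primitive (a : C) (s : list C) (y : R) (F : R -> C) (l : C) :
  0 < y <= 1 -> sum_Cmod (a :: s) <> 0 -> a <> y ->
  (forall t, 0 < t < y -> derC F t (/ (t - a) * GPL s t)%C) ->
  (forall t, 0 < t < y -> contC (fun t => / (t - a) * GPL s t)%C t) ->
  limC F (at_right 0) (RtoC 0) -> limC F (at_left y) l ->
  GPL (a :: s) y = l.
Proof.
  intros Hy Hs Hay HF Hc H0 Hl.
  assert (HI : forall t, 0 < t < 1 -> 0 < y * t < y) by (intros t Ht; nra).
  cbn [GPL]. destruct (Req_EM_T (sum_Cmod (a :: s)) 0) as [E|_]; [contradiction|].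
  destruct (Ceq_dec a y) as [E|_]; [contradiction|].
  apply (is_RInt_gen_unique (V := C_R_CompleteNormedModule)).
  assert (Lin : forall t, is_derive (fun t => y * t) t y).
  { intros t. auto_derive; [trivial|ring]. }
  (* The integrand is y times the derivative of F at y t. *)
  assert (Ef : forall t : R, (y / (y * t - a) * GPL s (y * t) =
                         y * (/ (RtoC (y * t)%R - a) * GPL s (RtoC (y * t)%R)))%C).
  { intros t. rewrite RtoC_mult. unfold Cdiv. ring. }
  apply (is_RInt_gen_primitive _ (fun t => F (y * t))).
  - intros t Ht. rewrite Ef. destruct (HF (y * t) (HI t Ht)) as [A B].
    assert (E : forall z : C, Re (y * z)%C = y * Re z /\ Im (y * z)%C = y * Im z).
    { intros [u v]. simpl. split; ring. }
    split; rewrite ?(proj1 (E _)), ?(proj2 (E _)).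
    + exact (is_derive_comp (V := R_NormedModule) (fun s => Re (F s)) (fun t => y * t) t _ _ A (Lin t)).
    + exact (is_derive_comp (V := R_NormedModule) (fun s => Im (F s)) (fun t => y * t) t _ _ B (Lin t)).
  - intros t Ht. destruct (Hc (y * t) (HI t Ht)) as [A B].
    assert (C1 : contC (fun t => / (RtoC (y * t)%R - a) * GPL s (RtoC (y * t)%R))%C t).
    { split.
      - apply (continuous_comp (fun t => y * t) (fun t => Re (/ (t - a) * GPL s t)%C));
          [apply (is_derive_continuous _ _ _ (Lin t)) | exact A].
      - apply (continuous_comp (fun t => y * t) (fun t => Im (/ (t - a) * GPL s t)%C));
          [apply (is_derive_continuous _ _ _ (Lin t)) | exact B]. }
    assert (C2 : contC (fun t => y * (/ (RtoC (y * t)%R - a) * GPL s (RtoC (y * t)%R)))%C t).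
    { apply (contC_mult (fun _ => RtoC y)); [|exact C1].
      split; apply continuous_const. }
    destruct C2 as [C2 C3].
    split; [eapply continuous_ext; [|exact C2] | eapply continuous_ext; [|exact C3]];
      intros u; symmetry; f_equal; exact (Ef u).
  - apply filterlim_comp with (2 := H0). intros P [d Hd].
    assert (Hdy : 0 < d / y) by (apply Rdiv_lt_0_compat; [exact (cond_pos d)|lra]).
    exists (mkposreal _ Hdy).
    intros t Ht Ht0. change (Rabs (t - 0) < d / y) in Ht.
    apply Hd; [|nra]. change (Rabs (y * t - 0) < d).
    rewrite Rminus_0_r in *. rewrite Rabs_mult, (Rabs_pos_eq y) by lra.
    apply Rmult_lt_reg_l with (/ y); [apply Rinv_0_lt_compat; lra|].
    rewrite <- Rmult_assoc, Rinv_l by lra. unfold Rdiv in Ht. lra.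
  - apply filterlim_comp with (2 := Hl). intros P [d Hd].
    assert (Hdy : 0 < d / y) by (apply Rdiv_lt_0_compat; [exact (cond_pos d)|lra]).
    exists (mkposreal _ Hdy).
    intros t Ht Ht0. change (Rabs (t - 1) < d / y) in Ht.
    apply Hd; [|nra]. change (Rabs (y * t - y) < d).
    replace (y * t - y) with (y * (t - 1)) by ring.
    rewrite Rabs_mult, (Rabs_pos_eq y) by lra.
    apply Rmult_lt_reg_l with (/ y); [apply Rinv_0_lt_compat; lra|].
    rewrite <- Rmult_assoc, Rinv_l by lra. unfold Rdiv in Ht. lra.
Qed.

(** A letter of this kind is regular on the closed path of integration. *)
Definition off_closed_path (a : C) : Prop :=
  exists K, forall t, 0 <= t <= 1 -> RtoC t <> a /\ Cmod (/ (t - a)) <= K.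

(** The bound allows simple poles at the ends of the path, so that the letters 0 and 1
    and the letters off the path are treated alike. *)
Definition off_open_path (a : C) : Prop :=
  exists K, forall t, 0 < t < 1 -> RtoC t <> a /\ Cmod (/ (t - a)) <= K / (t * (1 - t)).

(** Words whose innermost letter is away from 0: the innermost integral is O(t), and no
    logarithm of t ever appears. *)
Inductive reg_word : list C -> Prop :=
| reg_last a : off_closed_path a -> reg_word (a :: nil)
| reg_cons a s : off_open_path a -> reg_word s -> reg_word (a :: s).

Lemma off_closed_open a : off_closed_path a -> off_open_path a.
Proof.
  intros [K HK]. exists K. intros t Ht. destruct (HK t) as [A B]; [lra|].
  split; trivial. apply Rle_trans with (1 := B).
  assert (0 <= K) by (generalize (Cmod_ge_0 (/ (t - a))); lra).
  assert (0 < t * (1 - t) <= 1) by nra.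
  apply Rmult_le_reg_r with (t * (1 - t)); [lra|].
  unfold Rdiv. rewrite Rmult_assoc, Rinv_l by lra. nra.
Qed.

Lemma off_closed_path_neq_0 a : off_closed_path a -> a <> 0%C.
Proof. intros [K HK] E. destruct (HK 0) as [A _]; [lra|]. now apply A. Qed.

Lemma off_closed_path_neq_1 a : off_closed_path a -> a <> 1%C.
Proof. intros [K HK] E. destruct (HK 1) as [A _]; [lra|]. now apply A. Qed.

Lemma reg_word_sum s : reg_word s -> 0 < sum_Cmod s.
Proof.
  induction 1 as [a Ha|a s Ha Hs IH].
  - change (0 < Cmod a + 0). generalize (proj1 (Cmod_gt_0 a) (off_closed_path_neq_0 a Ha)). lra.
  - change (0 < Cmod a + sum_Cmod s). generalize (Cmod_ge_0 a). lra.
Qed.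

Lemma contC_inv (a : C) (t : R) : RtoC t <> a -> contC (fun t => / (RtoC t - a))%C t.
Proof.
  intros Ha. destruct a as [a1 a2].
  assert (N : (t + - a1) * ((t + - a1) * 1) + (0 + - a2) * ((0 + - a2) * 1) <> 0).
  { intros E. apply Ha.
    destruct (Rplus_sqr_eq_0 (t + - a1) (0 + - a2)) as [E1 E2].
    - unfold Rsqr. rewrite !Rmult_1_r in E. exact E.
    - apply injective_projections; simpl; lra. }
  split; apply (ex_derive_continuous (V := R_NormedModule)); simpl;
    auto_derive; exact N.
Qed.

Definition reg_bound (s : list C) : Prop :=
  exists K, forall t, 0 < t < 1 -> Cmod (GPL s t) <= K * (t / sqrt (1 - t)).

(** The primitive given by [primitiveC] vanishes at 0, hence it is the polylogarithm, and
    its bound is again of the form [reg_bound]. *)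
Lemma GPL_step (a : C) (s : list C) (K : R) :
  off_open_path a -> 0 < sum_Cmod (a :: s) ->
  (forall t, 0 < t < 1 -> contC (fun t => GPL s t) t) ->
  (forall t, 0 < t < 1 -> Cmod (/ (t - a) * GPL s t)%C <= K * inv_pow_3_2 t) ->
  reg_bound (a :: s) /\
  (forall t, 0 < t < 1 -> derC (fun t => GPL (a :: s) t) t (/ (t - a) * GPL s t)%C) /\
  limC (fun t : R => GPL (a :: s) t) (at_right 0) (RtoC 0).
Proof.
  intros [Ka Ha] Hs Hc Hle.
  assert (Hg : forall t, 0 < t < 1 -> contC (fun t => / (t - a) * GPL s t)%C t).
  { intros t Ht. apply contC_mult; [|now apply Hc]. apply contC_inv. now apply Ha. }
  destruct (primitiveC (fun t => / (t - a) * GPL s t)%C K Hg Hle) as [F [HF1 HF2]].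
  assert (F0 : limC F (at_right 0) (RtoC 0)).
  { apply (limC_Cmod_0 (at_right 0) F (fun t => 4 * K * (t / sqrt (1 - t)))).
    - generalize at_right_0_unit. apply filter_imp. exact HF2.
    - replace 0 with (4 * K * (0 / sqrt (1 - 0))) at 2 by (rewrite Rminus_0_r, sqrt_1; field).
      apply (continuous_at_right (fun t => 4 * K * (t / sqrt (1 - t)))).
      apply (ex_derive_continuous (V := R_NormedModule)). auto_derive.
      change (1 + - 0) with (1 - 0). rewrite Rminus_0_r, sqrt_1. lra. }
  assert (E : forall t, 0 < t < 1 -> GPL (a :: s) t = F t).
  { intros t Ht. apply (GPL_cons_primitive a s t F).
    - lra.
    - lra.
    - intros E. now apply (Ha t Ht).
    - intros u Hu. apply HF1. lra.
    - intros u Hu. apply Hg. lra.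
    - exact F0.
    - apply contC_at_left. apply (derC_contC _ _ _ (HF1 t Ht)). }
  split; [|split].
  - exists (4 * K). intros t Ht. rewrite E by trivial. now apply HF2.
  - intros t Ht. apply (derC_ext_loc F); [|now apply HF1].
    exists (mkposreal (Rmin t (1 - t)) ltac:(apply Rmin_pos; lra)).
    intros y Hy. change (Rabs (y - t) < Rmin t (1 - t)) in Hy.
    generalize (Rmin_l t (1 - t)) (Rmin_r t (1 - t)). intros R1 R2.
    apply Rabs_lt_between in Hy. symmetry. apply E. lra.
  - eapply filterlim_ext_loc; [|exact F0].
    generalize at_right_0_unit. apply filter_imp. intros t Ht. symmetry. now apply E.
Qed.

Lemma inv_pow_3_2_ge_1 t : 0 < t < 1 -> 1 <= inv_pow_3_2 t.
Proof.
  intros Ht. unfold inv_pow_3_2.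
  assert (S0 : 0 < sqrt (1 - t)) by (apply sqrt_lt_R0; lra).
  assert (S1 : sqrt (1 - t) <= 1) by (rewrite <- sqrt_1 at 2; apply sqrt_le_1_alt; lra).
  rewrite <- Rinv_1 at 1. apply Rinv_le_contravar; nra.
Qed.

(** By induction on the word: a bound K t / sqrt (1 - t) for the inner function times
    Ka / (t (1 - t)) for the letter is the hypothesis of [GPL_step]. *)
Lemma GPL_reg (s : list C) : reg_word s ->
  reg_bound s /\
  (forall t, 0 < t < 1 ->
     derC (fun t => GPL s t) t (/ (t - hd (RtoC 0) s) * GPL (tl s) t)%C) /\
  limC (fun t : R => GPL s t) (at_right 0) (RtoC 0).
Proof.
  induction 1 as [a Ha|a s Ha Hs IH].
  - destruct (Ha) as [K HK].
    apply (GPL_step a nil K).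
    + now apply off_closed_open.
    + apply reg_word_sum. now constructor.
    + intros t Ht. split; apply continuous_const.
    + intros t Ht. simpl. rewrite Cmult_1_r.
      destruct (HK t) as [_ B]; [lra|]. generalize (inv_pow_3_2_ge_1 t Ht).
      generalize (Cmod_ge_0 (/ (t - a))). nra.
  - destruct IH as [[K IH1] [IH2 _]]. destruct (Ha) as [Ka HKa].
    apply (GPL_step a s (Ka * K)).
    + exact Ha.
    + apply reg_word_sum. now constructor.
    + intros t Ht. exact (derC_contC _ _ _ (IH2 t Ht)).
    + intros t Ht. rewrite Cmod_mult.
      destruct (HKa t Ht) as [_ B].
      apply Rle_trans with (Ka / (t * (1 - t)) * (K * (t / sqrt (1 - t)))).
      * apply Rmult_le_compat; trivial; try apply Cmod_ge_0. now apply IH1.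
      * right. unfold inv_pow_3_2.
        assert (S0 : 0 < sqrt (1 - t)) by (apply sqrt_lt_R0; lra).
        field. lra.
Qed.

Lemma GPL_at_1 (a : C) (s : list C) (K : R) :
  reg_word (a :: s) -> a <> 1%C ->
  (forall t, 0 < t < 1 -> Cmod (/ (t - a) * GPL s t)%C <= K / sqrt (1 - t)) ->
  limC (fun t : R => GPL (a :: s) t) (at_left 1) (GPL (a :: s) 1%C).
Proof.
  intros Hw Ha1 HK.
  destruct (GPL_reg _ Hw) as [_ [HD H0]]. simpl in HD.
  destruct (limit_at_1 _ _ K HD HK) as [l Hl].
  replace (GPL (a :: s) 1%C) with l; [exact Hl|]. symmetry.
  apply (GPL_cons_primitive a s 1 (fun t => GPL (a :: s) t)); trivial.
  - lra.
  - apply Rgt_not_eq. now apply reg_word_sum.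
  - intros t Ht.
    assert (Hm : off_open_path a) by (inversion Hw; [now apply off_closed_open | assumption]).
    apply contC_mult.
    + apply contC_inv. destruct Hm as [? Hm]. now apply Hm.
    + inversion Hw as [b Hb|b s' Hb Hs']; subst.
      * split; apply continuous_const.
      * destruct (GPL_reg _ Hs') as [_ [HD' _]]. exact (derC_contC _ _ _ (HD' t Ht)).
Qed.

(** A first letter without pole at 1 leaves an integrand O((1 - t)^(-1/2)), although the
    inner function may be unbounded at 1; so the value at 1 is the limit of the
    values at t < 1. *)
Lemma GPL_lim_1 (a : C) (s : list C) (Ka : R) :
  reg_word s -> a <> 1%C ->
  (forall t, 0 < t < 1 -> RtoC t <> a /\ Cmod (/ (t - a)) <= Ka / t) ->
  limC (fun t : R => GPL (a :: s) t) (at_left 1) (GPL (a :: s) 1%C).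
Proof.
  intros Hs Ha1 HKa.
  assert (Hm : off_open_path a).
  { exists Ka. intros t Ht. destruct (HKa t Ht) as [A B]. split; trivial.
    apply Rle_trans with (1 := B).
    assert (P : 0 <= Ka / t) by (generalize (Cmod_ge_0 (/ (t - a))); lra).
    replace (Ka / (t * (1 - t))) with (Ka / t * (/ (1 - t))) by (field; lra).
    rewrite <- (Rmult_1_r (Ka / t)) at 1. apply Rmult_le_compat_l; trivial.
    rewrite <- Rinv_1 at 1. apply Rinv_le_contravar; lra. }
  destruct (GPL_reg _ Hs) as [[K HK] _].
  apply (GPL_at_1 a s (Ka * K)); trivial.
  - now constructor.
  - intros t Ht. rewrite Cmod_mult. destruct (HKa t Ht) as [_ B].
    apply Rle_trans with (Ka / t * (K * (t / sqrt (1 - t)))).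
    + apply Rmult_le_compat; trivial; try apply Cmod_ge_0. now apply HK.
    + right. assert (S0 : 0 < sqrt (1 - t)) by (apply sqrt_lt_R0; lra). field. lra.
Qed.


(** * The principal square root *)

Lemma acos_ratio (z : C) : z <> 0%C -> -1 <= Re z / Cmod z <= 1.
Proof.
  intros Hz. assert (P := proj1 (Cmod_gt_0 z) Hz).
  generalize (Rabs_Re_le z). intros H. apply Rabs_le_between in H.
  split; apply Rmult_le_reg_r with (Cmod z); trivial;
    unfold Rdiv; rewrite Rmult_assoc, Rinv_l by lra; lra.
Qed.

Lemma Carg_bounds (z : C) : - PI < Carg z <= PI.
Proof.
  unfold Carg. generalize (acos_bound (Re z / Cmod z)) PI_RGT_0. intros [A B] P.
  destruct (Rle_dec 0 (Im z)) as [H|H]; [lra|].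
  split; [|lra].
  enough (acos (Re z / Cmod z) <> PI) by lra.
  intros E.
  assert (Hz : z <> 0%C) by (intros ->; apply H; simpl; lra).
  assert (P' := proj1 (Cmod_gt_0 z) Hz).
  assert (E1 : Re z / Cmod z = -1).
  { rewrite <- (cos_acos (Re z / Cmod z)) by (now apply acos_ratio). rewrite E. apply cos_PI. }
  assert (E2 : Re z = - Cmod z) by (apply Rmult_eq_reg_r with (/ Cmod z);
    [unfold Rdiv in E1; rewrite E1; field; lra | apply Rinv_neq_0_compat; lra]).
  assert (E3 : Cmod z * Cmod z = Re z * Re z + Im z * Im z).
  { unfold Cmod. rewrite sqrt_sqrt by nra. unfold Re, Im. ring. }
  rewrite E2 in E3. nra.
Qed.

Lemma Cmod_Carg (z : C) : z <> 0%C ->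
  Cmod z * cos (Carg z) = Re z /\ Cmod z * sin (Carg z) = Im z.
Proof.
  intros Hz. assert (P := proj1 (Cmod_gt_0 z) Hz).
  assert (R := acos_ratio z Hz).
  assert (E3 : Cmod z * Cmod z = Re z * Re z + Im z * Im z).
  { unfold Cmod. rewrite sqrt_sqrt by nra. unfold Re, Im. ring. }
  assert (S : sqrt (1 - (Re z / Cmod z)²) = Rabs (Im z) / Cmod z).
  { replace (1 - (Re z / Cmod z)²) with ((Im z / Cmod z)²).
    - rewrite sqrt_Rsqr_abs. unfold Rdiv. rewrite Rabs_mult.
      now rewrite (Rabs_pos_eq (/ Cmod z)) by (left; now apply Rinv_0_lt_compat).
    - unfold Rsqr. field_simplify_eq; [|lra]. nra. }
  unfold Carg. destruct (Rle_dec 0 (Im z)) as [H|H].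
  - rewrite cos_acos, sin_acos by trivial. rewrite S, Rabs_pos_eq by trivial.
    split; field; lra.
  - rewrite cos_neg, sin_neg, cos_acos, sin_acos by trivial.
    rewrite S, Rabs_left by lra. split; field; lra.
Qed.

Lemma Csqrt_sqr (z : C) : (Csqrt z * Csqrt z)%C = z.
Proof.
  destruct (Ceq_dec z 0) as [->|Hz].
  - unfold Csqrt. rewrite Cmod_0, sqrt_0. ring.
  - destruct (Cmod_Carg z Hz) as [A B].
    assert (E : sqrt (Cmod z) * sqrt (Cmod z) = Cmod z) by (apply sqrt_sqrt, Cmod_ge_0).
    replace (Carg z) with (2 * (Carg z / 2)) in A, B by field.
    rewrite cos_2a in A. rewrite sin_2a in B.
    unfold Csqrt. set (s := sqrt (Cmod z)) in *. clearbody s.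
    apply injective_projections; simpl.
    + change (fst z) with (Re z). rewrite <- A, <- E. ring.
    + change (snd z) with (Im z). rewrite <- B, <- E. ring.
Qed.

(** The range of the principal square root: the open right half-plane, 0, and the upper
    imaginary half-axis. *)
Definition half_plane (w : C) : Prop := 0 < Re w \/ (Re w = 0 /\ 0 <= Im w).

Lemma Csqrt_half_plane (z : C) : half_plane (Csqrt z).
Proof.
  destruct (Carg_bounds z) as [A B]. unfold half_plane, Csqrt. simpl.
  assert (C := sqrt_pos (Cmod z)).
  destruct (Rle_lt_or_eq_dec _ _ C) as [C'|C'].
  - destruct (Rle_lt_or_eq_dec _ _ B) as [B'|B'].
    + left. rewrite Rmult_0_l, Rminus_0_r. apply Rmult_lt_0_compat; trivial.
      apply cos_gt_0; lra.
    + right. rewrite B', cos_PI2, sin_PI2. lra.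
  - right. rewrite <- C'. lra.
Qed.

Lemma Csqrt_unique (z w : C) : (w * w)%C = z -> half_plane w -> Csqrt z = w.
Proof.
  intros Hw HP. assert (HQ := Csqrt_half_plane z). assert (E := Csqrt_sqr z).
  assert (E2 : ((Csqrt z - w) * (Csqrt z + w))%C = 0%C).
  { replace ((Csqrt z - w) * (Csqrt z + w))%C with (Csqrt z * Csqrt z - w * w)%C by ring.
    rewrite E, Hw. ring. }
  destruct (Ceq_dec (Csqrt z) w) as [|Hne]; trivial.
  assert (E3 : (Csqrt z + w)%C = 0%C).
  { destruct (Ceq_dec (Csqrt z + w)%C 0) as [|Hn]; trivial.
    exfalso. revert E2. apply Cmult_neq_0; trivial.
    intros H. apply Hne. replace (Csqrt z) with (Csqrt z - w + w)%C by ring. rewrite H. ring. }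
  destruct (Csqrt z) as [a b]. destruct w as [c d]. injection E3. intros H1 H2.
  unfold half_plane in *. simpl in *. apply injective_projections; simpl; lra.
Qed.

(** Let p and q be the two square roots.  As p^2 + q^2 = 1 is real,
    Re p Im p = - Re q Im q; both real parts being nonnegative, Im p and Im q have
    opposite signs, which keeps the product p q in [half_plane]. *)
Lemma Csqrt_mult_compl (x : C) : Csqrt ((1 - x) * x)%C = (Csqrt (1 - x) * Csqrt x)%C.
Proof.
  apply Csqrt_unique.
  - replace (Csqrt (1 - x) * Csqrt x * (Csqrt (1 - x) * Csqrt x))%C
      with ((Csqrt (1 - x) * Csqrt (1 - x)) * (Csqrt x * Csqrt x))%C by ring.
    now rewrite !Csqrt_sqr.
  - assert (Hp := Csqrt_half_plane x). assert (Hq := Csqrt_half_plane (1 - x)).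
    assert (Ep := Csqrt_sqr x). assert (Eq := Csqrt_sqr (1 - x)).
    assert (E : (Csqrt x * Csqrt x + Csqrt (1 - x) * Csqrt (1 - x))%C = 1%C).
    { rewrite Ep, Eq. ring. }
    clear Ep Eq.
    destruct (Csqrt x) as [a b]. destruct (Csqrt (1 - x)) as [c d].
    injection E. intros E1 E2. unfold half_plane in *. simpl in *.
    assert (F1 : a * b = - (c * d)) by lra.
    destruct Hp as [Ha|[Ha Hb]]; destruct Hq as [Hc|[Hc Hd]].
    + left. assert (b * d <= 0); [|nra].
      assert (E3 : a * (b * d) = - c * (d * d))
        by (replace (a * (b * d)) with (a * b * d) by ring; rewrite F1; ring).
      assert (0 <= d * d) by nra. nra.
    + subst c. assert (b = 0) by (apply Rmult_eq_reg_l with a; lra). subst b. right. nra.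
    + subst a. assert (d = 0) by (apply Rmult_eq_reg_l with c; lra). subst d. right. nra.
    + subst a c. nra.
Qed.


(** * The four letters *)

Open Scope C_scope.

Lemma xi_00 x : xi 0 0 x = (1 + Csqrt x + Csqrt (1 - x)) / 2.
Proof. unfold xi. simpl Cpow. field. Qed.
Lemma xi_01 x : xi 0 1 x = (1 + Csqrt x - Csqrt (1 - x)) / 2.
Proof. unfold xi. simpl Cpow. field. Qed.
Lemma xi_10 x : xi 1 0 x = (1 - Csqrt x + Csqrt (1 - x)) / 2.
Proof. unfold xi. simpl Cpow. field. Qed.
Lemma xi_11 x : xi 1 1 x = (1 - Csqrt x - Csqrt (1 - x)) / 2.
Proof. unfold xi. simpl Cpow. field. Qed.

Lemma Csqrt_compl_sqr (x : C) :
  Csqrt (1 - x) * Csqrt (1 - x) = 1 - Csqrt x * Csqrt x.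
Proof. rewrite !Csqrt_sqr. reflexivity. Qed.

(** In terms of p = sqrt x and q = sqrt (1 - x), the four factors are
    (2t - 1 +- p +- q) / 2, and the product is a polynomial in (2t - 1)^2, p^2 and q^2. *)
Lemma xi_prod (x t : C) :
  (t - xi 0 0 x) * (t - xi 0 1 x) * (t - xi 1 0 x) * (t - xi 1 1 x)
  = t * (1 - t) * (t * (1 - t)) - x * (1 - x) / 4.
Proof.
  rewrite xi_00, xi_01, xi_10, xi_11.
  assert (E := Csqrt_compl_sqr x).
  replace (x * (1 - x)) with (Csqrt x * Csqrt x * (Csqrt (1 - x) * Csqrt (1 - x)))
    by now rewrite !Csqrt_sqr.
  set (p := Csqrt x) in *. set (q := Csqrt (1 - x)) in *. clearbody p q.
  transitivity (((2 * t - 1) * (2 * t - 1) * ((2 * t - 1) * (2 * t - 1))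
    - 2 * (2 * t - 1) * (2 * t - 1) * (p * p + q * q)
    + (p * p + q * q) * (p * p + q * q) - 4 * (p * p) * (q * q)) / 16).
  - field.
  - rewrite E. field.
Qed.

(** The logarithmic derivative of [xi_prod]. *)
Lemma xi_sum_inv (x t : C) :
  t <> xi 0 0 x -> t <> xi 0 1 x -> t <> xi 1 0 x -> t <> xi 1 1 x ->
  / (t - xi 0 0 x) + / (t - xi 0 1 x) + / (t - xi 1 0 x) + / (t - xi 1 1 x)
  = 2 * (t * (1 - t)) * (1 - 2 * t) / (t * (1 - t) * (t * (1 - t)) - x * (1 - x) / 4).
Proof.
  intros H1 H2 H3 H4. apply Cminus_eq_contra in H1, H2, H3, H4.
  rewrite <- xi_prod.
  assert (E : (t - xi 0 1 x) * (t - xi 1 0 x) * (t - xi 1 1 x)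
            + (t - xi 0 0 x) * (t - xi 1 0 x) * (t - xi 1 1 x)
            + (t - xi 0 0 x) * (t - xi 0 1 x) * (t - xi 1 1 x)
            + (t - xi 0 0 x) * (t - xi 0 1 x) * (t - xi 1 0 x)
            = 2 * (t * (1 - t)) * (1 - 2 * t)).
  { rewrite xi_00, xi_01, xi_10, xi_11.
    assert (E := Csqrt_compl_sqr x).
    set (p := Csqrt x) in *. set (q := Csqrt (1 - x)) in *. clearbody p q.
    transitivity ((2 * t - 1) * ((2 * t - 1) * (2 * t - 1) - (p * p + q * q)) / 2).
    - field.
    - rewrite E. field. }
  rewrite <- E. field. repeat split; assumption.
Qed.

(** This is |u| <= 16, the region on which the series with k^(r+1) converge absolutely. *)
Definition conv_domain (x : C) : Prop := (1 <= Cmod (4 * x * (1 - x)))%R.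

Lemma conv_domain_neq_0 (x : C) : conv_domain x -> x <> 0 /\ 1 - x <> 0.
Proof.
  unfold conv_domain. intros H. split; intros E; rewrite E in H.
  - rewrite Cmult_0_r, Cmult_0_l, Cmod_0 in H. lra.
  - rewrite Cmult_0_r, Cmod_0 in H. lra.
Qed.

(** At a root t in [0, 1] one has |4 x (1 - x)| = 16 (t (1 - t))^2, which is at least 1
    only for t = 1/2; then 4 x (1 - x) = 1, that is, x = 1/2. *)
Lemma xi_neq_real (x : C) (t : R) (l m : nat) :
  conv_domain x -> x <> 1 / 2 -> (0 <= t <= 1)%R ->
  (l = 0%nat \/ l = 1%nat) -> (m = 0%nat \/ m = 1%nat) -> RtoC t <> xi l m x.
Proof.
  intros Hd Hx Ht Hl Hm E.
  assert (P : (t - xi 0 0 x) * (t - xi 0 1 x) * (t - xi 1 0 x) * (t - xi 1 1 x) = 0).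
  { destruct Hl as [-> | ->]; destruct Hm as [-> | ->]; rewrite E; ring. }
  rewrite xi_prod in P.
  (* Solving the factored equation for x makes 4 x (1 - x) a nonnegative real number. *)
  assert (Q : 4 * x * (1 - x) = RtoC (16 * (t * (1 - t) * (t * (1 - t))))%R).
  { rewrite !RtoC_mult, !RtoC_minus.
    replace (4 * x * (1 - x)) with (16 * (x * (1 - x) / 4)) by field.
    replace (x * (1 - x) / 4) with (t * (1 - t) * (t * (1 - t))
      - (t * (1 - t) * (t * (1 - t)) - x * (1 - x) / 4)) by ring.
    rewrite P. ring. }
  unfold conv_domain in Hd. rewrite Q, Cmod_R in Hd.
  assert (B : (0 <= t * (1 - t) <= 1 / 4)%R)
    by (assert (0 <= (t - 1 / 2) * (t - 1 / 2))%R by apply Rle_0_sqr; nra).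
  rewrite Rabs_pos_eq in Hd by nra.
  assert (B2 : (1 / 4 <= t * (1 - t))%R) by nra.
  assert (Et : (t = 1 / 2)%R).
  { apply Rminus_diag_uniq, Rsqr_0_uniq. unfold Rsqr. nra. }
  apply Hx.
  assert (S : (x - 1 / 2) * (x - 1 / 2) = 0).
  { replace ((x - 1 / 2) * (x - 1 / 2)) with (1 / 4 - 4 * x * (1 - x) / 4) by field.
    rewrite Q, Et. replace (16 * (1 / 2 * (1 - 1 / 2) * (1 / 2 * (1 - 1 / 2))))%R with 1%R by field.
    field. }
  destruct (Ceq_dec (x - 1 / 2) 0) as [Z|Z].
  - replace x with (x - 1 / 2 + 1 / 2) by ring. rewrite Z. ring.
  - exfalso. revert S. now apply Cmult_neq_0.
Qed.

(** The distance from a to [0, 1] is at least |Im a|, or else the distance to the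
    nearer end when a is real. *)
Lemma off_closed_path_intro (a : C) : (forall t, (0 <= t <= 1)%R -> RtoC t <> a) -> off_closed_path a.
Proof.
  intros H.
  assert (D : exists d, (0 < d)%R /\ forall t, (0 <= t <= 1)%R -> (d <= Cmod (t - a))%R).
  { destruct (Req_dec (Im a) 0) as [E|E].
    - assert (Ha : (Re a < 0 \/ 1 < Re a)%R).
      { destruct (Rlt_dec (Re a) 0); [now left|]. destruct (Rlt_dec 1 (Re a)); [now right|].
        exfalso. apply (H (Re a)); [lra|]. apply injective_projections; simpl; [reflexivity|].
        now symmetry. }
      assert (L : forall t : R, (Rabs (t - Re a) <= Cmod (t - a))%R).
      { intros t. exact (Rabs_Re_le (t - a)). }
      destruct Ha as [Ha|Ha].
      + exists (- Re a)%R. split; [lra|]. intros t Ht. eapply Rle_trans; [|apply L].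
        eapply Rle_trans; [|apply Rle_abs]. lra.
      + exists (Re a - 1)%R. split; [lra|]. intros t Ht. eapply Rle_trans; [|apply L].
        rewrite Rabs_minus_sym. eapply Rle_trans; [|apply Rle_abs]. lra.
    - exists (Rabs (Im a)). split; [now apply Rabs_pos_lt|]. intros t Ht.
      eapply Rle_trans; [|apply Rabs_Im_le]. simpl. rewrite Rplus_0_l, Rabs_Ropp.
      apply Rle_refl. }
  destruct D as [d [Hd HD]]. exists (/ d)%R. intros t Ht. split; [now apply H|].
  rewrite Cmod_inv by (apply Cminus_eq_contra; now apply H).
  apply Rinv_le_contravar; auto.
Qed.

Lemma off_closed_path_xi (x : C) (l m : nat) :
  conv_domain x -> x <> 1 / 2 -> (l = 0%nat \/ l = 1%nat) -> (m = 0%nat \/ m = 1%nat) ->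
  off_closed_path (xi l m x).
Proof. intros. apply off_closed_path_intro. intros t Ht. now apply xi_neq_real. Qed.

Lemma off_open_path_0 : off_open_path 0.
Proof.
  exists 1%R. intros t Ht. split.
  - intros E. apply RtoC_inj in E. lra.
  - replace (t - 0) with (RtoC t) by ring.
    rewrite Cmod_inv by (intros E; apply RtoC_inj in E; lra).
    rewrite Cmod_R, Rabs_pos_eq by lra.
    replace (1 / (t * (1 - t)))%R with (/ t * / (1 - t))%R by (field; lra).
    rewrite <- (Rmult_1_r (/ t)) at 1.
    apply Rmult_le_compat_l; [left; apply Rinv_0_lt_compat; lra|].
    rewrite <- Rinv_1 at 1. apply Rinv_le_contravar; lra.
Qed.

Lemma off_open_path_1 : off_open_path 1.
Proof.
  exists 1%R. intros t Ht. split.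
  - intros E. apply RtoC_inj in E. lra.
  - rewrite <- RtoC_minus, Cmod_inv by (intros E; apply RtoC_inj in E; lra).
    rewrite Cmod_R, Rabs_left by lra.
    replace (1 / (t * (1 - t)))%R with (/ t * / - (t - 1))%R by (field; lra).
    rewrite <- (Rmult_1_l (/ - (t - 1))) at 1.
    apply Rmult_le_compat_r; [left; apply Rinv_0_lt_compat; lra|].
    rewrite <- Rinv_1 at 1. apply Rinv_le_contravar; lra.
Qed.


(** * Multiple harmonic sums *)

Open Scope R_scope.

(** Sequences indexed by k >= 1, with their weight.  The second and third rules are
    chosen for their effect on generating functions: they integrate against dZ / Z and
    dZ / (1 - Z).  Products of harmonic numbers expand with coefficients that are
    natural numbers, so closure under sums takes the place of linear combinations. *)
Inductive mhs : nat -> (nat -> R) -> Prop :=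
| mhs_inv : mhs 1 (fun k => / INR k)
| mhs_div n a : mhs n a -> mhs (S n) (fun k => a k / INR k)
| mhs_sum n a : mhs n a -> mhs (S n) (fun k => sum_n_m a 1 (pred k) / INR k)
| mhs_plus n a b : mhs n a -> mhs n b -> mhs n (fun k => a k + b k)
| mhs_ext n a b : mhs n a -> (forall k, (1 <= k)%nat -> a k = b k) -> mhs n b.

Lemma sum_1_0 (a : nat -> R) : sum_n_m a 1 0 = 0.
Proof. exact (sum_n_m_zero (G := R_AbelianMonoid) a 1 0 (Nat.lt_succ_diag_r 0)). Qed.

Lemma sum_1_S (a : nat -> R) m : sum_n_m a 1 (S m) = sum_n_m a 1 m + a (S m).
Proof. exact (sum_n_Sm (G := R_AbelianMonoid) a 1 m ltac:(lia)). Qed.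

Lemma mhs_div_pow (n : nat) (a : nat -> R) (r : nat) :
  mhs n a -> mhs (n + r) (fun k => a k / INR k ^ r).
Proof.
  intros H. induction r as [|r IH].
  - rewrite Nat.add_0_r. apply (mhs_ext _ a); trivial.
    intros k _. simpl. field.
  - rewrite Nat.add_succ_r. eapply mhs_ext; [exact (mhs_div _ _ IH)|].
    intros k Hk. assert (INR k <> 0) by (apply not_0_INR; lia).
    simpl. field. split; trivial. now apply pow_nonzero.
Qed.

Lemma mhs_pow (r : nat) : (1 <= r)%nat -> mhs r (fun k => / INR k ^ r).
Proof.
  intros Hr. destruct r as [|r]; [lia|].
  eapply mhs_ext; [exact (mhs_div_pow 1 _ r mhs_inv)|].
  intros k Hk. assert (INR k <> 0) by (apply not_0_INR; lia).
  simpl. field. split; trivial. now apply pow_nonzero.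
Qed.

(** The product rule for differences, as H_j B_j - H_(j-1) B_(j-1) has three terms. *)
Lemma harmonic_mul_sum (r : nat) (a : nat -> R) (m : nat) :
  harmonic r m * sum_n_m a 1 m =
  sum_n_m (fun j => sum_n_m a 1 (pred j) / INR j ^ r
                    + (harmonic r (pred j) * a j + a j / INR j ^ r)) 1 m.
Proof.
  induction m as [|m IH].
  - rewrite !sum_1_0. apply Rmult_0_r.
  - rewrite !sum_1_S, <- IH. unfold harmonic. rewrite sum_1_S. simpl pred.
    unfold Rdiv. ring.
Qed.

(** The harmonic number is taken at k - 1 because strict inequalities are what the
    rules of [mhs] produce; [harmonic_mul_sum] then expresses the product with a sum by
    terms already treated. *)
Lemma mhs_mul_harmonic_pred (r n : nat) (a : nat -> R) :
  (1 <= r)%nat -> mhs n a -> mhs (r + n) (fun k => harmonic r (pred k) * a k).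
Proof.
  intros Hr. induction 1 as [|n a Ha IH|n a Ha IH|n a b Ha IHa Hb IHb|n a b Ha IH E].
  - rewrite Nat.add_comm. apply (mhs_sum _ _ (mhs_pow r Hr)).
  - rewrite Nat.add_succ_r. eapply mhs_ext; [exact (mhs_div _ _ IH)|].
    intros k _. unfold Rdiv. ring.
  - rewrite Nat.add_succ_r.
    eapply mhs_ext.
    + apply mhs_sum. apply mhs_plus; [|apply mhs_plus].
      (* The sum already carries one division by k, and r - 1 further ones complete k^r. *)
      * replace (r + n)%nat with (S n + pred r)%nat by lia.
        exact (mhs_div_pow _ _ (pred r) (mhs_sum _ _ Ha)).
      * exact IH.
      * rewrite Nat.add_comm. exact (mhs_div_pow _ _ r Ha).
    + intros k Hk. cbv beta.
      transitivity (harmonic r (pred k) * sum_n_m a 1 (pred k) / INR k);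
        [|unfold Rdiv; ring].
      f_equal.
      rewrite harmonic_mul_sum. apply sum_n_m_ext_loc. intros j Hj.
      change plus with Rplus. f_equal.
      assert (INR j <> 0) by (apply not_0_INR; lia).
      replace r with (S (pred r)) at 2 by lia. simpl. field.
      split; trivial. now apply pow_nonzero.
  - eapply mhs_ext; [exact (mhs_plus _ _ _ IHa IHb)|]. intros k _. simpl. ring.
  - eapply mhs_ext; [exact IH|]. intros k Hk. simpl. now rewrite E.
Qed.

Lemma mhs_mul_harmonic (r n : nat) (a : nat -> R) :
  (1 <= r)%nat -> mhs n a -> mhs (r + n) (fun k => harmonic r k * a k).
Proof.
  intros Hr Ha.
  eapply mhs_ext.
  - apply mhs_plus; [exact (mhs_mul_harmonic_pred r n a Hr Ha)|].
    rewrite Nat.add_comm. exact (mhs_div_pow _ _ r Ha).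
  - intros k Hk. destruct k as [|k]; [lia|]. simpl pred. unfold harmonic.
    rewrite sum_1_S. unfold Rdiv. ring.
Qed.

Lemma mhs_harmonic_prod (r : nat) (rs : list nat) :
  (1 <= r)%nat -> List.Forall (fun rj => (1 <= rj)%nat) rs ->
  mhs (list_sum rs + r) (fun k => harmonic_prod rs k / INR k ^ r).
Proof.
  intros Hr. induction 1 as [|s rs Hs Hrs IH].
  - eapply mhs_ext; [exact (mhs_pow r Hr)|]. intros k _. unfold harmonic_prod. simpl.
    unfold Rdiv. ring.
  - simpl list_sum. rewrite <- Nat.add_assoc.
    eapply mhs_ext; [exact (mhs_mul_harmonic s _ _ Hs IH)|]. intros k _.
    unfold harmonic_prod. simpl. unfold Rdiv. ring.
Qed.

(** The fourth root of k; the estimates use integer powers of it instead of real exponents. *)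
Definition root4 (k : nat) : R := sqrt (sqrt (INR k)).

Lemma root4_4 k : root4 k ^ 4 = INR k.
Proof.
  replace (root4 k ^ 4) with ((root4 k * root4 k) * (root4 k * root4 k)) by ring.
  unfold root4. rewrite sqrt_sqrt by apply sqrt_pos. apply sqrt_sqrt, pos_INR.
Qed.

Lemma root4_pos k : (1 <= k)%nat -> 1 <= root4 k.
Proof.
  intros Hk. unfold root4. rewrite <- sqrt_1. apply sqrt_le_1_alt.
  rewrite <- sqrt_1. apply sqrt_le_1_alt. change 1 with (INR 1). now apply le_INR.
Qed.

Lemma root4_le j k : (j <= k)%nat -> root4 j <= root4 k.
Proof. intros H. apply sqrt_le_1_alt, sqrt_le_1_alt, le_INR, H. Qed.

(** With b = k^(1/4) and a = (k - 1)^(1/4), one has 1 = b^4 - a^4 <= 4 (b - a) b^3. *)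
Lemma root4_step k : (1 <= k)%nat -> / root4 k ^ 3 <= 4 * (root4 k - root4 (pred k)).
Proof.
  intros Hk. assert (P := root4_pos k Hk).
  assert (L : root4 (pred k) <= root4 k) by (apply root4_le; lia).
  assert (N : 0 <= root4 (pred k)) by apply sqrt_pos.
  assert (E : root4 k ^ 4 - root4 (pred k) ^ 4 = 1).
  { rewrite !root4_4. destruct k as [|k]; [lia|]. simpl pred. rewrite S_INR. ring. }
  revert P L N E. generalize (root4 k) (root4 (pred k)). intros b a P L N E.
  assert (B : 0 < b ^ 3) by (apply pow_lt; lra).
  apply Rmult_le_reg_r with (b ^ 3); trivial. rewrite Rinv_l by lra.
  rewrite <- E.
  replace (b ^ 4 - a ^ 4) with ((b - a) * (b ^ 3 + b ^ 2 * a + b * a ^ 2 + a ^ 3)) by ring.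
  assert (A2 : a ^ 2 <= b ^ 2) by (apply pow_incr; lra).
  assert (A3 : a ^ 3 <= b ^ 3) by (apply pow_incr; lra).
  assert (b ^ 2 * a <= b ^ 3) by (replace (b ^ 3) with (b ^ 2 * b) by ring;
    apply Rmult_le_compat_l; [apply pow_le; lra | lra]).
  assert (b * a ^ 2 <= b ^ 3) by (replace (b ^ 3) with (b * b ^ 2) by ring;
    apply Rmult_le_compat_l; lra).
  replace (4 * (b - a) * b ^ 3) with ((b - a) * (4 * b ^ 3)) by ring.
  apply Rmult_le_compat_l; lra.
Qed.

Lemma root4_0 : root4 0 = 0.
Proof. unfold root4. simpl. now rewrite sqrt_0, sqrt_0. Qed.

(** Elements of the class are really O(log^n k / k).  The weaker O(k^(-3/4)) is enough and
    is stable under averaging, because the sum of j^(-3/4) over j < k is O(k^(1/4)). *)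
Lemma mhs_bound (n : nat) (a : nat -> R) : mhs n a ->
  exists K, forall k, (1 <= k)%nat -> 0 <= a k <= K / root4 k ^ 3.
Proof.
  induction 1 as [|n a Ha [K IH]|n a Ha [K IH]|n a b Ha [K IHa] Hb [K' IHb]|n a b Ha [K IH] E].
  - exists 1. intros k Hk. assert (P := root4_pos k Hk). rewrite <- root4_4.
    assert (0 < root4 k ^ 3) by (apply pow_lt; lra).
    split.
    + left. apply Rinv_0_lt_compat. apply pow_lt. lra.
    + unfold Rdiv. rewrite Rmult_1_l. apply Rinv_le_contravar; trivial.
      replace (root4 k ^ 4) with (root4 k ^ 3 * root4 k) by ring. nra.
  - exists K. intros k Hk. specialize (IH k Hk).
    assert (1 <= INR k) by (change 1 with (INR 1); now apply le_INR).
    split.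
    + apply Rdiv_le_0_compat; lra.
    + apply Rle_trans with (a k); [|apply IH].
      apply Rmult_le_reg_r with (INR k); [lra|].
      unfold Rdiv. rewrite Rmult_assoc, Rinv_l by lra. nra.
  - assert (KP : 0 <= K).
    { specialize (IH 1%nat (le_n 1)). assert (P := root4_pos 1 (le_n 1)).
      assert (0 < root4 1 ^ 3) by (apply pow_lt; lra).
      apply Rmult_le_reg_r with (/ root4 1 ^ 3); [now apply Rinv_0_lt_compat|].
      unfold Rdiv in IH. lra. }
    assert (S : forall m, 0 <= sum_n_m a 1 m <= 4 * K * root4 m).
    { induction m as [|m IHm].
      - rewrite sum_1_0, root4_0. lra.
      - rewrite sum_1_S. specialize (IH (S m) ltac:(lia)).
        assert (T := root4_step (S m) ltac:(lia)). simpl pred in T.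
        split; [lra|]. unfold Rdiv in IH.
        assert (K * / root4 (S m) ^ 3 <= K * (4 * (root4 (S m) - root4 m)))
          by (apply Rmult_le_compat_l; lra).
        lra. }
    exists (4 * K). intros k Hk. assert (P := root4_pos k Hk).
    assert (1 <= INR k) by (change 1 with (INR 1); now apply le_INR).
    destruct (S (pred k)) as [S1 S2].
    split.
    + apply Rdiv_le_0_compat; lra.
    + assert (L : root4 (pred k) <= root4 k) by (apply root4_le; lia).
      apply Rle_trans with (4 * K * root4 k / INR k).
      * apply Rmult_le_compat_r; [left; apply Rinv_0_lt_compat; lra|].
        apply Rle_trans with (1 := S2). apply Rmult_le_compat_l; lra.
      * right. rewrite <- (root4_4 k). field. lra.
  - exists (K + K'). intros k Hk. specialize (IHa k Hk). specialize (IHb k Hk).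
    unfold Rdiv in *. rewrite Rmult_plus_distr_r. lra.
  - exists K. intros k Hk. rewrite <- E by trivial. now apply IH.
Qed.

Lemma mhs_bounded (n : nat) (a : nat -> R) : mhs n a ->
  exists K, forall k, (1 <= k)%nat -> Rabs (a k) <= K.
Proof.
  intros H. destruct (mhs_bound n a H) as [K HK]. exists K. intros k Hk.
  destruct (HK k Hk) as [A B]. rewrite Rabs_pos_eq by trivial.
  apply Rle_trans with (1 := B). assert (P := root4_pos k Hk).
  assert (0 < root4 k ^ 3) by (apply pow_lt; lra).
  assert (1 <= root4 k ^ 3) by (apply pow_R1_Rle; lra).
  assert (0 <= K).
  { apply Rmult_le_reg_r with (/ root4 k ^ 3); [now apply Rinv_0_lt_compat|].
    unfold Rdiv in *. lra. }
  apply Rmult_le_reg_r with (root4 k ^ 3); trivial.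
  unfold Rdiv. rewrite Rmult_assoc, Rinv_l by lra. nra.
Qed.

(** Convergence of the sum of k^(-5/4), by comparison with a telescoping sum of k^(-1/4). *)
Lemma ex_series_root4 : ex_series (fun n => / root4 (S n) ^ 5).
Proof.
  assert (T : forall n, / root4 (S (S n)) ^ 5 <= 4 * (/ root4 (S n) - / root4 (S (S n)))).
  { intros n. assert (T := root4_step (S (S n)) ltac:(lia)). simpl pred in T.
    assert (P := root4_pos (S n) ltac:(lia)). assert (P' := root4_pos (S (S n)) ltac:(lia)).
    assert (L : root4 (S n) <= root4 (S (S n))) by (apply root4_le; lia).
    revert T P P' L. generalize (root4 (S n)) (root4 (S (S n))). intros a b T P P' L.
    replace (/ a - / b) with ((b - a) * / (a * b)) by (field; lra).
    replace (/ b ^ 5) with (/ b ^ 3 * / (b * b)) by (field; lra).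
    rewrite <- Rmult_assoc. apply Rmult_le_compat; trivial.
    - left. apply Rinv_0_lt_compat, pow_lt. lra.
    - left. apply Rinv_0_lt_compat. nra.
    - apply Rinv_le_contravar; nra. }
  apply ex_series_incr_1.
  assert (Pos : forall n, 0 <= / root4 (S (S n)) ^ 5).
  { intros n. left. apply Rinv_0_lt_compat, pow_lt.
    assert (P := root4_pos (S (S n)) ltac:(lia)). lra. }
  assert (B : forall n, sum_n (fun n => / root4 (S (S n)) ^ 5) n <= 4 * (/ root4 1 - / root4 (S (S n)))).
  { induction n as [|n IH].
    - rewrite sum_O. apply T.
    - rewrite sum_Sn. specialize (T (S n)).
      change plus with Rplus. lra. }
  destruct (ex_finite_lim_seq_incr (sum_n (fun n => / root4 (S (S n)) ^ 5)) (4 * / root4 1)) as [l Hl].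
  - intros n. rewrite sum_Sn. specialize (Pos (S n)). change plus with Rplus. lra.
  - intros n. specialize (B n).
    assert (0 < / root4 (S (S n))).
    { apply Rinv_0_lt_compat. assert (P := root4_pos (S (S n)) ltac:(lia)). lra. }
    lra.
  - exists l. exact Hl.
Qed.


(** * The generating functions in the variable t *)

Definition CSeries (c : nat -> C) : C :=
  (Series (fun n => Re (c n)), Series (fun n => Im (c n))).

Lemma CSeries_correct (c : nat -> C) (M : nat -> R) :
  (forall n, Cmod (c n) <= M n) -> ex_series M -> is_seriesC c (CSeries c).
Proof.
  intros H HM. apply is_seriesC_iff. split; apply Series_correct.
  - apply (ex_series_le (V := R_CompleteNormedModule) _ M); trivial.
    intros n. eapply Rle_trans; [apply (Rabs_Re_le (c n)) | apply H].
  - apply (ex_series_le (V := R_CompleteNormedModule) _ M); trivial.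
    intros n. eapply Rle_trans; [apply (Rabs_Im_le (c n)) | apply H].
Qed.

Lemma is_seriesC_unique (c : nat -> C) (l m : C) :
  is_seriesC c l -> is_seriesC c m -> l = m.
Proof.
  intros H1 H2. apply is_seriesC_iff in H1, H2.
  apply injective_projections.
  - exact (eq_trans (eq_sym (is_series_unique _ _ (proj1 H1))) (is_series_unique _ _ (proj1 H2))).
  - exact (eq_trans (eq_sym (is_series_unique _ _ (proj2 H1))) (is_series_unique _ _ (proj2 H2))).
Qed.

Lemma CSeries_unique (c : nat -> C) (l : C) : is_seriesC c l -> CSeries c = l.
Proof.
  intros H. apply is_seriesC_iff in H. apply injective_projections; simpl.
  - apply (is_series_unique _ _ (proj1 H)).
  - apply (is_series_unique _ _ (proj2 H)).
Qed.

Lemma is_seriesC_scal (k : C) (c : nat -> C) (l : C) :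
  is_seriesC c l -> is_seriesC (fun n => k * c n)%C (k * l)%C.
Proof. exact (is_series_scal (V := C_NormedModule) k c l). Qed.

Lemma is_seriesC_plus (c d : nat -> C) (l m : C) :
  is_seriesC c l -> is_seriesC d m -> is_seriesC (fun n => c n + d n)%C (l + m)%C.
Proof. exact (is_series_plus (V := C_NormedModule) c d l m). Qed.

Lemma is_seriesC_ext (c d : nat -> C) (l : C) :
  (forall n, c n = d n) -> is_seriesC c l -> is_seriesC d l.
Proof. exact (is_series_ext (V := C_NormedModule) c d l). Qed.

Lemma is_seriesC_0 : is_seriesC (fun _ => RtoC 0) (RtoC 0).
Proof.
  apply (filterlim_ext (fun _ => RtoC 0)); [|apply filterlim_const].
  intros n. induction n as [|n IH].
  - now rewrite sum_O.
  - rewrite sum_Sn, <- IH. change (RtoC 0 = RtoC 0 + RtoC 0)%C. ring.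
Qed.

(** Every term of the geometric sum is at least the last one. *)
Lemma sum_geom_ge (s : R) (n : nat) : 0 <= s <= 1 ->
  INR (S n) * s ^ n <= sum_n (fun k => s ^ k) n.
Proof.
  intros Hs. induction n as [|n IH].
  - rewrite sum_O. simpl. lra.
  - rewrite sum_Sn. change plus with Rplus. rewrite S_INR.
    assert (P : 0 <= s ^ n) by (apply pow_le; lra).
    assert (Q := pos_INR (S n)).
    change (s ^ S n) with (s * s ^ n).
    assert (INR (S n) * (s * s ^ n) <= INR (S n) * s ^ n)
      by (apply Rmult_le_compat_l; trivial; nra).
    lra.
Qed.

(** With s = sqrt r, the factors (n + 1) s^n are bounded, which leaves a geometric series in s. *)
Lemma ex_series_n_geom (r : R) : 0 <= r < 1 -> ex_series (fun n => INR (S n) * r ^ n).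
Proof.
  intros Hr. set (s := sqrt r).
  assert (Es : s * s = r) by (apply sqrt_sqrt; lra).
  assert (S0 : 0 <= s) by apply sqrt_pos.
  assert (S1 : s < 1) by nra.
  assert (B : forall n, INR (S n) * s ^ n <= / (1 - s)).
  { intros n. apply Rle_trans with (1 := sum_geom_ge s n ltac:(lra)).
    rewrite sum_n_Reals.
    assert (E : sum_f_R0 (fun k => s ^ k) n = (1 - s ^ S n) / (1 - s)) by (apply tech3; lra).
    rewrite E. unfold Rdiv. rewrite <- (Rmult_1_l (/ (1 - s))) at 2.
    apply Rmult_le_compat_r; [left; apply Rinv_0_lt_compat; lra|].
    assert (0 <= s ^ S n) by (now apply pow_le). lra. }
  apply (ex_series_le (V := R_CompleteNormedModule) _ (fun n => / (1 - s) * s ^ n)).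
  - intros n. change (Rabs (INR (S n) * r ^ n) <= / (1 - s) * s ^ n).
    rewrite <- Es, Rpow_mult_distr, <- Rmult_assoc.
    assert (P : 0 <= s ^ n) by (now apply pow_le). assert (Q := pos_INR (S n)).
    rewrite Rabs_pos_eq by (apply Rmult_le_pos; trivial; apply Rmult_le_pos; trivial).
    apply Rmult_le_compat_r; trivial.
  - apply (ex_series_scal_l (V := R_NormedModule) (/ (1 - s))). apply ex_series_geom.
    rewrite Rabs_pos_eq; lra.
Qed.

(** The real factor of Z(t) = u t^2 (1 - t)^2. *)
Definition quartic (t : R) : R := t * (1 - t) * (t * (1 - t)).
Definition dquartic (t : R) : R := 2 * (t * (1 - t)) * (1 - 2 * t).

Lemma is_derive_quartic t : is_derive quartic t (dquartic t).
Proof. unfold quartic, dquartic. auto_derive; trivial. ring. Qed.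

Lemma quartic_bounds t : 0 <= t <= 1 -> 0 <= quartic t <= 1 / 16.
Proof.
  intros Ht. unfold quartic.
  assert (0 <= (t - 1 / 2) * (t - 1 / 2)) by apply Rle_0_sqr.
  assert (0 <= t * (1 - t) <= 1 / 4) by nra. nra.
Qed.

Lemma quartic_lt t : 0 <= t <= 1 -> t <> 1 / 2 -> quartic t < 1 / 16.
Proof.
  intros Ht Hh. unfold quartic.
  assert (0 < (t - 1 / 2) * (t - 1 / 2)) by (apply Rsqr_pos_lt; lra).
  assert (0 <= t * (1 - t) < 1 / 4) by nra. nra.
Qed.

Lemma quartic_pos t : 0 < t < 1 -> 0 < quartic t.
Proof. intros Ht. unfold quartic. assert (0 < t * (1 - t)) by nra. nra. Qed.

Definition gen_series (a : nat -> R) (u : C) (t : R) : C :=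
  CSeries (fun n => a (S n) * (u * quartic t) ^ S n)%C.

Lemma gen_series_correct (a : nat -> R) (K : R) (u : C) (t : R) :
  (forall k, (1 <= k)%nat -> Rabs (a k) <= K * INR k) -> Cmod (u * quartic t) < 1 ->
  is_seriesC (fun n => a (S n) * (u * quartic t) ^ S n)%C (gen_series a u t).
Proof.
  intros Ha Hu. set (r := Cmod (u * quartic t)) in *.
  assert (R0 : 0 <= r) by apply Cmod_ge_0.
  apply (CSeries_correct _ (fun n => K * (INR (S n) * r ^ n))).
  - intros n. rewrite Cmod_mult, Cmod_pow, Cmod_R. fold r.
    specialize (Ha (S n) ltac:(lia)). rewrite <- Rmult_assoc.
    apply Rmult_le_compat; trivial; try apply Rabs_pos.
    + now apply pow_le.
    + simpl. assert (0 <= r ^ n) by now apply pow_le. nra.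
  - apply (ex_series_scal_l (V := R_NormedModule) K). apply ex_series_n_geom. lra.
Qed.

Lemma bounded_linear (a : nat -> R) (K : R) :
  (forall k, (1 <= k)%nat -> Rabs (a k) <= K) ->
  forall k, (1 <= k)%nat -> Rabs (a k) <= K * INR k.
Proof.
  intros Ha k Hk. specialize (Ha k Hk).
  assert (0 <= K) by (generalize (Rabs_pos (a k)); lra).
  assert (1 <= INR k) by (change 1 with (INR 1); now apply le_INR). nra.
Qed.

(** This symmetry makes it possible to pass the point t = 1/2, where |Z| may equal 1. *)
Lemma gen_series_sym (a : nat -> R) (u : C) (t : R) : gen_series a u (1 - t) = gen_series a u t.
Proof.
  unfold gen_series. replace (quartic (1 - t)) with (quartic t); trivial.
  unfold quartic. ring.
Qed.

Lemma Cmod_mul_quartic (u : C) (t : R) : 0 <= t <= 1 -> Cmod (u * quartic t) = Cmod u * quartic t.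
Proof.
  intros Ht. rewrite Cmod_mult, Cmod_R, Rabs_pos_eq; trivial. now apply quartic_bounds.
Qed.

Lemma mul_quartic_near (u : C) (t0 : R) : 0 < t0 < 1 -> Cmod (u * quartic t0) < 1 ->
  exists r d, 0 <= r < 1 /\ 0 < d /\
    forall t, Rabs (t - t0) < d -> 0 < t < 1 /\ Cmod (u * quartic t) <= r.
Proof.
  intros Ht Hu. rewrite Cmod_mul_quartic in Hu by lra.
  set (f := fun t => Cmod u * quartic t).
  assert (Hc : continuous f t0).
  { apply (is_derive_continuous f t0 (Cmod u * dquartic t0)). apply is_derive_scal, is_derive_quartic. }
  assert (P : 0 < (1 - f t0) / 2) by (unfold f; lra).
  destruct (proj1 (filterlim_locally f (f t0)) Hc (mkposreal _ P)) as [d Hd].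
  exists ((1 + f t0) / 2), (Rmin d (Rmin t0 (1 - t0))).
  assert (F0 : 0 <= f t0).
  { apply Rmult_le_pos; [apply Cmod_ge_0|]. apply quartic_bounds. lra. }
  assert (D0 := cond_pos d).
  assert (M1 := Rmin_l d (Rmin t0 (1 - t0))). assert (M2 := Rmin_r d (Rmin t0 (1 - t0))).
  assert (M3 := Rmin_l t0 (1 - t0)). assert (M4 := Rmin_r t0 (1 - t0)).
  split; [unfold f in *; lra|]. split; [repeat apply Rmin_pos; lra|].
  intros t H.
  assert (H' := H). apply Rabs_lt_between in H'.
  assert (T : 0 < t < 1) by lra. split; trivial.
  rewrite Cmod_mul_quartic by lra. fold (f t).
  assert (B : Rabs (f t - f t0) < (1 - f t0) / 2).
  { apply (Hd t). change (Rabs (t - t0) < d). lra. }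
  apply Rabs_lt_between in B. lra.
Qed.

Lemma gen_series_derive (a : nat -> R) (K : R) (u : C) (t0 : R) (l : C) :
  (forall k, (1 <= k)%nat -> Rabs (a k) <= K) ->
  0 < t0 < 1 -> Cmod (u * quartic t0) < 1 ->
  is_seriesC (fun n => a (S n) * u ^ S n * (INR (S n) * dquartic t0 * quartic t0 ^ n)%R)%C l ->
  derC (gen_series a u) t0 l.
Proof.
  intros Ha Ht Hu Hl.
  destruct (mul_quartic_near u t0 Ht Hu) as [r [d [Hr [Hd H]]]].
  assert (K0 : 0 <= K) by (generalize (Ha 1%nat (le_n 1)) (Rabs_pos (a 1%nat)); lra).
  apply (derC_series (fun n => a (S n) * u ^ S n)%C (fun n t => quartic t ^ S n)
           (fun n t => INR (S n) * dquartic t * quartic t ^ n)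
           (fun n => K * Cmod u * (INR (S n) * r ^ n)) _ _ _ d Hd).
  - apply (ex_series_scal_l (V := R_NormedModule) (K * Cmod u)). now apply ex_series_n_geom.
  - intros n t _. exact (is_derive_pow quartic (S n) t _ (is_derive_quartic t)).
  - intros n t T. destruct (H t T) as [T1 T2]. rewrite Cmod_mul_quartic in T2 by lra.
    rewrite Cmod_mult, Cmod_pow, Cmod_R, !Rabs_mult.
    assert (Z := quartic_bounds t ltac:(lra)).
    rewrite (Rabs_pos_eq (INR (S n))) by apply pos_INR.
    rewrite (Rabs_pos_eq (quartic t ^ n)) by (apply pow_le; lra).
    assert (D : Rabs (dquartic t) <= 1).
    { unfold dquartic. apply Rabs_le.
      assert (0 <= (t - 1 / 2) * (t - 1 / 2)) by apply Rle_0_sqr.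
      assert (0 <= t * (1 - t) <= 1 / 4) by nra. split; nra. }
    replace (Rabs (a (S n)) * Cmod u ^ S n * (INR (S n) * Rabs (dquartic t) * quartic t ^ n))
      with ((Rabs (a (S n)) * Rabs (dquartic t)) * Cmod u * (INR (S n) * (Cmod u * quartic t) ^ n))
      by (rewrite Rpow_mult_distr; simpl; ring).
    assert (U := Cmod_ge_0 u).
    apply Rmult_le_compat.
    + repeat apply Rmult_le_pos; trivial; apply Rabs_pos.
    + apply Rmult_le_pos; [apply pos_INR | apply pow_le; nra].
    + apply Rmult_le_compat_r; trivial. rewrite <- (Rmult_1_r K).
      apply Rmult_le_compat; trivial; try apply Rabs_pos. apply Ha. lia.
    + apply Rmult_le_compat_l; [apply pos_INR|]. apply pow_incr. split; [nra|lra].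
  - intros t T. destruct (H t T) as [T1 T2].
    eapply is_seriesC_ext; [|apply (gen_series_correct a K u t); [|lra]].
    + intros n. cbv beta. rewrite Cpow_mult_l, RtoC_pow. ring.
    + now apply bounded_linear.
  - exact Hl.
Qed.

(** Abel summation: multiplication by 1 - Z undoes the partial sums. *)
Lemma partial_sums_series (a : nat -> R) (K : R) (Z l : C) :
  (forall k, (1 <= k)%nat -> Rabs (a k) <= K) -> Cmod Z < 1 ->
  is_seriesC (fun n => a (S n) * Z ^ S n)%C l ->
  is_seriesC (fun n => sum_n_m a 1 n * Z ^ n)%C (l / (1 - Z))%C.
Proof.
  intros Ha HZ Hl.
  assert (K0 : 0 <= K) by (generalize (Ha 1%nat (le_n 1)) (Rabs_pos (a 1%nat)); lra).
  assert (B : forall n, Rabs (sum_n_m a 1 n) <= K * INR n).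
  { induction n as [|n IH].
    - rewrite sum_1_0, Rabs_R0. simpl. lra.
    - rewrite sum_1_S, S_INR. specialize (Ha (S n) ltac:(lia)).
      apply Rle_trans with (1 := Rabs_triang _ _). lra. }
  set (s := CSeries (fun n => sum_n_m a 1 n * Z ^ n)%C).
  assert (Hs : is_seriesC (fun n => sum_n_m a 1 n * Z ^ n)%C s).
  { apply (CSeries_correct _ (fun n => K * (INR (S n) * Cmod Z ^ n))).
    - intros n. rewrite Cmod_mult, Cmod_pow, Cmod_R, <- Rmult_assoc.
      apply Rmult_le_compat_r; [apply pow_le, Cmod_ge_0|].
      apply Rle_trans with (1 := B n). apply Rmult_le_compat_l; trivial.
      apply le_INR. lia.
    - apply (ex_series_scal_l (V := R_NormedModule) K). apply ex_series_n_geom.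
      split; [apply Cmod_ge_0 | exact HZ]. }
  (* A_(n+1) Z^(n+1) = Z (A_n Z^n) + a_(n+1) Z^(n+1), and A_0 = 0. *)
  assert (E : s = (Z * s + l)%C).
  { apply (is_seriesC_unique (fun n => sum_n_m a 1 (S n) * Z ^ S n)%C).
    - apply (is_series_incr_1 (V := C_NormedModule) (fun n => sum_n_m a 1 n * Z ^ n)%C).
      rewrite sum_1_0.
      assert (E : (s + 0 * Z ^ 0)%C = s) by ring.
      change (is_seriesC (fun n => sum_n_m a 1 n * Z ^ n)%C (s + 0 * Z ^ 0)%C).
      rewrite E. exact Hs.
    - eapply is_seriesC_ext; [|apply is_seriesC_plus; [apply (is_seriesC_scal Z _ _ Hs)|exact Hl]].
      intros n. cbv beta. rewrite sum_1_S, RtoC_plus. simpl. ring. }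
  assert (N : (1 - Z)%C <> 0%C).
  { intros N. assert (Z = 1%C) by (replace Z with (1 - (1 - Z))%C by ring; rewrite N; ring).
    subst Z. rewrite Cmod_1 in HZ. lra. }
  replace (l / (1 - Z))%C with s; [exact Hs|].
  replace l with (s - Z * s)%C by (rewrite E at 1; ring). field. exact N.
Qed.

Lemma gen_series_lim_0 (a : nat -> R) (K : R) (u : C) :
  (forall k, (1 <= k)%nat -> Rabs (a k) <= K) ->
  limC (gen_series a u) (at_right 0) (RtoC 0).
Proof.
  intros Ha.
  assert (K0 : 0 <= K) by (generalize (Ha 1%nat (le_n 1)) (Rabs_pos (a 1%nat)); lra).
  assert (Z0 : Cmod u * quartic 0 = 0) by (unfold quartic; ring).
  assert (Near : at_right 0 (fun t => 0 < t < 1 /\ Cmod (u * quartic t) < 1 / 2)).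
  { apply filter_and; [exact at_right_0_unit|].
    assert (Hc : filterlim (fun t => Cmod u * quartic t) (at_right 0)
        (locally (Cmod u * quartic 0))).
    { apply (continuous_at_right (fun t => Cmod u * quartic t)).
      apply (is_derive_continuous _ _ (Cmod u * dquartic 0)). apply is_derive_scal, is_derive_quartic. }
    rewrite Z0 in Hc.
    assert (P : 0 < 1 / 2) by lra.
    generalize (filter_and _ _ at_right_0_unit (proj1 (filterlim_locally _ _) Hc (mkposreal _ P))).
    apply filter_imp. intros t [T1 T2]. change (Rabs (Cmod u * quartic t - 0) < 1 / 2) in T2.
    rewrite Cmod_mul_quartic by lra. apply Rabs_lt_between in T2. lra. }
  assert (W : forall k, (1 <= k)%nat -> Rabs (a k) <= K * INR k).
  { now apply bounded_linear. }
  apply (tannery (V := C_NormedModule) (at_right 0)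
    (fun n t => a (S n) * (u * quartic t) ^ S n)%C (fun _ => RtoC 0) (fun n => K * (1 / 2) ^ n)).
  - apply (ex_series_scal_l (V := R_NormedModule) K). apply ex_series_geom.
    rewrite Rabs_pos_eq; lra.
  - revert Near. apply filter_imp. intros t [T1 T2] n.
    change (Cmod (a (S n) * (u * quartic t) ^ S n) <= K * (1 / 2) ^ n).
    rewrite Cmod_mult, Cmod_pow, Cmod_R.
    assert (M := Cmod_ge_0 (u * quartic t)).
    assert (P := pow_le _ n M).
    assert (Q : Cmod (u * quartic t) ^ n <= (1 / 2) ^ n) by (apply pow_incr; lra).
    apply Rmult_le_compat; [apply Rabs_pos | now apply pow_le | apply Ha; lia|].
    simpl. nra.
  - intros n. change (Cmod 0 <= K * (1 / 2) ^ n). rewrite Cmod_0.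
    apply Rmult_le_pos; trivial. apply pow_le. lra.
  - intros n.
    apply (limC_Cmod_0 (at_right 0) (fun t => a (S n) * (u * quartic t) ^ S n)%C
             (fun t => K * (Cmod u * quartic t) ^ S n)).
    + generalize at_right_0_unit. apply filter_imp. intros t T.
      rewrite Cmod_mult, Cmod_pow, Cmod_R, Cmod_mul_quartic by lra.
      apply Rmult_le_compat_r; [|apply Ha; lia].
      apply pow_le, Rmult_le_pos; [apply Cmod_ge_0 | apply quartic_bounds; lra].
    + replace 0 with (K * (Cmod u * quartic 0) ^ S n) at 2 by (rewrite Z0; simpl; ring).
      apply (continuous_at_right (fun t => K * (Cmod u * quartic t) ^ S n)).
      eapply is_derive_continuous. apply is_derive_scal.
      apply (is_derive_pow (fun t => Cmod u * quartic t) (S n)).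
      apply is_derive_scal, is_derive_quartic.
  - revert Near. apply filter_imp. intros t [T1 T2].
    apply (gen_series_correct a K u t W). lra.
  - exact is_seriesC_0.
Qed.


(** * Formal combinations of words *)

Open Scope C_scope.

Definition zero_l : C -> C := fun _ => RtoC 0.
Definition one_l : C -> C := fun _ => RtoC 1.

(** Words with letters that are functions of x, so that one formal combination serves all x
    at once; the innermost letter is one of the four xi. *)
Inductive xword : list (C -> C) -> Prop :=
| xword_last f : Xi_fun f -> xword (f :: nil)
| xword_cons f s : f = zero_l \/ f = one_l \/ Xi_fun f -> xword s -> xword (f :: s).

Definition eval_word (x : C) (s : list (C -> C)) : list C := map (fun f => f x) s.

Definition eval_comb (c : list (Q * list (C -> C))) (x z : C) : C :=
  Qcomb (fun s => GPL (eval_word x s) z) c.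

Definition prepend (q : Q) (f : C -> C) (c : list (Q * list (C -> C))) :=
  map (fun p => ((q * fst p)%Q, f :: snd p)) c.

(** Integration against dZ / Z = 2 dt / t + 2 dt / (t - 1). *)
Definition prepend_dlog_quartic (c : list (Q * list (C -> C))) := prepend 2 zero_l c ++ prepend 2 one_l c.

(** Integration against dZ / (1 - Z), the sum of - dt / (t - xi) over the four xi. *)
Definition prepend_xi (c : list (Q * list (C -> C))) :=
  prepend (-1) (xi 0 0) c ++ prepend (-1) (xi 0 1) c ++ prepend (-1) (xi 1 0) c ++ prepend (-1) (xi 1 1) c.

Definition xwords (n : nat) (c : list (Q * list (C -> C))) : Prop :=
  List.Forall (fun p => xword (snd p) /\ length (snd p) = n) c.

Definition unit_comb : list (Q * list (C -> C)) := (1%Q, nil) :: nil.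

Lemma Qcomb_app {A : Type} (f : A -> C) (c d : list (Q * A)) :
  Qcomb f (c ++ d) = Qcomb f c + Qcomb f d.
Proof.
  induction c as [|p c IH].
  - change (Qcomb f d = 0 + Qcomb f d). ring.
  - change (Q2R (fst p) * f (snd p) + Qcomb f (c ++ d)
            = Q2R (fst p) * f (snd p) + Qcomb f c + Qcomb f d).
    rewrite IH. ring.
Qed.

Lemma eval_comb_app c d x z : eval_comb (c ++ d) x z = eval_comb c x z + eval_comb d x z.
Proof. apply Qcomb_app. Qed.

Lemma eval_comb_cons q s c x z :
  eval_comb ((q, s) :: c) x z = Q2R q * GPL (eval_word x s) z + eval_comb c x z.
Proof. reflexivity. Qed.

Lemma eval_comb_unit x z : eval_comb unit_comb x z = 1.
Proof.
  unfold unit_comb. rewrite eval_comb_cons. unfold eval_comb, Qcomb. simpl.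
  replace (Q2R 1) with 1%R by (unfold Q2R; simpl; field). ring.
Qed.

(** The parameters of the region for which no letter xi lies on the path. *)
Definition good (x : C) : Prop := conv_domain x /\ x <> 1 / 2.

Lemma Xi_fun_off_closed_path (f : C -> C) (x : C) : Xi_fun f -> good x -> off_closed_path (f x).
Proof.
  intros [-> | [-> | [-> | ->]]] [Hd Hx]; apply off_closed_path_xi; auto.
Qed.

Lemma letter_off_open_path (f : C -> C) (x : C) :
  f = zero_l \/ f = one_l \/ Xi_fun f -> good x -> off_open_path (f x).
Proof.
  intros [-> | [-> | Hf]] Hx.
  - exact off_open_path_0.
  - exact off_open_path_1.
  - now apply off_closed_open, Xi_fun_off_closed_path.
Qed.

Lemma xword_reg (s : list (C -> C)) (x : C) : xword s -> good x -> reg_word (eval_word x s).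
Proof.
  intros Hs Hx. induction Hs as [f Hf|f s Hf Hs IH].
  - apply reg_last. now apply Xi_fun_off_closed_path.
  - apply reg_cons; trivial. now apply letter_off_open_path.
Qed.

Lemma eval_comb_prepend_derive (q : Q) (f : C -> C) (c : list (Q * list (C -> C))) (x : C) (t : R) :
  List.Forall (fun p => xword (f :: snd p)) c -> good x -> (0 < t < 1)%R ->
  derC (fun t => eval_comb (prepend q f c) x t) t (Q2R q * / (t - f x) * eval_comb c x t).
Proof.
  intros Hc Hx Ht. induction Hc as [|[p s] c Hp Hc IH].
  - replace (Q2R q * / (t - f x) * eval_comb nil x t) with (RtoC 0) by (unfold eval_comb, Qcomb; simpl; ring).
    exact (derC_const 0 t).
  - simpl prepend. rewrite eval_comb_cons.
    assert (D := proj1 (proj2 (GPL_reg _ (xword_reg _ x Hp Hx))) t Ht).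
    simpl in D.
    replace (Q2R q * / (t - f x) * (Q2R p * GPL (eval_word x s) t + eval_comb c x t))
      with (Q2R (q * p) * (/ (t - f x) * GPL (eval_word x s) t) + Q2R q * / (t - f x) * eval_comb c x t)
      by (rewrite Q2R_mult, RtoC_mult; ring).
    apply (derC_plus (fun t : R => Q2R (q * p) * GPL (f x :: eval_word x s) t)
             (fun t : R => eval_comb (prepend q f c) x t)); [|exact IH].
    apply derC_scal. exact D.
Qed.

Lemma eval_comb_lim_0 (n : nat) (c : list (Q * list (C -> C))) (x : C) :
  xwords n c -> good x -> limC (fun t : R => eval_comb c x t) (at_right 0) (RtoC 0).
Proof.
  intros Hc Hx. induction Hc as [|[p s] c [Hp _] Hc IH].
  - exact (filterlim_const (RtoC 0)).
  - replace (RtoC 0) with (Q2R p * 0 + 0) by ring.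
    apply (limC_plus (at_right 0) (fun t : R => Q2R p * GPL (eval_word x s) t)
             (fun t : R => eval_comb c x t)); [|exact IH].
    apply limC_scal; [typeclasses eauto|].
    apply (GPL_reg _ (xword_reg _ x Hp Hx)).
Qed.

Lemma eval_comb_contC (n : nat) (c : list (Q * list (C -> C))) (x : C) (t : R) :
  xwords n c -> good x -> (0 < t < 1)%R -> contC (fun t => eval_comb c x t) t.
Proof.
  intros Hc Hx Ht. 
  assert (D : exists l, derC (fun t => eval_comb c x t) t l).
  { induction Hc as [|[p s] c [Hp _] Hc [l IH]].
    - exists (RtoC 0). exact (derC_const 0 t).
    - assert (D := proj1 (proj2 (GPL_reg _ (xword_reg _ x Hp Hx))) t Ht).
      eexists.
      apply (derC_plus (fun t : R => Q2R p * GPL (eval_word x s) t) (fun t : R => eval_comb c x t)); [|exact IH].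
      apply derC_scal. exact D. }
  destruct D as [l D]. exact (derC_contC _ _ _ D).
Qed.

Lemma limC_minus {T : Type} (F : (T -> Prop) -> Prop) {FF : Filter F}
    (f g : T -> C) (l m : C) :
  limC f F l -> limC g F m -> limC (fun y => f y - g y) F (l - m).
Proof.
  intros H1 H2. replace (l - m) with (l + - (1) * m) by ring.
  eapply filterlim_ext; [|exact (limC_plus F _ _ _ _ H1 (limC_scal F (- (1)) _ _ H2))].
  intros y. simpl. ring.
Qed.

Lemma zero_of_derC_0 (h : R -> C) (a b : R) : (a < b)%R ->
  (forall t, (a < t < b)%R -> derC h t 0) -> limC h (at_right a) (RtoC 0) ->
  forall t, (a < t < b)%R -> h t = 0.
Proof.
  intros Hab D H0 t Ht.
  apply (limC_unique (at_right a) h); [|exact H0].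
  apply (filterlim_ext_loc (fun _ => h t)); [|apply filterlim_const].
  assert (Hd : (0 < b - a)%R) by lra.
  exists (mkposreal _ Hd). intros s Hs Hs0.
  change (Rabs (s - a) < b - a)%R in Hs. apply Rabs_lt_between in Hs.
  apply (derC_0_const h a b); trivial; lra.
Qed.

Lemma Cminus_0_eq (z w : C) : z - w = 0 -> z = w.
Proof. intros H. replace z with (z - w + w) by ring. rewrite H. ring. Qed.

(** The function f may be discontinuous at t = 1/2.  To the left of that point f = g by
    uniqueness of primitives.  To the right, f(t) - g(t) = g(1 - t) - g(t) by
    symmetry, and this tends to 0 at 1/2 because g is continuous there. *)
Lemma eq_of_same_derivative (f g d : R -> C) :
  (forall t, (0 < t < 1)%R -> t <> (1 / 2)%R -> derC f t (d t)) ->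
  (forall t, (0 < t < 1)%R -> t <> (1 / 2)%R -> derC g t (d t)) ->
  contC g (1 / 2) ->
  limC f (at_right 0) (RtoC 0) -> limC g (at_right 0) (RtoC 0) ->
  (forall t, f (1 - t)%R = f t) ->
  forall t, (0 < t < 1)%R -> t <> (1 / 2)%R -> f t = g t.
Proof.
  intros Hf Hg Hc Hf0 Hg0 Hsym.
  assert (D : forall t, (0 < t < 1)%R -> t <> (1 / 2)%R -> derC (fun s => f s - g s) t 0).
  { intros t Ht Hh. replace (RtoC 0) with (d t - d t) by ring. apply derC_minus; auto. }
  assert (Left : forall t, (0 < t < 1 / 2)%R -> f t = g t).
  { intros t Ht. apply Cminus_0_eq.
    apply (zero_of_derC_0 (fun s => f s - g s) 0 (1 / 2)); trivial; [lra | | ].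
    - intros s Hs. apply D; lra.
    - replace (RtoC 0) with (0 - 0) by ring. exact (limC_minus _ _ _ _ _ Hf0 Hg0). }
  intros t Ht Hh. destruct (Rlt_dec t (1 / 2)) as [Hl|Hl]; [apply Left; lra|].
  apply Cminus_0_eq.
  apply (zero_of_derC_0 (fun s => f s - g s) (1 / 2) 1); [lra | | | lra].
  - intros s Hs. apply D; lra.
  - replace (RtoC 0) with (g (1 / 2)%R - g (1 / 2)%R) by ring.
    assert (Hd : (0 < 1 / 2)%R) by lra.
    eapply (filterlim_ext_loc (fun s => g (1 - s)%R - g s)).
    + exists (mkposreal _ Hd). intros s Hs Hs0.
      change (Rabs (s - 1 / 2) < 1 / 2)%R in Hs. apply Rabs_lt_between in Hs.
      rewrite <- (Left (1 - s)%R) by lra. now rewrite Hsym.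
    + apply limC_minus; [typeclasses eauto| |now apply contC_at_right].
      apply filterlim_comp with (2 := contC_lim _ _ Hc).
      replace (1 / 2)%R with (1 - 1 / 2)%R at 2 by field.
      apply (continuous_at_right (fun s => (1 - s)%R)).
      apply (continuous_minus (V := R_NormedModule) (fun _ => 1%R) (fun s => s));
        [apply continuous_const | apply continuous_id].
Qed.

(** The factor u of Z(t) = u t^2 (1 - t)^2. *)
Definition zscale (x : C) : C := 2 ^ 2 / (x * (1 - x)).

Lemma Cmod_zscale (x : C) : x <> 0 -> 1 - x <> 0 -> (Cmod (zscale x) = 16 / Cmod (4 * x * (1 - x)))%R.
Proof.
  intros H0 H1.
  assert (P0 := proj1 (Cmod_gt_0 x) H0). assert (P1 := proj1 (Cmod_gt_0 (1 - x)) H1).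
  unfold zscale. rewrite Cmod_div by (now apply Cmult_neq_0).
  rewrite !Cmod_mult, Cmod_pow, !Cmod_R, !Rabs_pos_eq by lra.
  field. lra.
Qed.

Lemma Cmod_zscale_le (x : C) : conv_domain x -> (Cmod (zscale x) <= 16)%R.
Proof.
  intros Hd. destruct (conv_domain_neq_0 x Hd) as [H0 H1]. rewrite Cmod_zscale by trivial.
  unfold conv_domain in Hd. apply Rmult_le_reg_r with (Cmod (4 * x * (1 - x))); [lra|].
  unfold Rdiv. rewrite Rmult_assoc, Rinv_l by lra. lra.
Qed.

Lemma Cmod_zscale_lt (x : C) : (1 < Cmod (4 * x * (1 - x)))%R -> (Cmod (zscale x) < 16)%R.
Proof.
  intros Hd. assert (Hd' : conv_domain x) by (unfold conv_domain; lra).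
  destruct (conv_domain_neq_0 x Hd') as [H0 H1]. rewrite Cmod_zscale by trivial.
  apply Rmult_lt_reg_r with (Cmod (4 * x * (1 - x))); [lra|].
  unfold Rdiv. rewrite Rmult_assoc, Rinv_l by lra. lra.
Qed.

Lemma Cmod_Z_lt_1 (x : C) (t : R) : conv_domain x -> (0 < t < 1)%R -> t <> (1 / 2)%R ->
  (Cmod (zscale x * quartic t) < 1)%R.
Proof.
  intros Hd Ht Hh. rewrite Cmod_mul_quartic by lra.
  assert (A := Cmod_zscale_le x Hd). assert (B := quartic_lt t ltac:(lra) Hh).
  assert (P := quartic_pos t Ht). assert (P' := Cmod_ge_0 (zscale x)). nra.
Qed.

Lemma one_minus_Z (x : C) (t : R) : conv_domain x ->
  1 - zscale x * quartic t = - zscale x *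
    ((t - xi 0 0 x) * (t - xi 0 1 x) * (t - xi 1 0 x) * (t - xi 1 1 x)).
Proof.
  intros Hd. destruct (conv_domain_neq_0 x Hd) as [H0 H1].
  rewrite xi_prod. unfold quartic, zscale. rewrite !RtoC_mult, RtoC_minus. field. now split.
Qed.

Lemma real_neq_xi (x : C) (t : R) (l m : nat) : good x -> (0 <= t <= 1)%R ->
  (l = 0%nat \/ l = 1%nat) -> (m = 0%nat \/ m = 1%nat) -> t - xi l m x <> 0.
Proof.
  intros [Hd Hx] Ht Hl Hm. apply Cminus_eq_contra. now apply xi_neq_real.
Qed.

Lemma one_minus_Z_neq_0 (x : C) (t : R) : good x -> (0 <= t <= 1)%R ->
  1 - zscale x * quartic t <> 0.
Proof.
  intros Hx Ht. assert (Hd := proj1 Hx). destruct (conv_domain_neq_0 x Hd) as [H0 H1].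
  rewrite one_minus_Z by trivial.
  repeat apply Cmult_neq_0; try (apply real_neq_xi; auto).
  unfold zscale. intros E. apply C1_nz.
  replace (RtoC 1) with (- (2 ^ 2 / (x * (1 - x))) * (- (x * (1 - x)) / 2 ^ 2))
    by (field; now split).
  rewrite E. ring.
Qed.

Lemma dlog_one_minus_Z (x : C) (t : R) : good x -> (0 < t < 1)%R ->
  - (/ (t - xi 0 0 x) + / (t - xi 0 1 x) + / (t - xi 1 0 x) + / (t - xi 1 1 x))
  = zscale x * dquartic t / (1 - zscale x * quartic t).
Proof.
  intros Hx Ht. assert (Hd := proj1 Hx). destruct (conv_domain_neq_0 x Hd) as [H0 H1].
  rewrite one_minus_Z by trivial.
  rewrite xi_sum_inv by (apply xi_neq_real; try apply Hx; auto; lra).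
  rewrite <- xi_prod.
  unfold zscale, dquartic. rewrite !RtoC_mult, !RtoC_minus, !RtoC_mult.
  field. repeat split; trivial; apply real_neq_xi; auto; lra.
Qed.


(** * Generating functions as combinations of polylogarithms *)

(** The sum s satisfies s = 1 + Z s. *)
Lemma geometric_seriesC (Z : C) : (Cmod Z < 1)%R -> is_seriesC (fun n => Z ^ n) (/ (1 - Z)).
Proof.
  intros HZ. set (s := CSeries (fun n => Z ^ n)).
  assert (Hs : is_seriesC (fun n => Z ^ n) s).
  { apply (CSeries_correct _ (fun n => (Cmod Z ^ n)%R)).
    - intros n. rewrite Cmod_pow. apply Rle_refl.
    - apply ex_series_geom. rewrite Rabs_pos_eq; [exact HZ | apply Cmod_ge_0]. }
  assert (Es : s = 1 + Z * s).
  { apply (is_seriesC_unique (fun n => Z ^ n)); trivial.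
    apply (is_series_decr_1 (V := C_NormedModule)).
    change (is_seriesC (fun n => Z ^ S n) (1 + Z * s + - (1))).
    replace (1 + Z * s + - (1)) with (Z * s) by ring.
    exact (is_seriesC_scal Z _ _ Hs). }
  assert (N : 1 - Z <> 0).
  { intros N. assert (Z1 : Z = 1) by (replace Z with (1 - (1 - Z)) by ring; rewrite N; ring).
    rewrite Z1, Cmod_1 in HZ. lra. }
  replace (/ (1 - Z)) with s; [exact Hs|].
  replace s with ((s - Z * s) / (1 - Z)) by (field; exact N).
  rewrite Es at 1. field. exact N.
Qed.

Lemma gen_series_inv_derive (x : C) (t : R) :
  good x -> (0 < t < 1)%R -> t <> (1 / 2)%R ->
  derC (gen_series (fun k => / INR k)%R (zscale x)) t (zscale x * dquartic t / (1 - zscale x * quartic t)).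
Proof.
  intros Hx Ht Hh. assert (HZ := Cmod_Z_lt_1 x t (proj1 Hx) Ht Hh).
  apply (gen_series_derive _ 1); trivial.
  - intros k Hk. assert (1 <= INR k)%R by (change 1%R with (INR 1); now apply le_INR).
    rewrite Rabs_pos_eq by (left; apply Rinv_0_lt_compat; lra).
    rewrite <- Rinv_1. apply Rinv_le_contravar; lra.
  - eapply is_seriesC_ext;
      [|exact (is_seriesC_scal (zscale x * dquartic t) _ _ (geometric_seriesC _ HZ))].
    intros n. cbv beta. rewrite Cpow_mult_l, !RtoC_mult, RtoC_pow, RtoC_inv, Cpow_S
      by (apply not_0_INR; lia).
    field. intros H. apply RtoC_inj in H. revert H. apply not_0_INR. lia.
Qed.

Lemma gen_series_div_derive (x : C) (t : R) (n : nat) (a : nat -> R) :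
  good x -> (0 < t < 1)%R -> t <> (1 / 2)%R -> mhs n a ->
  derC (gen_series (fun k => a k / INR k)%R (zscale x)) t
    (dquartic t / quartic t * gen_series a (zscale x) t).
Proof.
  intros Hx Ht Hh Ha. assert (HZ := Cmod_Z_lt_1 x t (proj1 Hx) Ht Hh).
  destruct (mhs_bounded _ _ Ha) as [K HK].
  destruct (mhs_bounded _ _ (mhs_div _ _ Ha)) as [K' HK'].
  apply (gen_series_derive _ K'); trivial.
  eapply is_seriesC_ext;
    [|apply (is_seriesC_scal (dquartic t / quartic t)); apply (gen_series_correct a K (zscale x) t); trivial].
  - intros m. cbv beta. assert (P := quartic_pos t Ht).
    unfold Rdiv. rewrite Cpow_mult_l, !RtoC_mult, RtoC_pow, RtoC_inv, (Cpow_S (quartic t))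
      by (apply not_0_INR; lia).
    field. split; intros H; apply RtoC_inj in H; [|lra].
    revert H. apply not_0_INR. lia.
  - now apply bounded_linear.
Qed.

Lemma gen_series_sum_derive (x : C) (t : R) (n : nat) (a : nat -> R) :
  good x -> (0 < t < 1)%R -> t <> (1 / 2)%R -> mhs n a ->
  derC (gen_series (fun k => sum_n_m a 1 (pred k) / INR k)%R (zscale x)) t
    (zscale x * dquartic t / (1 - zscale x * quartic t) * gen_series a (zscale x) t).
Proof.
  intros Hx Ht Hh Ha. assert (HZ := Cmod_Z_lt_1 x t (proj1 Hx) Ht Hh).
  destruct (mhs_bounded _ _ Ha) as [K HK].
  destruct (mhs_bounded _ _ (mhs_sum _ _ Ha)) as [K' HK'].
  apply (gen_series_derive _ K'); trivial.
  replace (zscale x * dquartic t / (1 - zscale x * quartic t) * gen_series a (zscale x) t)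
    with (zscale x * dquartic t * (gen_series a (zscale x) t / (1 - zscale x * quartic t)))
    by (field; apply one_minus_Z_neq_0; trivial; lra).
  eapply is_seriesC_ext;
    [|apply (is_seriesC_scal (zscale x * dquartic t)); apply (partial_sums_series a K); trivial;
      apply (gen_series_correct a K (zscale x) t); trivial].
  - intros m. cbv beta.
    unfold Rdiv. simpl pred. rewrite Cpow_mult_l, !RtoC_mult, RtoC_pow, RtoC_inv, (Cpow_S (zscale x))
      by (apply not_0_INR; lia).
    field. intros H; apply RtoC_inj in H. revert H. apply not_0_INR. lia.
  - now apply bounded_linear.
Qed.

Lemma eval_comb_prepend_dlog_quartic_derive (x : C) (t : R) (n : nat) (c : list (Q * list (C -> C))) :
  good x -> (0 < t < 1)%R -> xwords n c ->
  derC (fun t => eval_comb (prepend_dlog_quartic c) x t) t (dquartic t / quartic t * eval_comb c x t).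
Proof.
  intros Hx Ht Hc. unfold prepend_dlog_quartic.
  apply (derC_ext_loc (fun t : R => eval_comb (prepend 2 zero_l c) x t + eval_comb (prepend 2 one_l c) x t)).
  { apply filter_forall. intros s. now rewrite eval_comb_app. }
  replace (dquartic t / quartic t * eval_comb c x t)
    with (Q2R 2 * / (t - zero_l x) * eval_comb c x t + Q2R 2 * / (t - one_l x) * eval_comb c x t).
  - apply (derC_plus (fun t : R => eval_comb (prepend 2 zero_l c) x t) (fun t : R => eval_comb (prepend 2 one_l c) x t));
      apply eval_comb_prepend_derive; trivial; (eapply List.Forall_impl; [|exact Hc]);
      intros [p s] [Hp _]; apply xword_cons; auto.
  - replace (Q2R 2) with 2%R by (unfold Q2R; simpl; field).
    unfold zero_l, one_l, dquartic, quartic. rewrite !RtoC_mult, !RtoC_minus, RtoC_mult.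
    assert (t1 : RtoC t <> 1) by (intros H; apply RtoC_inj in H; lra).
    assert (t2 : RtoC t <> 0) by (intros H; apply RtoC_inj in H; lra).
    field. repeat split; trivial; apply Cminus_eq_contra; auto.
Qed.

Lemma eval_comb_prepend_xi_derive (x : C) (t : R) (c : list (Q * list (C -> C))) :
  good x -> (0 < t < 1)%R ->
  (forall f, Xi_fun f -> List.Forall (fun p => xword (f :: snd p)) c) ->
  derC (fun t => eval_comb (prepend_xi c) x t) t
    (zscale x * dquartic t / (1 - zscale x * quartic t) * eval_comb c x t).
Proof.
  intros Hx Ht Hc. unfold prepend_xi.
  apply (derC_ext_loc (fun t : R => eval_comb (prepend (-1) (xi 0 0) c) x t + (eval_comb (prepend (-1) (xi 0 1) c) x t
    + (eval_comb (prepend (-1) (xi 1 0) c) x t + eval_comb (prepend (-1) (xi 1 1) c) x t)))).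
  { apply filter_forall. intros s. now rewrite !eval_comb_app. }
  rewrite <- dlog_one_minus_Z by trivial.
  match goal with |- derC _ _ ?z => replace z with
    (Q2R (-1) * / (t - xi 0 0 x) * eval_comb c x t + (Q2R (-1) * / (t - xi 0 1 x) * eval_comb c x t
    + (Q2R (-1) * / (t - xi 1 0 x) * eval_comb c x t + Q2R (-1) * / (t - xi 1 1 x) * eval_comb c x t))) end.
  - repeat apply (fun f g t l m H1 H2 => derC_plus f g t l m H1 H2);
      apply eval_comb_prepend_derive; trivial; apply Hc; unfold Xi_fun; auto.
  - replace (Q2R (-1)) with (-1)%R by (unfold Q2R; simpl; field).
    field. repeat split; apply real_neq_xi; auto; lra.
Qed.

Lemma xwords_prepend (n : nat) (q : Q) (f : C -> C) (c : list (Q * list (C -> C))) :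
  f = zero_l \/ f = one_l \/ Xi_fun f -> xwords n c -> xwords (S n) (prepend q f c).
Proof.
  intros Hf Hc. induction Hc as [|[p s] c [Hs Hn] Hc IH].
  - constructor.
  - simpl. constructor; [|exact IH]. simpl in *. split; [now constructor | now f_equal].
Qed.

Lemma xwords_app (n : nat) (c d : list (Q * list (C -> C))) :
  xwords n c -> xwords n d -> xwords n (c ++ d).
Proof. intros Hc Hd. apply List.Forall_app. now split. Qed.

Lemma xwords_prepend_xi (n : nat) (c : list (Q * list (C -> C))) :
  xwords n c -> xwords (S n) (prepend_xi c).
Proof.
  intros Hc. unfold prepend_xi.
  repeat apply xwords_app; apply xwords_prepend; trivial; unfold Xi_fun; auto 6.
Qed.

Lemma xwords_prepend_dlog_quartic (n : nat) (c : list (Q * list (C -> C))) :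
  xwords n c -> xwords (S n) (prepend_dlog_quartic c).
Proof.
  intros Hc. unfold prepend_dlog_quartic. apply xwords_app; apply xwords_prepend; auto.
Qed.

Lemma xwords_letters : xwords 1 (prepend_xi unit_comb).
Proof.
  unfold prepend_xi, unit_comb, xwords. simpl.
  repeat (apply List.Forall_cons;
    [split; [apply xword_last; unfold Xi_fun; auto | reflexivity] |]).
  apply List.Forall_nil.
Qed.

(** The point t = 1/2 is left out because |Z(1/2)| = 1 when x is on the boundary of the
    region of convergence. *)
Definition represents (c : list (Q * list (C -> C))) (a : nat -> R) : Prop :=
  forall x, good x -> forall t, (0 < t < 1)%R -> t <> (1 / 2)%R ->
    gen_series a (zscale x) t = eval_comb c x t.

(** Both sides vanish at 0, so only their derivatives have to be compared. *)
Lemma represents_by_derivative (n m : nat) (c : list (Q * list (C -> C))) (a : nat -> R)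
    (d : C -> R -> C) :
  mhs n a -> xwords m c ->
  (forall x t, good x -> (0 < t < 1)%R -> t <> (1 / 2)%R -> derC (gen_series a (zscale x)) t (d x t)) ->
  (forall x t, good x -> (0 < t < 1)%R -> t <> (1 / 2)%R ->
     derC (fun t => eval_comb c x t) t (d x t)) ->
  represents c a.
Proof.
  intros Ha Hc HL HE x Hx t Ht Hh. destruct (mhs_bounded _ _ Ha) as [K HK].
  apply (eq_of_same_derivative (gen_series a (zscale x)) (fun t => eval_comb c x t) (d x)); auto.
  - apply (eval_comb_contC m); trivial. lra.
  - now apply (gen_series_lim_0 a K).
  - now apply (eval_comb_lim_0 m).
  - intros s. apply gen_series_sym.
Qed.

Lemma represents_inv : represents (prepend_xi unit_comb) (fun k => / INR k)%R.
Proof.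
  apply (represents_by_derivative 1 1 _ _
    (fun x t => zscale x * dquartic t / (1 - zscale x * quartic t))).
  - constructor.
  - exact xwords_letters.
  - intros x t. apply gen_series_inv_derive.
  - intros x t Hx Ht Hh.
    replace (zscale x * dquartic t / (1 - zscale x * quartic t))
      with (zscale x * dquartic t / (1 - zscale x * quartic t) * eval_comb unit_comb x t) by (rewrite eval_comb_unit; ring).
    apply eval_comb_prepend_xi_derive; trivial. intros f Hf. constructor; [now apply xword_last | constructor].
Qed.

Lemma represents_div (n : nat) (c : list (Q * list (C -> C))) (a : nat -> R) :
  mhs n a -> xwords n c -> represents c a ->
  represents (prepend_dlog_quartic c) (fun k => a k / INR k)%R.
Proof.
  intros Ha Hc H.
  apply (represents_by_derivative (S n) (S n) _ _ (fun x t => dquartic t / quartic t * gen_series a (zscale x) t)).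
  - now constructor.
  - now apply xwords_prepend_dlog_quartic.
  - intros x t Hx Ht Hh. now apply (gen_series_div_derive x t n).
  - intros x t Hx Ht Hh. rewrite (H x Hx t Ht Hh).
    now apply (eval_comb_prepend_dlog_quartic_derive x t n).
Qed.

Lemma represents_sum (n : nat) (c : list (Q * list (C -> C))) (a : nat -> R) :
  mhs n a -> xwords n c -> represents c a ->
  represents (prepend_xi c) (fun k => sum_n_m a 1 (pred k) / INR k)%R.
Proof.
  intros Ha Hc H.
  apply (represents_by_derivative (S n) (S n) _ _
    (fun x t => zscale x * dquartic t / (1 - zscale x * quartic t) * gen_series a (zscale x) t)).
  - now constructor.
  - now apply xwords_prepend_xi.
  - intros x t Hx Ht Hh. now apply (gen_series_sum_derive x t n).
  - intros x t Hx Ht Hh. rewrite (H x Hx t Ht Hh).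
    apply eval_comb_prepend_xi_derive; trivial. intros f Hf.
    eapply List.Forall_impl; [|exact Hc]. intros p [Hp _]. apply xword_cons; auto.
Qed.

(** Each rule of [mhs] corresponds to prepending the letters of one differential form. *)
Lemma mhs_representable (n : nat) (a : nat -> R) : mhs n a ->
  exists c, xwords n c /\ represents c a.
Proof.
  intros Ha. induction Ha as [|n a Ha [c [Hc IH]]|n a Ha [c [Hc IH]]
    |n a b Ha [c [Hc IHa]] Hb [d [Hd IHb]]|n a b Ha [c [Hc IH]] He].
  - exists (prepend_xi unit_comb). split; [exact xwords_letters | exact represents_inv].
  - exists (prepend_dlog_quartic c). split; [now apply xwords_prepend_dlog_quartic | now apply (represents_div n)].
  - exists (prepend_xi c). split; [now apply xwords_prepend_xi | now apply (represents_sum n)].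
  - exists (c ++ d). split; [now apply xwords_app|].
    intros x Hx t Ht Hh. rewrite eval_comb_app, <- IHa, <- IHb by trivial.
    destruct (mhs_bounded _ _ Ha) as [K HK]. destruct (mhs_bounded _ _ Hb) as [K' HK'].
    apply CSeries_unique.
    assert (HZ := Cmod_Z_lt_1 x t (proj1 Hx) Ht Hh).
    eapply is_seriesC_ext; [|apply is_seriesC_plus;
      [exact (gen_series_correct a K (zscale x) t (bounded_linear a K HK) HZ) |
       exact (gen_series_correct b K' (zscale x) t (bounded_linear b K' HK') HZ)]].
    intros k. cbv beta. rewrite RtoC_plus. ring.
  - exists c. split; trivial. intros x Hx t Ht Hh. rewrite <- IH by trivial.
    unfold gen_series.
    assert (Ext : forall e f : nat -> C, (forall k, e k = f k) -> CSeries e = CSeries f).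
    { intros e f H. unfold CSeries. f_equal; apply Series_ext; intros k; now rewrite H. }
    apply Ext. intros k. rewrite He by lia. reflexivity.
Qed.


(** * Incomplete Beta integrals *)

Open Scope R_scope.

Definition beta_fun (a b : nat) (t : R) : R := t ^ a * (1 - t) ^ b.
(** The incomplete Beta function with parameters a + 1 and b + 1. *)
Definition ibeta (a b : nat) (t : R) : R := RInt (beta_fun a b) 0 t.

Lemma beta_fun_continuous a b t : continuous (beta_fun a b) t.
Proof.
  apply (ex_derive_continuous (V := R_NormedModule)). unfold beta_fun. auto_derive. trivial.
Qed.

Lemma beta_fun_ex_RInt a b s t : ex_RInt (beta_fun a b) s t.
Proof.
  apply (ex_RInt_continuous (V := R_CompleteNormedModule)).
  intros z _. apply beta_fun_continuous.
Qed.

Lemma beta_fun_ge_0 a b t : 0 <= t <= 1 -> 0 <= beta_fun a b t.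
Proof. intros Ht. apply Rmult_le_pos; apply pow_le; lra. Qed.

Lemma is_derive_ibeta a b t : is_derive (ibeta a b) t (beta_fun a b t).
Proof.
  apply (is_derive_RInt (V := R_NormedModule) (beta_fun a b) (ibeta a b) 0 t).
  - apply filter_forall. intros s. apply (RInt_correct (V := R_CompleteNormedModule)).
    apply beta_fun_ex_RInt.
  - apply beta_fun_continuous.
Qed.

Lemma ibeta_0 a b : ibeta a b 0 = 0.
Proof. apply (RInt_point (V := R_CompleteNormedModule)). Qed.

Lemma ibeta_le a b t : 0 <= t <= 1 -> 0 <= ibeta a b t <= ibeta a b 1.
Proof.
  intros Ht. split.
  - apply RInt_ge_0; [lra | apply beta_fun_ex_RInt |].
    intros s Hs. apply beta_fun_ge_0. lra.
  - unfold ibeta.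
    rewrite <- (RInt_Chasles (V := R_CompleteNormedModule) (beta_fun a b) 0 t 1)
      by apply beta_fun_ex_RInt.
    change plus with Rplus.
    assert (0 <= RInt (beta_fun a b) t 1); [|lra].
    apply RInt_ge_0; [lra | apply beta_fun_ex_RInt |].
    intros s Hs. apply beta_fun_ge_0. lra.
Qed.

(** Integration by parts: t^(a+1) (1 - t)^(b+1) vanishes at both ends. *)
Lemma ibeta_parts a b : INR (S a) * ibeta a (S b) 1 = INR (S b) * ibeta (S a) b 1.
Proof.
  set (f := beta_fun (S a) (S b)).
  set (df := fun t => INR (S a) * beta_fun a (S b) t - INR (S b) * beta_fun (S a) b t).
  assert (I1 : is_RInt df 0 1 (minus (f 1) (f 0))).
  { apply (is_RInt_derive (V := R_CompleteNormedModule) f df).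
    - intros t _. unfold f, df, beta_fun. auto_derive; trivial.
      change (match a with O => 1 | S _ => INR a + 1 end) with (INR (S a)).
      change (match b with O => 1 | S _ => INR b + 1 end) with (INR (S b)).
      rewrite !S_INR. change (1 + - t) with (1 - t). simpl. ring.
    - intros t _. apply (ex_derive_continuous (V := R_NormedModule)). unfold df, beta_fun.
      auto_derive. trivial. }
  assert (I2 : is_RInt df 0 1 (INR (S a) * ibeta a (S b) 1 - INR (S b) * ibeta (S a) b 1)).
  { apply (is_RInt_minus (V := R_NormedModule));
      apply (is_RInt_scal (V := R_NormedModule));
      apply (RInt_correct (V := R_CompleteNormedModule)), beta_fun_ex_RInt. }
  assert (E1 := is_RInt_unique _ _ _ _ I1). rewrite (is_RInt_unique _ _ _ _ I2) in E1.
  assert (F : minus (f 1) (f 0) = 0).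
  { change (f 1 - f 0 = 0). unfold f, beta_fun. simpl. ring. }
  rewrite F in E1. lra.
Qed.

Lemma ibeta_1 a b : ibeta a b 1 = INR (fact a) * INR (fact b) / INR (fact (a + b + 1)).
Proof.
  revert a. induction b as [|b IH]; intros a.
  - assert (I1 : is_RInt (beta_fun a 0) 0 1
       (minus ((fun t => t ^ S a / INR (S a)) 1) ((fun t => t ^ S a / INR (S a)) 0))).
    { apply (is_RInt_derive (V := R_CompleteNormedModule) (fun t => t ^ S a / INR (S a))).
      - intros t _. apply is_derive_ext with (fun t => / INR (S a) * t ^ S a).
        + intros s. unfold Rdiv. apply Rmult_comm.
        + replace (beta_fun a 0 t) with (/ INR (S a) * (INR (S a) * 1 * t ^ pred (S a))).
          * apply is_derive_scal. apply (is_derive_pow (fun t => t) (S a) t 1).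
            apply (is_derive_id (K := R_AbsRing)).
          * unfold beta_fun. simpl pred. rewrite pow_O. field. apply not_0_INR. lia.
      - intros t _. apply beta_fun_continuous. }
    unfold ibeta. rewrite (is_RInt_unique _ _ _ _ I1).
    change (1 ^ S a / INR (S a) - 0 ^ S a / INR (S a) =
      INR (fact a) * INR (fact 0) / INR (fact (a + 0 + 1))).
    replace (a + 0 + 1)%nat with (S a) by lia.
    rewrite pow1, pow_i by lia. rewrite fact_simpl, mult_INR. simpl (INR (fact 0)).
    field. split; [apply INR_fact_neq_0 | apply not_0_INR; lia].
  - assert (P := ibeta_parts a b). rewrite IH in P.
    assert (N : INR (S a) <> 0) by (apply not_0_INR; lia).
    apply Rmult_eq_reg_l with (INR (S a)); trivial. rewrite P.
    replace (S a + b + 1)%nat with (a + S b + 1)%nat by lia.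
    rewrite (fact_simpl a), (fact_simpl b), !mult_INR. field. apply INR_fact_neq_0.
Qed.


(** * Summation by a Beta integral *)

Definition central (n : nat) : R := INR (fact (2 * n)) / (INR (fact n) * INR (fact n)).

Lemma fact_pos n : 0 < INR (fact n).
Proof. apply lt_0_INR, lt_O_fact. Qed.

Lemma central_pos n : 0 < central n.
Proof.
  unfold central. assert (P := fact_pos n). assert (P' := fact_pos (2 * n)).
  apply Rdiv_lt_0_compat; trivial. nra.
Qed.

Lemma central_S n : central (S n) * INR (S n) = central n * (2 * (2 * INR n + 1)).
Proof.
  unfold central. replace (2 * S n)%nat with (S (S (2 * n))) by lia.
  rewrite !fact_simpl, !mult_INR. rewrite !S_INR, mult_INR. change (INR 2) with 2.
  assert (P := fact_pos n). assert (Q := pos_INR n). field. lra.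
Qed.

(** The bound 4^n <= 2 sqrt n binom(2n, n), squared so that the induction only involves
    polynomials in n. *)
Lemma central_lower n : (1 <= n)%nat -> 16 ^ n <= 4 * INR n * (central n * central n).
Proof.
  induction 1 as [|n Hn IH].
  - unfold central. simpl. lra.
  - assert (P := central_pos n). assert (E := central_S n). assert (Q := pos_INR n).
    assert (N : 0 < INR (S n)) by (apply lt_0_INR; lia).
    apply Rmult_le_reg_r with (INR (S n)); trivial.
    replace (4 * INR (S n) * (central (S n) * central (S n)) * INR (S n))
      with (4 * INR (S n) * (central (S n) * INR (S n)) * central (S n)) by ring.
    replace (4 * INR (S n) * (central (S n) * INR (S n)) * central (S n))
      with (4 * (central (S n) * INR (S n)) * (central (S n) * INR (S n))) by ring.
    rewrite E. change (16 ^ S n) with (16 * 16 ^ n). rewrite S_INR.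
    assert (C2 : 0 < central n * central n) by nra.
    apply Rle_trans with (16 * (4 * INR n * (central n * central n)) * (INR n + 1)).
    + apply Rmult_le_compat_r; lra.
    + replace (16 * (4 * INR n * (central n * central n)) * (INR n + 1))
        with ((central n * central n) * (64 * INR n * (INR n + 1))) by ring.
      replace (4 * (central n * (2 * (2 * INR n + 1))) * (central n * (2 * (2 * INR n + 1))))
        with ((central n * central n) * (16 * ((2 * INR n + 1) * (2 * INR n + 1)))) by ring.
      apply Rmult_le_compat_l; nra.
Qed.

Lemma binom_central k : binom_4k_2k k = central (2 * k).
Proof.
  unfold binom_4k_2k, Binomial.C, central.
  replace (4 * k - 2 * k)%nat with (2 * k)%nat by lia.
  now replace (2 * (2 * k))%nat with (4 * k)%nat by lia.
Qed.

Lemma binom_pos k : 0 < binom_4k_2k k.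
Proof. rewrite binom_central. apply central_pos. Qed.

Lemma binom_lower k : (1 <= k)%nat -> 16 ^ k <= 3 * root4 k ^ 2 * binom_4k_2k k.
Proof.
  intros Hk. assert (L := central_lower (2 * k) ltac:(lia)).
  rewrite <- binom_central, mult_INR, <- (root4_4 k) in L. change (INR 2) with 2 in L.
  rewrite pow_mult in L. replace (16 ^ 2) with (16 * 16) in L by ring.
  rewrite Rpow_mult_distr in L.
  assert (B := binom_pos k). assert (P := root4_pos k Hk).
  assert (S : 0 < 16 ^ k) by (apply pow_lt; lra).
  revert L B S. generalize (16 ^ k) (binom_4k_2k k). intros s b L B S.
  assert (R2 : 1 <= root4 k ^ 2) by (apply pow_R1_Rle; lra).
  replace (root4 k ^ 4) with (root4 k ^ 2 * root4 k ^ 2) in L by ring.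
  revert R2 L. generalize (root4 k ^ 2). intros r R2 L.
  assert (RB : 0 < r * b) by (apply Rmult_lt_0_compat; lra).
  apply Rsqr_incr_0_var; unfold Rsqr; [|lra].
  replace (4 * (2 * (r * r)) * (b * b)) with (8 * ((r * b) * (r * b))) in L by ring.
  replace (3 * r * b * (3 * r * b)) with (9 * ((r * b) * (r * b))) by ring.
  assert (0 < (r * b) * (r * b)) by (now apply Rmult_lt_0_compat). lra.
Qed.

Lemma ibeta_div (n : nat) :
  ibeta (2 * n + 1) (2 * S n) 1 = / (2 * INR (S n) * binom_4k_2k (S n)).
Proof.
  rewrite ibeta_1, binom_central. unfold central.
  replace (2 * n + 1 + 2 * S n + 1)%nat with (2 * (2 * S n))%nat by lia.
  replace (fact (2 * S n)) with ((2 * S n) * fact (2 * n + 1))%nat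
    by (replace (2 * S n)%nat with (S (2 * n + 1)) by lia; now rewrite fact_simpl).
  rewrite !mult_INR. change (INR 2) with 2.
  assert (P := fact_pos (2 * n + 1)). assert (P' := fact_pos (2 * (2 * S n))).
  assert (Q : 0 < INR (S n)) by (apply lt_0_INR; lia).
  field. lra.
Qed.

Lemma ibeta_one (k : nat) :
  ibeta (2 * k) (2 * k) 1 = / ((4 * INR k + 1) * binom_4k_2k k).
Proof.
  rewrite ibeta_1, binom_central. unfold central.
  replace (2 * k + 2 * k + 1)%nat with (S (2 * (2 * k))) by lia.
  rewrite (fact_simpl (2 * (2 * k))), mult_INR.
  replace (INR (S (2 * (2 * k)))) with (4 * INR k + 1)
    by (rewrite S_INR, !mult_INR; change (INR 2) with 2; ring).
  assert (P := fact_pos (2 * k)). assert (P' := fact_pos (2 * (2 * k))).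
  assert (Q := pos_INR k). field. lra.
Qed.

(** The identity (2k + 1) / ((4k + 1) (4k + 3)) = (1 / (4k + 1) + 1 / (4k + 3)) / 4 lets the
    integrand t (1 - t) produce the denominator 4k + 3. *)
Lemma ibeta_quad (k : nat) :
  ibeta (2 * k + 1) (2 * k + 1) 1 =
  (/ ((4 * INR k + 1) * binom_4k_2k k) + / ((4 * INR k + 3) * binom_4k_2k k)) / 8.
Proof.
  rewrite ibeta_1, binom_central. unfold central.
  replace (2 * k + 1 + (2 * k + 1) + 1)%nat with (S (S (S (2 * (2 * k))))) by lia.
  replace (2 * k + 1)%nat with (S (2 * k)) by lia.
  rewrite !fact_simpl, !mult_INR.
  rewrite !S_INR, !mult_INR. change (INR 2) with 2.
  assert (P := fact_pos (2 * k)). assert (P' := fact_pos (2 * (2 * k))).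
  assert (Q := pos_INR k). field. lra.
Qed.

(** Interchange of sum and integral.  The series F(t) of incomplete Beta integrals converges
    uniformly on [0, 1], since each term is largest at t = 1; it is therefore continuous,
    and away from t = 1/2 it can be differentiated term by term, with derivative
    q Phi.  So F - e is constant on both halves of (0, 1), hence zero by continuity at
    0 and at 1/2, and the value of F at 1 is the limit of e. *)
Lemma beta_integral_series
    (c : nat -> C) (K : R) (al be : nat -> nat) (q : R -> R) (u : C)
    (Phi e : R -> C) (l : C) :
  Cmod u <= 16 ->
  (forall n, Cmod (c n) <= K * INR (S n)) ->
  (forall n t, 0 < t < 1 -> beta_fun (al n) (be n) t = q t * quartic t ^ S n) ->
  (forall t, 0 < t < 1 -> 0 <= q t <= / t) ->
  ex_series (fun n => Cmod (c n) * Cmod u ^ S n * ibeta (al n) (be n) 1) ->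
  (forall t, 0 < t < 1 -> t <> 1 / 2 ->
     is_seriesC (fun n => c n * (u * quartic t) ^ S n)%C (Phi t)) ->
  (forall t, 0 < t < 1 -> derC e t (q t * Phi t)%C) ->
  limC e (at_right 0) (RtoC 0) -> limC e (at_left 1) l ->
  is_seriesC (fun n => c n * u ^ S n * ibeta (al n) (be n) 1)%C l.
Proof.
  intros Hu Hc Hq Hq0 HM HPhi He He0 He1.
  set (M := fun n => Cmod (c n) * Cmod u ^ S n * ibeta (al n) (be n) 1) in HM.
  set (f := fun n t => (c n * u ^ S n * ibeta (al n) (be n) t)%C).
  set (F := fun t => CSeries (fun n => f n t)).
  assert (K0 : 0 <= K).
  { generalize (Hc 0%nat) (Cmod_ge_0 (c 0%nat)). simpl. lra. }
  assert (HfM : forall t, 0 <= t <= 1 -> forall n, Cmod (f n t) <= M n).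
  { intros t Ht n. unfold f, M. destruct (ibeta_le (al n) (be n) t Ht) as [A B].
    rewrite !Cmod_mult, Cmod_pow, Cmod_R, Rabs_pos_eq by trivial.
    apply Rmult_le_compat_l; trivial.
    apply Rmult_le_pos; [|apply pow_le]; apply Cmod_ge_0. }
  assert (HF : forall t, 0 <= t <= 1 -> is_seriesC (fun n => f n t) (F t)).
  { intros t Ht. apply (CSeries_correct _ M); trivial. now apply HfM. }
  assert (Hlim : forall (G : (R -> Prop) -> Prop) t, Filter G ->
            G (fun s => 0 <= s <= 1) -> 0 <= t <= 1 ->
            (forall g : R -> R, continuous g t -> filterlim g G (locally (g t))) ->
            limC F G (F t)).
  { intros G t FG HG Ht Hcont.
    apply (tannery (V := C_NormedModule) G f (fun n => f n t) M).
    - exact HM.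
    - revert HG. apply filter_imp. intros s Hs n. now apply (HfM s Hs).
    - intros n. now apply (HfM t Ht).
    - intros n. unfold f. apply limC_scal; trivial.
      apply limC_iff; trivial. split; simpl; [|apply filterlim_const].
      apply Hcont. apply (is_derive_continuous _ _ _ (is_derive_ibeta _ _ _)).
    - revert HG. apply filter_imp. intros s Hs. now apply HF.
    - now apply HF. }
  assert (HD : forall t, 0 < t < 1 -> t <> 1 / 2 -> derC F t (q t * Phi t)%C).
  { intros t0 Ht Hh.
    assert (HZ : Cmod (u * quartic t0) < 1).
    { rewrite Cmod_mul_quartic by lra. assert (A := quartic_lt t0 ltac:(lra) Hh).
      assert (B := quartic_pos t0 Ht). assert (P := Cmod_ge_0 u). nra. }
    destruct (mul_quartic_near u t0 Ht HZ) as [r [d [Hr [Hd Hn]]]].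
    apply (derC_series (fun n => c n * u ^ S n)%C (fun n => ibeta (al n) (be n))
      (fun n => beta_fun (al n) (be n))
      (fun n => K * (2 / t0) * (INR (S n) * r ^ n)) F _ t0 (Rmin d (t0 / 2))).
    (* The radius t0 / 2 gives q t <= 1 / t <= 2 / t0. *)
    - apply Rmin_pos; lra.
    - apply (ex_series_scal_l (V := R_NormedModule) (K * (2 / t0))).
      now apply ex_series_n_geom.
    - intros n t _. apply is_derive_ibeta.
    - intros n t T.
      assert (T1 : Rabs (t - t0) < d) by (eapply Rlt_le_trans; [exact T | apply Rmin_l]).
      assert (T2 : Rabs (t - t0) < t0 / 2) by (eapply Rlt_le_trans; [exact T | apply Rmin_r]).
      destruct (Hn t T1) as [T3 T4]. apply Rabs_lt_between in T2.
      rewrite Cmod_mul_quartic in T4 by lra.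
      rewrite Hq by trivial. destruct (Hq0 t T3) as [Q1 Q2].
      assert (Z := quartic_pos t T3).
      rewrite Cmod_mult, Cmod_pow, Rabs_mult, (Rabs_pos_eq (q t)),
        (Rabs_pos_eq (quartic t ^ S n)) by (trivial; apply pow_le; lra).
      replace (Cmod (c n) * Cmod u ^ S n * (q t * quartic t ^ S n))
        with (Cmod (c n) * q t * (Cmod u * quartic t) ^ S n) by (rewrite Rpow_mult_distr; ring).
      assert (U := Cmod_ge_0 u).
      assert (UZ : 0 <= Cmod u * quartic t) by nra.
      replace (K * (2 / t0) * (INR (S n) * r ^ n)) with (K * INR (S n) * (2 / t0) * r ^ n) by ring.
      apply Rmult_le_compat.
      + apply Rmult_le_pos; [apply Cmod_ge_0 | trivial].
      + now apply pow_le.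
      + apply Rmult_le_compat; trivial; [apply Cmod_ge_0|].
        apply Rle_trans with (1 := Q2).
        replace (2 / t0) with (/ (t0 / 2)) by (field; lra).
        apply Rinv_le_contravar; lra.
      + assert (P1 := pow_le _ n UZ).
        assert (P2 : (Cmod u * quartic t) ^ n <= r ^ n) by (apply pow_incr; lra).
        simpl. nra.
    - intros t T.
      assert (T1 : Rabs (t - t0) < d) by (eapply Rlt_le_trans; [exact T | apply Rmin_l]).
      apply HF. destruct (Hn t T1). lra.
    - eapply is_seriesC_ext; [|exact (is_seriesC_scal (q t0) _ _ (HPhi t0 Ht Hh))].
      intros n. cbv beta. rewrite Hq, Cpow_mult_l, RtoC_mult, RtoC_pow by trivial. ring. }
  assert (F0 : F 0 = 0%C).
  { apply CSeries_unique. apply (is_seriesC_ext (fun _ => RtoC 0)); [|exact is_seriesC_0].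
    intros n. unfold f. rewrite ibeta_0. ring. }
  assert (DD : forall t, 0 < t < 1 -> t <> 1 / 2 -> derC (fun s => F s - e s)%C t 0%C).
  { intros t Ht Hh. replace (RtoC 0) with (q t * Phi t - q t * Phi t)%C by ring.
    apply derC_minus; auto. }
  assert (Left : forall t, 0 < t < 1 / 2 -> (F t - e t = 0)%C).
  { apply (zero_of_derC_0 (fun s => F s - e s)%C 0 (1 / 2)); [lra| |].
    - intros t Ht. apply DD; lra.
    - replace (RtoC 0) with (F 0 - 0)%C by (rewrite F0; ring).
      apply limC_minus; [typeclasses eauto| |exact He0].
      apply Hlim; [typeclasses eauto| |lra|].
      + generalize at_right_0_unit. apply filter_imp. intros s Hs. lra.
      + intros g Hg. now apply continuous_at_right. }
  assert (Hec : contC e (1 / 2)) by (apply (derC_contC _ _ _ (He (1 / 2) ltac:(lra)))).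
  assert (Hd2 : 0 < 1 / 2) by lra.
  (* The difference vanishes at 1/2 as a limit from the left, and this starts the right half. *)
  assert (Mid : (F (1 / 2)%R - e (1 / 2)%R = 0)%C).
  { apply (limC_unique (at_left (1 / 2)) (fun s => F s - e s)%C).
    - apply limC_minus; [typeclasses eauto| |now apply contC_at_left].
      apply Hlim; [typeclasses eauto| |lra|].
      + exists (mkposreal _ Hd2). intros s Hs Hs0.
        change (Rabs (s - 1 / 2) < 1 / 2) in Hs. apply Rabs_lt_between in Hs. lra.
      + intros g Hg. now apply continuous_at_left.
    - apply (filterlim_ext_loc (fun _ => RtoC 0)); [|apply filterlim_const].
      exists (mkposreal _ Hd2). intros s Hs Hs0.
      change (Rabs (s - 1 / 2) < 1 / 2) in Hs. apply Rabs_lt_between in Hs.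
      symmetry. apply Left. lra. }
  assert (Right : forall t, 1 / 2 < t < 1 -> (F t - e t = 0)%C).
  { apply (zero_of_derC_0 (fun s => F s - e s)%C (1 / 2) 1); [lra| |].
    - intros t Ht. apply DD; lra.
    - rewrite <- Mid.
      apply limC_minus; [typeclasses eauto| |now apply contC_at_right].
      apply Hlim; [typeclasses eauto| |lra|].
      + exists (mkposreal _ Hd2). intros s Hs Hs0.
        change (Rabs (s - 1 / 2) < 1 / 2) in Hs. apply Rabs_lt_between in Hs. lra.
      + intros g Hg. now apply continuous_at_right. }
  replace l with (F 1).
  - apply HF. lra.
  - apply (limC_unique (at_left 1) F).
    + apply Hlim; [typeclasses eauto| |lra|].
      * generalize at_left_1_unit. apply filter_imp. intros s Hs. lra.
      * intros g Hg. now apply continuous_at_left.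
    + apply (filterlim_ext_loc e); [|exact He1].
      exists (mkposreal _ Hd2). intros s Hs Hs0.
      change (Rabs (s - 1) < 1 / 2) in Hs. apply Rabs_lt_between in Hs.
      symmetry. apply Cminus_0_eq. apply Right. lra.
Qed.


(** * The sums with a power of k *)

Open Scope C_scope.

(** The first letter 0 has no pole at 1, so [GPL_lim_1] applies to each word. *)
Lemma eval_comb_prepend_zero_lim_1 (n : nat) (q : Q) (c : list (Q * list (C -> C))) (x : C) :
  xwords n c -> good x ->
  limC (fun t : R => eval_comb (prepend q zero_l c) x t) (at_left 1) (eval_comb (prepend q zero_l c) x 1).
Proof.
  intros Hc Hx. induction Hc as [|[p s] c [Hp _] Hc IH].
  - exact (filterlim_const (RtoC 0)).
  - simpl prepend. rewrite eval_comb_cons.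
    apply (limC_plus (at_left 1) (fun t : R => Q2R (q * p) * GPL (eval_word x (zero_l :: s)) t)
             (fun t : R => eval_comb (prepend q zero_l c) x t)); [|exact IH].
    apply limC_scal; [typeclasses eauto|].
    apply (GPL_lim_1 0 (eval_word x s) 1); [now apply xword_reg | |].
    + intros H. apply C1_nz. now symmetry.
    + intros t Ht.
      assert (N : RtoC t <> 0) by (intros H; apply RtoC_inj in H; lra).
      split; trivial. replace (t - 0) with (RtoC t) by ring.
      rewrite Cmod_inv, Cmod_R, Rabs_pos_eq by (trivial; lra). unfold Rdiv. lra.
Qed.

Definition series_coef (a : nat -> R) (n : nat) : R := (a (S n) / (INR (S n) * binom_4k_2k (S n)))%R.

(** The numerators are O(k^(-3/4)) and 16^k / binom(4k, 2k) is O(k^(1/2)), which together with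
    1/k makes O(k^(-5/4)). *)
Lemma series_coef_summable (n : nat) (a : nat -> R) : mhs n a ->
  ex_series (fun m => (Rabs (series_coef a m) * 16 ^ S m)%R).
Proof.
  intros Ha. destruct (mhs_bound n a Ha) as [K HK].
  apply (ex_series_le (V := R_CompleteNormedModule) _ (fun m => 3 * K * / root4 (S m) ^ 5)%R).
  - intros m.
    change (Rabs (Rabs (series_coef a m) * 16 ^ S m) <= 3 * K * / root4 (S m) ^ 5)%R.
    assert (S0 : (0 < 16 ^ S m)%R) by (apply pow_lt; lra).
    rewrite Rabs_mult, Rabs_Rabsolu, (Rabs_pos_eq (16 ^ S m)) by lra.
    destruct (HK (S m) ltac:(lia)) as [A1 A2].
    assert (B := binom_pos (S m)). assert (BL := binom_lower (S m) ltac:(lia)).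
    assert (P := root4_pos (S m) ltac:(lia)).
    unfold series_coef. rewrite <- root4_4.
    revert A1 A2 B BL P S0. generalize (root4 (S m)) (binom_4k_2k (S m)) (16 ^ S m)%R (a (S m)).
    intros r b s y A1 A2 B BL P S0.
    assert (R3 : (0 < r ^ 3)%R) by (apply pow_lt; lra).
    assert (R4 : (0 < r ^ 4)%R) by (apply pow_lt; lra).
    assert (R5 : (0 < r ^ 5)%R) by (apply pow_lt; lra).
    assert (RB : (0 < r ^ 4 * b)%R) by (apply Rmult_lt_0_compat; lra).
    rewrite Rabs_pos_eq by (apply Rdiv_le_0_compat; lra).
    apply Rle_trans with (K / r ^ 3 / (r ^ 4 * b) * (3 * r ^ 2 * b))%R.
    + apply Rmult_le_compat; try lra.
      * apply Rdiv_le_0_compat; lra.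
      * apply Rmult_le_compat_r; [left; now apply Rinv_0_lt_compat | lra].
    + right. field. lra.
  - apply (ex_series_scal_l (V := R_NormedModule) (3 * K)%R). exact ex_series_root4.
Qed.

Lemma series_coef_le (a : nat -> R) (u : C) (m : nat) : (Cmod u <= 16)%R ->
  (Cmod (series_coef a m * u ^ S m) <= Rabs (series_coef a m) * 16 ^ S m)%R.
Proof.
  intros Hu. rewrite Cmod_mult, Cmod_pow, Cmod_R.
  apply Rmult_le_compat_l; [apply Rabs_pos|]. apply pow_incr.
  split; [apply Cmod_ge_0 | exact Hu].
Qed.

Lemma series_coef_correct (n : nat) (a : nat -> R) (u : C) : mhs n a -> (Cmod u <= 16)%R ->
  is_seriesC (fun m => series_coef a m * u ^ S m) (CSeries (fun m => series_coef a m * u ^ S m)).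
Proof.
  intros Ha Hu. apply (CSeries_correct _ (fun m => (Rabs (series_coef a m) * 16 ^ S m)%R)).
  - intros m. now apply series_coef_le.
  - exact (series_coef_summable n a Ha).
Qed.

(** The combination representing the numerators is integrated once more, against 2 dt / t. *)
Lemma series_coef_value (n : nat) (a : nat -> R) (c : list (Q * list (C -> C))) (x : C) :
  mhs n a -> xwords n c -> represents c a -> good x ->
  is_seriesC (fun m => series_coef a m * zscale x ^ S m) (eval_comb (prepend 2 zero_l c) x 1).
Proof.
  intros Ha Hc Hr Hx. assert (Hu := Cmod_zscale_le x (proj1 Hx)).
  destruct (mhs_bounded n a Ha) as [K HK].
  assert (Hcoef : forall m, (2 * a (S m) * ibeta (2 * m + 1) (2 * S m) 1 = series_coef a m)%R).
  { intros m. rewrite ibeta_div. unfold series_coef.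
    assert (B := binom_pos (S m)). assert (P : (0 < INR (S m))%R) by (apply lt_0_INR; lia).
    field. lra. }
  eapply is_seriesC_ext;
    [|apply (beta_integral_series (fun m => RtoC (2 * a (S m))) (2 * K)
        (fun m => 2 * m + 1)%nat (fun m => 2 * S m)%nat (fun t => / t)%R (zscale x)
        (fun t => 2 * eval_comb c x t) (fun t => eval_comb (prepend 2 zero_l c) x t))].
  - intros m. cbv beta. rewrite <- (Hcoef m), !RtoC_mult. ring.
  - exact Hu.
  - intros m. rewrite Cmod_R, Rabs_mult, (Rabs_pos_eq 2), Rmult_assoc by lra.
    apply Rmult_le_compat_l; [lra|]. apply bounded_linear; trivial. lia.
  - intros m t Ht. unfold beta_fun, quartic.
    replace (t * (1 - t) * (t * (1 - t)))%R with (t ^ 2 * (1 - t) ^ 2)%R by ring.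
    rewrite Rpow_mult_distr, <- !pow_mult.
    replace (2 * S m)%nat with (S (2 * m + 1)) by lia.
    simpl. field. lra.
  - intros t Ht. split; [left; apply Rinv_0_lt_compat; lra | lra].
  - apply (ex_series_le (V := R_CompleteNormedModule) _
             (fun m => (Rabs (series_coef a m) * 16 ^ S m)%R)); [|exact (series_coef_summable n a Ha)].
    intros m. rewrite Cmod_R.
    destruct (ibeta_le (2 * m + 1) (2 * S m) 1 ltac:(lra)) as [I _].
    assert (P := pow_le _ (S m) (Cmod_ge_0 (zscale x))).
    change (Rabs (Rabs (2 * a (S m)) * Cmod (zscale x) ^ S m * ibeta (2 * m + 1) (2 * S m) 1)
      <= Rabs (series_coef a m) * 16 ^ S m)%R.
    rewrite Rabs_pos_eq by (apply Rmult_le_pos; trivial; apply Rmult_le_pos; trivial; apply Rabs_pos).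
    rewrite <- Hcoef, (Rabs_mult (2 * a (S m))), (Rabs_pos_eq (ibeta _ _ 1)) by trivial.
    assert (Q : (Cmod (zscale x) ^ S m <= 16 ^ S m)%R)
      by (apply pow_incr; split; [apply Cmod_ge_0 | exact Hu]).
    assert (W : (0 <= Rabs (2 * a (S m)) * ibeta (2 * m + 1) (2 * S m) 1)%R)
      by (apply Rmult_le_pos; trivial; apply Rabs_pos).
    nra.
  - intros t Ht Hh.
    eapply is_seriesC_ext; [|apply (is_seriesC_scal 2); rewrite <- (Hr x Hx t Ht Hh);
      apply (gen_series_correct a K); [now apply bounded_linear | now apply Cmod_Z_lt_1; [apply Hx| |]]].
    intros m. cbv beta. rewrite RtoC_mult. ring.
  - intros t Ht.
    assert (D := eval_comb_prepend_derive 2 zero_l c x t).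
    replace (RtoC (/ t) * (2 * eval_comb c x t)) with (Q2R 2 * / (t - zero_l x) * eval_comb c x t).
    + apply D; trivial. eapply List.Forall_impl; [|exact Hc].
      intros p [Hp _]. apply xword_cons; auto.
    + replace (Q2R 2) with 2%R by (unfold Q2R; simpl; field).
      unfold zero_l. rewrite RtoC_inv by lra.
      assert (RtoC t <> 0) by (intros H; apply RtoC_inj in H; lra).
      replace (t - 0) with (RtoC t) by ring. ring.
  - apply (eval_comb_lim_0 (S n)); trivial. apply xwords_prepend; auto.
  - now apply (eval_comb_prepend_zero_lim_1 n).
Qed.

Lemma xword_nth (s : list (C -> C)) : xword s ->
  (forall i, (i < length s)%nat ->
     nth i s zero_l = zero_l \/ nth i s zero_l = one_l \/ Xi_fun (nth i s zero_l)) /\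
  Xi_fun (nth (length s - 1) s zero_l).
Proof.
  induction 1 as [f Hf|f s Hf Hs [IH1 IH2]].
  - split; [|exact Hf]. intros i Hi. simpl in Hi. replace i with 0%nat by lia. simpl. auto.
  - split.
    + intros [|i] Hi; [exact Hf|]. simpl in Hi |- *. apply IH1. lia.
    + simpl. rewrite Nat.sub_0_r. destruct s as [|g s]; [inversion Hs|].
      simpl in IH2 |- *. rewrite Nat.sub_0_r in IH2. exact IH2.
Qed.

Lemma xword_admissible_fun (w : nat) (s : list (C -> C)) : xword s -> length s = w ->
  admissible (fun _ => RtoC 0) (fun _ => RtoC 1) Xi_fun Xi_fun w w s.
Proof.
  intros Hs Hw. destruct (xword_nth s Hs) as [H1 H2]. subst w.
  split; [reflexivity|]. split; [|exact H2].
  intros l Hl _. apply (H1 (l - 1)%nat). lia.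
Qed.

Lemma Xi_fun_Xi (f : C -> C) (x : C) : Xi_fun f -> Xi x (f x).
Proof. unfold Xi. intros [-> | [-> | [-> | ->]]]; auto. Qed.

Lemma xword_admissible (w : nat) (s : list (C -> C)) (x : C) : xword s -> length s = w ->
  admissible (RtoC 0) (RtoC 1) (Xi x) (Xi x) w w (eval_word x s).
Proof.
  intros Hs Hw. destruct (xword_nth s Hs) as [H1 H2]. subst w.
  assert (N : forall i, nth i (eval_word x s) (RtoC 0) = nth i s zero_l x)
    by (intros i; exact (map_nth (fun f => f x) s zero_l i)).
  unfold eval_word in *. split; [apply length_map|]. rewrite N. split.
  - intros l Hl _. rewrite N. destruct (H1 (l - 1)%nat) as [H|[H|H]].
    + lia.
    + left. now rewrite H.
    + right. left. now rewrite H.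
    + right. right. now apply Xi_fun_Xi.
  - now apply Xi_fun_Xi.
Qed.

Lemma eval_comb_GPL_space (w : nat) (c : list (Q * list (C -> C))) (x : C) :
  xwords w c -> GPL_space 1 w w (Xi x) (Xi x) (eval_comb c x 1).
Proof.
  intros Hc. exists (fun _ => eval_comb c x 1). split.
  - intros j Hj. replace j with w by lia.
    exists (map (fun p => (fst p, GPL (eval_word x (snd p)) 1)) c). split.
    + apply List.Forall_map. eapply List.Forall_impl; [|exact Hc].
      intros [q s] [Hs Hw]. exists (eval_word x s). split; [now apply xword_admissible | reflexivity].
    + clear Hc. induction c as [|[q s] c IH]; [reflexivity|].
      rewrite eval_comb_cons, IH. reflexivity.
  - symmetry. apply (sum_n_n (G := C_AbelianMonoid)).
Qed.

Lemma limC_mult {T : Type} (F : (T -> Prop) -> Prop) {FF : Filter F}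
    (f g : T -> C) (l m : C) :
  limC f F l -> limC g F m -> limC (fun y => f y * g y) F (l * m).
Proof.
  intros H1 H2. apply limC_iff in H1; trivial. apply limC_iff in H2; trivial.
  destruct H1 as [A B]. destruct H2 as [A' B'].
  assert (Mul : forall p q : T -> R, forall a b, filterlim p F (locally a) ->
     filterlim q F (locally b) -> filterlim (fun y => p y * q y)%R F (locally (a * b)%R)).
  { intros p q a b Hp Hq.
    exact (filterlim_comp_2 p q Rmult Hp Hq (filterlim_mult (K := R_AbsRing) a b)). }
  assert (Sub : forall p q : T -> R, forall a b, filterlim p F (locally a) ->
     filterlim q F (locally b) -> filterlim (fun y => p y - q y)%R F (locally (a - b)%R)).
  { intros p q a b Hp Hq.
    apply (filterlim_plus_fun (V := R_NormedModule) p (fun y => - q y)%R a (- b)%R Hp).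
    apply filterlim_comp with (1 := Hq). apply (filterlim_opp (V := R_NormedModule)). }
  apply limC_iff; trivial. split.
  - apply Sub; apply Mul; assumption.
  - apply (filterlim_plus_fun (V := R_NormedModule)); apply Mul; assumption.
Qed.

Lemma limC_pow {T : Type} (F : (T -> Prop) -> Prop) {FF : Filter F}
    (f : T -> C) (l : C) (n : nat) : limC f F l -> limC (fun y => f y ^ n) F (l ^ n).
Proof.
  intros H. induction n as [|n IH].
  - apply filterlim_const.
  - simpl. now apply limC_mult.
Qed.

Lemma to_half_filter : Filter to_half.
Proof. unfold to_half. apply within_filter, locally_filter. Qed.

Lemma to_half_good : to_half good.
Proof. unfold to_half, within. apply filter_forall. intros y [H1 H2]. now split. Qed.

Lemma conv_domain_half : conv_domain (1 / 2).
Proof.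
  unfold conv_domain. replace (4 * (1 / 2) * (1 - 1 / 2)) with (RtoC 1) by field.
  rewrite Cmod_1. lra.
Qed.

(** The difference of the two values is 64 (y - 1/2)^2 / (4 y (1 - y)), and the denominator is
    at least 1 in modulus on the region that defines the filter. *)
Lemma zscale_lim_half : limC zscale to_half (zscale (1 / 2)).
Proof.
  assert (FF := to_half_filter).
  assert (Id : limC (fun y => y - 1 / 2) to_half (RtoC 0)).
  { replace (RtoC 0) with (1 / 2 - 1 / 2) by ring.
    apply limC_minus; trivial; [|apply filterlim_const].
    intros P HP. unfold filtermap, to_half, within.
    eapply filter_imp; [|exact HP]. intros y Hy _. exact Hy. }
  assert (Sq := limC_mult _ _ _ _ _ Id Id).
  assert (D : limC (fun y => zscale y - zscale (1 / 2)) to_half (RtoC 0)).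
  { apply (limC_Cmod_0 to_half (fun y => zscale y - zscale (1 / 2))
      (fun y => 64 * Cmod ((y - 1 / 2) * (y - 1 / 2)))%R).
    - generalize to_half_good. apply filter_imp. intros y [Hy _].
      destruct (conv_domain_neq_0 y Hy) as [Y0 Y1].
      replace (zscale y - zscale (1 / 2)) with ((64 * ((y - 1 / 2) * (y - 1 / 2))) / (4 * y * (1 - y)))
        by (unfold zscale; field; now split).
      rewrite Cmod_div by (repeat apply Cmult_neq_0; trivial; intros H; apply RtoC_inj in H; lra).
      rewrite (Cmod_mult 64), Cmod_R, (Rabs_pos_eq 64) by lra.
      unfold conv_domain in Hy. set (z := Cmod (4 * y * (1 - y))) in *.
      set (s := Cmod ((y - 1 / 2) * (y - 1 / 2))).
      assert (0 <= s)%R by apply Cmod_ge_0.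
      apply Rmult_le_reg_r with z; [lra|].
      unfold Rdiv. rewrite Rmult_assoc, Rinv_l by lra. nra.
    - apply limC_iff in Sq; trivial.
      replace 0%R with (64 * Cmod (0 * 0))%R by (rewrite Cmult_0_l, Cmod_0; ring).
      apply (filterlim_comp _ _ _ (fun y => Cmod ((y - 1 / 2) * (y - 1 / 2))) (fun s => 64 * s)%R
              to_half (locally (Cmod (0 * 0)))).
      + assert (Sq' : limC (fun y => (y - 1 / 2) * (y - 1 / 2)) to_half (0 * 0))
          by (apply limC_iff; trivial).
        apply filterlim_comp with (1 := Sq').
        exact (filterlim_norm (V := C_NormedModule) (0 * 0)).
      + apply (filterlim_scal_r (V := R_NormedModule) 64). }
  replace (zscale (1 / 2)) with (0 + zscale (1 / 2)) by ring.
  eapply filterlim_ext; [|apply (limC_plus to_half _ (fun _ => zscale (1 / 2)) _ _ D);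
    apply filterlim_const].
  intros y. simpl. ring.
Qed.

(** Near x = 1/2 the combination equals the sum of the series, which is continuous in x by
    [tannery], with the majorant taken at the boundary value |u| = 16. *)
Lemma eval_comb_GPL_space_lim (n : nat) (a : nat -> R) (w : nat) (c : list (Q * list (C -> C))) :
  mhs n a -> xwords w c ->
  (forall x, good x -> is_seriesC (fun m => series_coef a m * zscale x ^ S m) (eval_comb c x 1)) ->
  GPL_space_lim to_half 1 w w Xi_fun Xi_fun (CSeries (fun m => series_coef a m * zscale (1 / 2) ^ S m)).
Proof.
  intros Ha Hc H. assert (FF := to_half_filter). exists c. split.
  - eapply List.Forall_impl; [|exact Hc]. intros [q s] [Hs Hw].
    exists w. split; [lia|]. now apply xword_admissible_fun.
  - apply (tannery (V := C_NormedModule) to_half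
      (fun m y => series_coef a m * zscale y ^ S m) (fun m => series_coef a m * zscale (1 / 2) ^ S m)
      (fun m => (Rabs (series_coef a m) * 16 ^ S m)%R) (fun y => eval_comb c y 1)).
    + exact (series_coef_summable n a Ha).
    + generalize to_half_good. apply filter_imp. intros y [Hy _] m.
      exact (series_coef_le a (zscale y) m (Cmod_zscale_le y Hy)).
    + intros m. exact (series_coef_le a (zscale (1 / 2)) m (Cmod_zscale_le _ conv_domain_half)).
    + intros m. apply limC_scal; trivial. apply limC_pow; trivial. exact zscale_lim_half.
    + generalize to_half_good. apply filter_imp. intros y Hy. now apply H.
    + exact (series_coef_correct n a _ Ha (Cmod_zscale_le _ conv_domain_half)).
Qed.

Lemma series_power (x : C) (r : nat) (rs : list nat) :
  conv_domain x -> (1 <= r)%nat -> List.Forall (fun rj => (1 <= rj)%nat) rs ->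
  let w := (r + 1 + list_sum rs)%nat in
  exists v : C,
    is_seriesC (fun n : nat => let k := S n in
      RtoC (harmonic_prod rs k) / RtoC (INR k ^ (r + 1) * binom_4k_2k k)
            * (2 ^ 2 / (x * (1 - x))) ^ k) v /\
    (x <> 1 / 2 -> GPL_space 1 w w (Xi x) (Xi x) v) /\
    (x = 1 / 2 -> GPL_space_lim to_half 1 w w Xi_fun Xi_fun v).
Proof.
  intros Hx Hr Hrs w.
  set (a := fun k => (harmonic_prod rs k / INR k ^ r)%R).
  assert (Ha := mhs_harmonic_prod r rs Hr Hrs). fold a in Ha.
  destruct (mhs_representable _ _ Ha) as [c [Hc Rc]].
  assert (Hw : xwords w (prepend 2 zero_l c)).
  { replace w with (S (list_sum rs + r)) by (unfold w; lia). apply xwords_prepend; auto. }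
  assert (V := fun y Hy => series_coef_value _ a c y Ha Hc Rc Hy).
  exists (CSeries (fun m => series_coef a m * zscale x ^ S m)). split; [|split].
  - eapply is_seriesC_ext; [|exact (series_coef_correct _ a _ Ha (Cmod_zscale_le x Hx))].
    intros n. cbv beta zeta. unfold series_coef, a, zscale. f_equal.
    assert (B := binom_pos (S n)).
    assert (P : (0 < INR (S n))%R) by (apply lt_0_INR; lia).
    assert (P2 : (0 < INR (S n) ^ r)%R) by (now apply pow_lt).
    rewrite <- RtoC_div.
    + f_equal. rewrite pow_add, pow_1. field. lra.
    + rewrite pow_add, pow_1. apply Rgt_not_eq.
      apply Rmult_lt_0_compat; [now apply Rmult_lt_0_compat | exact B].
  - intros Hh. rewrite (CSeries_unique _ _ (V x (conj Hx Hh))). now apply eval_comb_GPL_space.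
  - intros ->. exact (eval_comb_GPL_space_lim _ a w _ Ha Hw V).
Qed.


(** * The sums with 4k+1 and 4k+3 *)

(** At z = t in [0, 1) this is log (1 - Z(t)), continued from log 1 = 0 along the path, as
    G(xi; t) is log (1 - t / xi). *)
Definition letter_sum (x z : C) : C := sum01 (fun l => sum01 (fun m => GPL (xi l m x :: nil) z)).

(** The first letter is kept fixed, because the partial fractions only give it a coefficient. *)
Definition pair_sum (l m : nat) (x z : C) : C :=
  sum01 (fun l' => sum01 (fun m' => GPL (xi l m x :: xi l' m' x :: nil) z)).

Definition pair_comb (k : nat -> nat -> C) (x z : C) : C :=
  sum01 (fun l => sum01 (fun m => k l m * pair_sum l m x z)).

Definition is01 (l : nat) : Prop := l = 0%nat \/ l = 1%nat.

Lemma derC_sum01 (f : nat -> R -> C) (d : nat -> C) (t : R) :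
  (forall l, is01 l -> derC (f l) t (d l)) ->
  derC (fun t => sum01 (fun l => f l t)) t (sum01 d).
Proof.
  intros H. apply (derC_plus (f 0%nat) (f 1%nat)); apply H; unfold is01; auto.
Qed.

Lemma limC_sum01 {T : Type} (F : (T -> Prop) -> Prop) {FF : Filter F}
    (f : nat -> T -> C) (v : nat -> C) :
  (forall l, is01 l -> limC (f l) F (v l)) ->
  limC (fun t => sum01 (fun l => f l t)) F (sum01 v).
Proof.
  intros H. apply (limC_plus F (f 0%nat) (f 1%nat)); apply H; unfold is01; auto.
Qed.

Lemma xi_word_reg (x : C) (l m l' m' : nat) : good x -> is01 l -> is01 m -> is01 l' -> is01 m' ->
  reg_word (xi l m x :: xi l' m' x :: nil).
Proof.
  intros [Hd Hx] Hl Hm Hl' Hm'. apply reg_cons; [apply off_closed_open | apply reg_last];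
    now apply off_closed_path_xi.
Qed.

Lemma pair_sum_derive (l m : nat) (x : C) (t : R) : good x -> is01 l -> is01 m -> (0 < t < 1)%R ->
  derC (fun t => pair_sum l m x t) t (/ (t - xi l m x) * letter_sum x t).
Proof.
  intros Hx Hl Hm Ht.
  replace (/ (t - xi l m x) * letter_sum x t)
    with (sum01 (fun l' => sum01 (fun m' => / (t - xi l m x) * GPL (xi l' m' x :: nil) t)))
    by (unfold letter_sum, sum01; ring).
  apply (derC_sum01 (fun l' t => sum01 (fun m' => GPL (xi l m x :: xi l' m' x :: nil) (RtoC t)))).
  intros l' Hl'.
  apply (derC_sum01 (fun m' t => GPL (xi l m x :: xi l' m' x :: nil) (RtoC t))).
  intros m' Hm'.
  exact (proj1 (proj2 (GPL_reg _ (xi_word_reg x l m l' m' Hx Hl Hm Hl' Hm'))) t Ht).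
Qed.

Lemma pair_sum_lim_0 (l m : nat) (x : C) : good x -> is01 l -> is01 m ->
  limC (fun t : R => pair_sum l m x t) (at_right 0) (RtoC 0).
Proof.
  intros Hx Hl Hm.
  replace (RtoC 0) with (sum01 (fun _ => sum01 (fun _ => RtoC 0))) by (unfold sum01; ring).
  apply (limC_sum01 (at_right 0)
    (fun l' t => sum01 (fun m' => GPL (xi l m x :: xi l' m' x :: nil) (RtoC t)))).
  intros l' Hl'.
  apply (limC_sum01 (at_right 0) (fun m' t => GPL (xi l m x :: xi l' m' x :: nil) (RtoC t))).
  intros m' Hm'. apply (GPL_reg _ (xi_word_reg x l m l' m' Hx Hl Hm Hl' Hm')).
Qed.

Lemma pair_sum_lim_1 (l m : nat) (x : C) : good x -> is01 l -> is01 m ->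
  limC (fun t : R => pair_sum l m x t) (at_left 1) (pair_sum l m x 1).
Proof.
  intros Hx Hl Hm.
  apply (limC_sum01 (at_left 1)
    (fun l' t => sum01 (fun m' => GPL (xi l m x :: xi l' m' x :: nil) (RtoC t)))
    (fun l' => sum01 (fun m' => GPL (xi l m x :: xi l' m' x :: nil) 1))).
  intros l' Hl'.
  apply (limC_sum01 (at_left 1) (fun m' t => GPL (xi l m x :: xi l' m' x :: nil) (RtoC t))
    (fun m' => GPL (xi l m x :: xi l' m' x :: nil) 1)).
  intros m' Hm'.
  assert (Hs : off_closed_path (xi l m x)) by (apply off_closed_path_xi; trivial; apply Hx).
  destruct (Hs) as [K HK].
  apply (GPL_lim_1 (xi l m x) (xi l' m' x :: nil) K).
  - apply reg_last. apply off_closed_path_xi; trivial; apply Hx.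
  - now apply off_closed_path_neq_1.
  - intros t Ht. destruct (HK t ltac:(lra)) as [A B]. split; trivial.
    apply Rle_trans with (1 := B).
    assert (0 <= K)%R by (generalize (Cmod_ge_0 (/ (t - xi l m x))); lra).
    unfold Rdiv. rewrite <- (Rmult_1_r K) at 1. apply Rmult_le_compat_l; trivial.
    rewrite <- Rinv_1. apply Rinv_le_contravar; lra.
Qed.

Lemma pair_comb_derive (k : nat -> nat -> C) (x : C) (t : R) : good x -> (0 < t < 1)%R ->
  derC (fun t => pair_comb k x t) t
    (sum01 (fun l => sum01 (fun m => k l m * / (t - xi l m x))) * letter_sum x t).
Proof.
  intros Hx Ht.
  replace (sum01 (fun l => sum01 (fun m => k l m * / (t - xi l m x))) * letter_sum x t)
    with (sum01 (fun l => sum01 (fun m => k l m * (/ (t - xi l m x) * letter_sum x t))))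
    by (unfold sum01; ring).
  apply (derC_sum01 (fun l t => sum01 (fun m => k l m * pair_sum l m x (RtoC t)))). intros l Hl.
  apply (derC_sum01 (fun m t => k l m * pair_sum l m x (RtoC t))). intros m Hm.
  apply derC_scal. now apply pair_sum_derive.
Qed.

Lemma pair_comb_lim_0 (k : nat -> nat -> C) (x : C) : good x ->
  limC (fun t : R => pair_comb k x t) (at_right 0) (RtoC 0).
Proof.
  intros Hx.
  replace (RtoC 0) with (sum01 (fun l => sum01 (fun m => k l m * 0))) by (unfold sum01; ring).
  apply (limC_sum01 (at_right 0) (fun l t => sum01 (fun m => k l m * pair_sum l m x (RtoC t)))).
  intros l Hl.
  apply (limC_sum01 (at_right 0) (fun m t => k l m * pair_sum l m x (RtoC t)) (fun m => k l m * 0)).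
  intros m Hm. apply limC_scal; [typeclasses eauto|]. now apply pair_sum_lim_0.
Qed.

Lemma pair_comb_lim_1 (k : nat -> nat -> C) (x : C) : good x ->
  limC (fun t : R => pair_comb k x t) (at_left 1) (pair_comb k x 1).
Proof.
  intros Hx.
  apply (limC_sum01 (at_left 1) (fun l t => sum01 (fun m => k l m * pair_sum l m x (RtoC t)))
    (fun l => sum01 (fun m => k l m * pair_sum l m x 1))).
  intros l Hl.
  apply (limC_sum01 (at_left 1) (fun m t => k l m * pair_sum l m x (RtoC t))
    (fun m => k l m * pair_sum l m x 1)).
  intros m Hm. apply limC_scal; [typeclasses eauto|]. now apply pair_sum_lim_1.
Qed.

Lemma Q2R_1 : Q2R 1 = 1%R.
Proof. unfold Q2R. simpl. field. Qed.
Lemma Q2R_m1 : Q2R (-1) = (-1)%R.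
Proof. unfold Q2R. simpl. field. Qed.

Lemma eval_comb_letters (x z : C) : eval_comb (prepend_xi unit_comb) x z = - letter_sum x z.
Proof.
  unfold prepend_xi, unit_comb, prepend. simpl map. simpl app. rewrite !eval_comb_cons.
  simpl fst. rewrite !Q2R_mult, Q2R_1, Q2R_m1.
  change (eval_comb nil x z) with (RtoC 0). unfold letter_sum, sum01, eval_word. simpl map. 
  rewrite RtoC_mult. ring.
Qed.

Lemma eval_comb_letters2 (x z : C) :
  eval_comb (prepend_xi (prepend_xi unit_comb)) x z = pair_comb (fun _ _ => 1) x z.
Proof.
  unfold prepend_xi, unit_comb, prepend. simpl map. simpl app. rewrite !eval_comb_cons.
  simpl fst. rewrite !Q2R_mult, Q2R_1, Q2R_m1.
  change (eval_comb nil x z) with (RtoC 0). unfold pair_comb, pair_sum, sum01, eval_word. simpl map. 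
  rewrite !RtoC_mult. ring.
Qed.

(** The sum is the generating function of a multiple harmonic sum of weight 2, and as t -> 1 it
    behaves as it does for t -> 0, by symmetry. *)
Lemma pair_comb_1 (x : C) : good x -> pair_comb (fun _ _ => 1) x 1 = 0.
Proof.
  intros Hx.
  set (a := fun k => (sum_n_m (fun k => / INR k) 1 (pred k) / INR k)%R).
  assert (Ha : mhs 2 a) by (apply mhs_sum; constructor).
  destruct (mhs_bounded _ _ Ha) as [K HK].
  assert (Hr : represents (prepend_xi (prepend_xi unit_comb)) a)
    by (apply (represents_sum 1); [constructor | exact xwords_letters | exact represents_inv]).
  apply (limC_unique (at_left 1) (fun t : R => pair_comb (fun _ _ => 1) x t)).
  - now apply pair_comb_lim_1.
  - apply (filterlim_ext_loc (fun t => gen_series a (zscale x) (1 - t))).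
    + assert (Hd : (0 < 1 / 2)%R) by lra.
      exists (mkposreal _ Hd). intros t Ht Ht1.
      change (Rabs (t - 1) < 1 / 2)%R in Ht. apply Rabs_lt_between in Ht.
      rewrite gen_series_sym, (Hr x Hx t) by lra. apply eval_comb_letters2.
    + apply filterlim_comp with (2 := gen_series_lim_0 a K (zscale x) HK).
      intros P [d Hd]. exists d. intros t Ht Ht1. apply Hd; [|lra].
      change (Rabs (1 - t - 0) < d)%R. rewrite Rminus_0_r, Rabs_minus_sym. exact Ht.
Qed.

Lemma harmonic_bound (k : nat) : (Rabs (harmonic 1 k) <= INR k)%R.
Proof.
  induction k as [|k IH].
  - unfold harmonic. rewrite sum_1_0, Rabs_R0. simpl. lra.
  - unfold harmonic in *. rewrite sum_1_S, S_INR, pow_1.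
    apply Rle_trans with (1 := Rabs_triang _ _).
    assert (1 <= INR (S k))%R by (change 1%R with (INR 1); apply le_INR; lia).
    rewrite <- S_INR. rewrite (Rabs_pos_eq (/ INR (S k))) by (left; apply Rinv_0_lt_compat; lra).
    rewrite S_INR at 2. apply Rplus_le_compat; trivial.
    rewrite <- Rinv_1. apply Rinv_le_contravar; lra.
Qed.

(** The harmonic numbers are the partial sums of 1/k, so [partial_sums_series] applies. *)
Lemma harmonic_generating (x : C) (t : R) :
  good x -> (0 < t < 1)%R -> t <> (1 / 2)%R ->
  is_seriesC (fun n => harmonic 1 (S n) * (zscale x * quartic t) ^ S n)
    (- letter_sum x t / (1 - zscale x * quartic t)).
Proof.
  intros Hx Ht Hh. assert (HZ := Cmod_Z_lt_1 x t (proj1 Hx) Ht Hh).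
  rewrite <- eval_comb_letters, <- (represents_inv x Hx t Ht Hh).
  destruct (mhs_bounded _ _ mhs_inv) as [K HK].
  assert (P := partial_sums_series _ K (zscale x * quartic t) _ HK HZ
    (gen_series_correct _ K (zscale x) t (bounded_linear _ K HK) HZ)).
  assert (H : forall k, sum_n_m (fun k => / INR k)%R 1 k = harmonic 1 k).
  { intros k. unfold harmonic. apply sum_n_m_ext. intros j. now rewrite pow_1. }
  eapply is_seriesC_ext.
  2:{ apply (is_series_incr_1 (V := C_NormedModule)
        (fun n => sum_n_m (fun k => / INR k)%R 1 n * (zscale x * quartic t) ^ n)).
      match goal with |- is_series _ (plus ?l _) => 
        change (is_seriesC (fun n => sum_n_m (fun k => / INR k)%R 1 n * (zscale x * quartic t) ^ n)
          (l + sum_n_m (fun k => / INR k)%R 1 0 * (zscale x * quartic t) ^ 0)) end.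
      rewrite sum_1_0, Cmult_0_l, Cplus_0_r. exact P. }
  intros n. cbv beta. now rewrite H.
Qed.

Lemma ibeta_one_le (k : nat) : (1 <= k)%nat -> (16 ^ k * ibeta (2 * k) (2 * k) 1 <= 1)%R.
Proof.
  intros Hk. rewrite ibeta_one.
  assert (B := binom_pos k). assert (BL := binom_lower k Hk). assert (P := root4_pos k Hk).
  assert (Q := pos_INR k).
  assert (R4 := root4_4 k).
  assert (R2 : (1 <= root4 k ^ 2)%R) by (apply pow_R1_Rle; lra).
  replace (root4 k ^ 4)%R with (root4 k ^ 2 * root4 k ^ 2)%R in R4 by ring.
  assert (R3 : (root4 k ^ 2 <= INR k)%R) by nra.
  assert (D : (0 < (4 * INR k + 1) * binom_4k_2k k)%R) by (apply Rmult_lt_0_compat; lra).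
  apply Rmult_le_reg_r with ((4 * INR k + 1) * binom_4k_2k k)%R; trivial.
  rewrite Rmult_assoc, Rinv_l by lra.
  apply Rle_trans with (3 * root4 k ^ 2 * binom_4k_2k k)%R; [lra|].
  rewrite Rmult_1_l. apply Rmult_le_compat_r; lra.
Qed.

Lemma ibeta_quad_le (k : nat) :
  (ibeta (2 * k + 1) (2 * k + 1) 1 <= ibeta (2 * k) (2 * k) 1)%R.
Proof.
  rewrite ibeta_quad, ibeta_one. assert (B := binom_pos k). assert (Q := pos_INR k).
  assert (D : (0 < (4 * INR k + 1) * binom_4k_2k k)%R) by (apply Rmult_lt_0_compat; lra).
  assert (/ ((4 * INR k + 3) * binom_4k_2k k) <= / ((4 * INR k + 1) * binom_4k_2k k))%R
    by (apply Rinv_le_contravar; trivial; apply Rmult_le_compat_r; lra).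
  assert (0 < / ((4 * INR k + 1) * binom_4k_2k k))%R by now apply Rinv_0_lt_compat.
  lra.
Qed.

(** For |u| < 16 a factor (|u| / 16)^k is left, which absorbs the growth of the harmonic numbers. *)
Lemma harmonic_summable (u : C) (b : nat -> R) : (Cmod u < 16)%R ->
  (forall n, (0 <= b n)%R /\ (16 ^ S n * b n <= 1)%R) ->
  ex_series (fun n => (Cmod (RtoC (harmonic 1 (S n))) * Cmod u ^ S n * b n)%R).
Proof.
  intros Hu Hb. set (r := (Cmod u / 16)%R). assert (U := Cmod_ge_0 u).
  assert (Hr : (0 <= r < 1)%R) by (unfold r; lra).
  apply (ex_series_le (V := R_CompleteNormedModule) _ (fun n => INR (S n) * r ^ n)%R);
    [|now apply ex_series_n_geom].
  intros n. destruct (Hb n) as [B1 B2]. rewrite Cmod_R.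
  change (Rabs (Rabs (harmonic 1 (S n)) * Cmod u ^ S n * b n) <= INR (S n) * r ^ n)%R.
  replace (Cmod u) with (r * 16)%R by (unfold r; field).
  rewrite Rpow_mult_distr.
  assert (P1 : (0 <= r ^ n)%R) by (apply pow_le; lra).
  assert (P2 : (0 < 16 ^ S n)%R) by (apply pow_lt; lra).
  assert (P3 : (0 <= r ^ S n <= r ^ n)%R) by (simpl; nra).
  rewrite Rabs_pos_eq by (apply Rmult_le_pos; trivial; apply Rmult_le_pos;
    [apply Rabs_pos | apply Rmult_le_pos; lra]).
  replace (Rabs (harmonic 1 (S n)) * (r ^ S n * 16 ^ S n) * b n)%R
    with (Rabs (harmonic 1 (S n)) * (r ^ S n * (16 ^ S n * b n)))%R by ring.
  apply Rmult_le_compat; [apply Rabs_pos | | apply harmonic_bound |].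
  - apply Rmult_le_pos; [lra|]. apply Rmult_le_pos; lra.
  - assert (0 <= 16 ^ S n * b n)%R by (apply Rmult_le_pos; lra). nra.
Qed.

(** The generating function of the harmonic numbers is - [letter_sum] / (1 - Z), so if
    the k l m are the coefficients of the partial fractions of - q / (1 - Z), the integrand is the
    derivative of [pair_comb]. *)
Lemma harmonic_beta_series (x : C) (al : nat -> nat) (q : R -> R) (k : nat -> nat -> C) :
  good x ->
  (forall n t, (0 < t < 1)%R -> beta_fun (al n) (al n) t = (q t * quartic t ^ S n)%R) ->
  (forall t, (0 < t < 1)%R -> (0 <= q t <= / t)%R) ->
  ex_series (fun n => (Cmod (RtoC (harmonic 1 (S n))) * Cmod (zscale x) ^ S n
                       * ibeta (al n) (al n) 1)%R) ->
  (forall t, (0 < t < 1)%R ->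
     sum01 (fun l => sum01 (fun m => k l m * / (t - xi l m x)))
     = - (q t / (1 - zscale x * quartic t))) ->
  is_seriesC (fun n => harmonic 1 (S n) * zscale x ^ S n * ibeta (al n) (al n) 1)
    (pair_comb k x 1).
Proof.
  intros Hx Hq Hq0 HM Hk.
  apply (beta_integral_series (fun n => RtoC (harmonic 1 (S n))) 1 al al q (zscale x)
    (fun t => - letter_sum x t / (1 - zscale x * quartic t)) (fun t => pair_comb k x t)); trivial.
  - apply Cmod_zscale_le, Hx.
  - intros n. rewrite Cmod_R, Rmult_1_l. apply harmonic_bound.
  - intros t Ht Hh. now apply harmonic_generating.
  - intros t Ht. assert (D := pair_comb_derive k x t Hx Ht). rewrite Hk in D by trivial.
    replace (q t * (- letter_sum x t / (1 - zscale x * quartic t)))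
      with (- (q t / (1 - zscale x * quartic t)) * letter_sum x t); [exact D|].
    unfold Cdiv. ring.
  - now apply pair_comb_lim_0.
  - now apply pair_comb_lim_1.
Qed.

(** The residues of - 1 / (1 - Z) at the xi. *)
Definition coef_first (x : C) (l m : nat) : C :=
  - (Csqrt (1 - x) * Csqrt x * ((-1) ^ l * Csqrt (1 - x) - (-1) ^ m * Csqrt x)
    / (4 * (2 * x - 1))).

(** The residues of - t (1 - t) / (1 - Z) at the xi. *)
Definition coef_second (x : C) (l m : nat) : C :=
  - ((Csqrt (1 - x) * Csqrt x) * (Csqrt (1 - x) * Csqrt x)
     / (8 * ((-1) ^ l * Csqrt x + (-1) ^ m * Csqrt (1 - x)))).

Lemma inv_one_minus_Z (x : C) (t : R) : good x -> (0 < t < 1)%R ->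
  / (1 - zscale x * quartic t) = - ((Csqrt (1 - x) * Csqrt x) * (Csqrt (1 - x) * Csqrt x) / 4) /
    ((t - xi 0 0 x) * (t - xi 0 1 x) * (t - xi 1 0 x) * (t - xi 1 1 x)).
Proof.
  intros Hx Ht. destruct (conv_domain_neq_0 x (proj1 Hx)) as [H0 H1].
  rewrite one_minus_Z by apply Hx.
  replace (Csqrt (1 - x) * Csqrt x * (Csqrt (1 - x) * Csqrt x))
    with (Csqrt (1 - x) * Csqrt (1 - x) * (Csqrt x * Csqrt x)) by ring.
  rewrite !Csqrt_sqr. unfold zscale.
  field. repeat split; trivial; apply real_neq_xi; auto; lra.
Qed.

Lemma half_neq (z w : C) : z - w / 2 <> 0 -> z * 2 - w <> 0.
Proof.
  intros H E. apply H. replace (z - w / 2) with ((z * 2 - w) / 2) by field. rewrite E. field.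
Qed.

Lemma partial_fractions_1 (x : C) (t : R) : good x -> (0 < t < 1)%R ->
  sum01 (fun l => sum01 (fun m => coef_first x l m * / (t - xi l m x)))
  = - (1 / (1 - zscale x * quartic t)).
Proof.
  intros Hx Ht.
  assert (X : 2 * x - 1 <> 0).
  { intros H. apply (proj2 Hx). replace x with ((2 * x - 1 + 1) / 2) by field. rewrite H. field. }
  assert (N00 := real_neq_xi x t 0 0 Hx ltac:(lra) ltac:(auto) ltac:(auto)).
  assert (N01 := real_neq_xi x t 0 1 Hx ltac:(lra) ltac:(auto) ltac:(auto)).
  assert (N10 := real_neq_xi x t 1 0 Hx ltac:(lra) ltac:(auto) ltac:(auto)).
  assert (N11 := real_neq_xi x t 1 1 Hx ltac:(lra) ltac:(auto) ltac:(auto)).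
  unfold Cdiv at 1. rewrite Cmult_1_l, inv_one_minus_Z by trivial.
  unfold sum01, coef_first. simpl Cpow.
  (* Written this way, the identity to prove holds for independent p, q and t. *)
  replace (2 * x - 1) with (Csqrt x * Csqrt x - Csqrt (1 - x) * Csqrt (1 - x)) in *
    by (rewrite !Csqrt_sqr; ring).
  rewrite xi_00, xi_01, xi_10, xi_11 in *.
  set (p := Csqrt x) in *. set (q := Csqrt (1 - x)) in *. clearbody p q.
  apply half_neq in N00, N01, N10, N11.
  field. repeat split; assumption.
Qed.

Definition sigma (x : C) (l m : nat) : C := (-1) ^ l * Csqrt x + (-1) ^ m * Csqrt (1 - x).

Lemma xi_sigma (x : C) (l m : nat) : xi l m x = (1 + sigma x l m) / 2.
Proof. unfold xi, sigma. field. Qed.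

Lemma sigma_neq (x : C) (l m : nat) : good x -> is01 l -> is01 m ->
  sigma x l m <> 0 /\ 1 - sigma x l m <> 0.
Proof.
  intros Hx Hl Hm. split; intros E.
  - apply (real_neq_xi x (1 / 2) l m Hx ltac:(lra) Hl Hm).
    rewrite xi_sigma, E, RtoC_div by lra. field.
  - apply (real_neq_xi x 1 l m Hx ltac:(lra) Hl Hm).
    rewrite xi_sigma. replace (sigma x l m) with (1 - (1 - sigma x l m)) by ring.
    rewrite E. field.
Qed.

(** Unlike [partial_fractions_1], this uses (sqrt x)^2 + (sqrt (1 - x))^2 = 1, which relates
    t (1 - t) to (2t - 1)^2. *)
Lemma partial_fractions_2 (x : C) (t : R) : good x -> (0 < t < 1)%R ->
  sum01 (fun l => sum01 (fun m => coef_second x l m * / (t - xi l m x)))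
  = - (RtoC (t * (1 - t)) / (1 - zscale x * quartic t)).
Proof.
  intros Hx Ht.
  assert (N00 := real_neq_xi x t 0 0 Hx ltac:(lra) ltac:(auto) ltac:(auto)).
  assert (N01 := real_neq_xi x t 0 1 Hx ltac:(lra) ltac:(auto) ltac:(auto)).
  assert (N10 := real_neq_xi x t 1 0 Hx ltac:(lra) ltac:(auto) ltac:(auto)).
  assert (N11 := real_neq_xi x t 1 1 Hx ltac:(lra) ltac:(auto) ltac:(auto)).
  assert (S00 := proj1 (sigma_neq x 0 0 Hx ltac:(now left) ltac:(now left))).
  assert (S01 := proj1 (sigma_neq x 0 1 Hx ltac:(now left) ltac:(now right))).
  unfold Cdiv at 1. rewrite inv_one_minus_Z, RtoC_mult, RtoC_minus by trivial.
  unfold sum01, coef_second. unfold sigma in *. simpl Cpow in *.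
  rewrite xi_00, xi_01, xi_10, xi_11 in *.
  assert (Hq := Csqrt_compl_sqr x).
  set (p := Csqrt x) in *. set (q := Csqrt (1 - x)) in *. clearbody p q.
  (* Written this way, the identity to prove holds for independent p, q and t. *)
  assert (E : t * (1 - t) = (p * p + q * q - (2 * t - 1) * (2 * t - 1)) / 4)
    by (rewrite Hq; field).
  rewrite E. clear E Hq.
  replace (1 * p + 1 * q) with (p + q) in * by ring.
  replace (1 * p + -1 * 1 * q) with (p - q) in * by ring.
  replace (-1 * 1 * p + 1 * q) with (- (p - q)) by ring.
  replace (-1 * 1 * p + -1 * 1 * q) with (- (p + q)) by ring.
  apply half_neq in N00, N01, N10, N11.
  field. repeat split; assumption.
Qed.

(** With e, d the two signs, p = sqrt x, q = sqrt (1 - x) and s = e p + d q, the relation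
    s^2 = 1 + 2 e d p q turns the denominator into e d s (1 - s) and 2 p q into e d (s^2 - 1).
    The quotient is then - (p q)^2 (1 + s) / s, where - (p q)^2 / s is 8 times the residue
    [coef_second]. *)
Lemma second_coefficient (x : C) (l m : nat) : good x -> is01 l -> is01 m ->
  2 * Csqrt ((1 - x) * x) ^ 3 /
    ((-1) ^ l * Csqrt (1 - x) + (-1) ^ m * Csqrt x
     - 2 * Csqrt ((1 - x) * x) - (-1) ^ (l + m))
  = 8 * coef_second x l m - (Csqrt (1 - x) * Csqrt x) ^ 2.
Proof.
  intros Hx Hl Hm. destruct (sigma_neq x l m Hx Hl Hm) as [S0 S1].
  rewrite Csqrt_mult_compl. unfold coef_second. unfold sigma in *.
  assert (Hq := Csqrt_compl_sqr x).
  set (p := Csqrt x) in *. set (q := Csqrt (1 - x)) in *. clearbody p q.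
  assert (Hl2 : (-1) ^ l * (-1) ^ l = 1) by (destruct Hl as [-> | ->]; simpl; ring).
  assert (Hm2 : (-1) ^ m * (-1) ^ m = 1) by (destruct Hm as [-> | ->]; simpl; ring).
  rewrite Cpow_add_r.
  set (e := (-1) ^ l) in *. set (d := (-1) ^ m) in *. clearbody e d.
  set (s := e * p + d * q) in *.
  assert (Es : s * s = 1 + 2 * (e * d) * (q * p)).
  { unfold s. transitivity (e * e * (p * p) + d * d * (q * q) + 2 * (e * d) * (q * p)); [ring|].
    rewrite Hl2, Hm2, Hq. ring. }
  assert (Eed : e * d * (e * d) = 1) by (transitivity (e * e * (d * d)); [ring | rewrite Hl2, Hm2; ring]).
  assert (ED : e * q + d * p - 2 * (q * p) - e * d = e * d * (s * (1 - s))).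
  { transitivity (e * d * s - e * d * (s * s)); [|ring]. rewrite Es.
    unfold s.
    transitivity (d * (e * e) * p + e * (d * d) * q - e * d - 2 * (e * d * (e * d)) * (q * p)).
    - rewrite Hl2, Hm2, Eed. ring.
    - ring. }
  assert (Eqp : 2 * (q * p) = e * d * (s * s - 1)).
  { rewrite Es. transitivity (2 * (q * p) * (e * d * (e * d))); [rewrite Eed; ring | ring]. }
  rewrite ED.
  assert (Ne : e <> 0) by (intros E; apply C1_nz; rewrite <- Hl2, E; ring).
  assert (Nd : d <> 0) by (intros E; apply C1_nz; rewrite <- Hm2, E; ring).
  replace (2 * (q * p) ^ 3) with (2 * (q * p) * ((q * p) * (q * p))) by (simpl; ring).
  rewrite Eqp. simpl Cpow. field. repeat split; assumption.
Qed.

Lemma good_of_gt (x : C) : (1 < Cmod (4 * x * (1 - x)))%R -> good x.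
Proof.
  intros H. split; [unfold conv_domain; lra|]. intros ->.
  replace (4 * (1 / 2) * (1 - 1 / 2)) with (RtoC 1) in H by field.
  rewrite Cmod_1 in H. lra.
Qed.

Lemma harmonic_series_1 (x : C) : (1 < Cmod (4 * x * (1 - x)))%R ->
  is_seriesC (fun n => harmonic 1 (S n) * zscale x ^ S n * ibeta (2 * S n) (2 * S n) 1)
    (pair_comb (coef_first x) x 1).
Proof.
  intros H. assert (Hx := good_of_gt x H).
  apply (harmonic_beta_series x (fun n => 2 * S n)%nat (fun _ => 1%R)); trivial.
  - intros n t Ht. unfold beta_fun, quartic.
    replace (t * (1 - t) * (t * (1 - t)))%R with (t ^ 2 * (1 - t) ^ 2)%R by ring.
    rewrite Rpow_mult_distr, <- !pow_mult. ring.
  - intros t Ht. split; [lra|]. rewrite <- Rinv_1 at 1. apply Rinv_le_contravar; lra.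
  - apply harmonic_summable; [now apply Cmod_zscale_lt|]. intros n. split.
    + apply ibeta_le. lra.
    + apply ibeta_one_le. lia.
  - intros t Ht. now apply partial_fractions_1.
Qed.

Lemma harmonic_series_2 (x : C) : (1 < Cmod (4 * x * (1 - x)))%R ->
  is_seriesC (fun n => harmonic 1 (S n) * zscale x ^ S n * ibeta (2 * S n + 1) (2 * S n + 1) 1)
    (pair_comb (coef_second x) x 1).
Proof.
  intros H. assert (Hx := good_of_gt x H).
  apply (harmonic_beta_series x (fun n => 2 * S n + 1)%nat (fun t => t * (1 - t))%R); trivial.
  - intros n t Ht. unfold beta_fun, quartic.
    replace (t * (1 - t) * (t * (1 - t)))%R with (t ^ 2 * (1 - t) ^ 2)%R by ring.
    rewrite Rpow_mult_distr, <- !pow_mult, !pow_add, !pow_1. ring.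
  - intros t Ht. split; [nra|]. apply Rle_trans with 1%R; [nra|].
    rewrite <- Rinv_1 at 1. apply Rinv_le_contravar; lra.
  - apply harmonic_summable; [now apply Cmod_zscale_lt|]. intros n. split.
    + apply ibeta_le. lra.
    + apply Rle_trans with (16 ^ S n * ibeta (2 * S n) (2 * S n) 1)%R.
      * apply Rmult_le_compat_l; [apply pow_le; lra | apply ibeta_quad_le].
      * apply ibeta_one_le. lia.
  - intros t Ht. now apply partial_fractions_2.
Qed.

Lemma sum01_ext (f g : nat -> C) : (forall l, is01 l -> f l = g l) -> sum01 f = sum01 g.
Proof. intros H. unfold sum01. rewrite !H by (unfold is01; auto). reflexivity. Qed.

Lemma pair_comb_explicit (k : nat -> nat -> C) (x : C) :
  pair_comb k x 1 = sum01 (fun l => sum01 (fun l' => sum01 (fun m => sum01 (fun m' =>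
    k l m * GPL (xi l m x :: xi l' m' x :: nil) 1)))).
Proof. unfold pair_comb, pair_sum, sum01. ring. Qed.

Lemma series_4k_1 (x : C) : (1 < Cmod (4 * x * (1 - x)))%R ->
  is_seriesC
     (fun n : nat => let k := S n in
        RtoC (harmonic 1 k) / RtoC ((4 * INR k + 1) * binom_4k_2k k)
        * (2 ^ 2 / (x * (1 - x))) ^ k)
     (- sum01 (fun l => sum01 (fun l' => sum01 (fun m => sum01 (fun m' =>
          Csqrt ((1 - x) * x) * ((-1) ^ l * Csqrt (1 - x) - (-1) ^ m * Csqrt x)
          * GPL (xi l m x :: xi l' m' x :: nil) 1
          / (4 * (2 * x - 1))))))).
Proof.
  intros H. assert (V := harmonic_series_1 x H). rewrite pair_comb_explicit in V.
  match goal with |- is_series _ ?v => match type of V with is_series _ ?w =>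
    replace v with w end end.
  - eapply is_seriesC_ext; [|exact V]. intros n. cbv beta zeta.
    rewrite ibeta_one. fold (zscale x).
    assert (B := binom_pos (S n)). assert (Q := pos_INR (S n)).
    rewrite RtoC_inv. 
    + unfold Cdiv. ring.
    + apply Rgt_not_eq, Rmult_lt_0_compat; lra.
  - unfold coef_first, Cdiv. rewrite Csqrt_mult_compl. unfold sum01. ring.
Qed.

Lemma series_4k_3 (x : C) : (1 < Cmod (4 * x * (1 - x)))%R ->
  is_seriesC
     (fun n : nat => let k := S n in
        RtoC (harmonic 1 k) / RtoC ((4 * INR k + 3) * binom_4k_2k k)
        * (2 ^ 2 / (x * (1 - x))) ^ k)
     (sum01 (fun l => sum01 (fun l' => sum01 (fun m => sum01 (fun m' =>
          2 * Csqrt ((1 - x) * x) ^ 3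
          * GPL (xi l m x :: xi l' m' x :: nil) 1
          / ((-1) ^ l * Csqrt (1 - x) + (-1) ^ m * Csqrt x
             - 2 * Csqrt ((1 - x) * x) - (-1) ^ (l + m))))))
      + sum01 (fun l => sum01 (fun l' => sum01 (fun m => sum01 (fun m' =>
          Csqrt ((1 - x) * x) * ((-1) ^ l * Csqrt (1 - x) - (-1) ^ m * Csqrt x)
          * GPL (xi l m x :: xi l' m' x :: nil) 1
          / (4 * (2 * x - 1))))))).
Proof.
  intros H. assert (Hx := good_of_gt x H).
  assert (V1 := series_4k_1 x H).
  assert (V2 := is_seriesC_scal 8 _ _ (harmonic_series_2 x H)).
  assert (V := is_seriesC_plus _ _ _ _ V2 (is_seriesC_scal (- (1)) _ _ V1)).
  assert (E : 8 * pair_comb (coef_second x) x 1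
    = sum01 (fun l => sum01 (fun l' => sum01 (fun m => sum01 (fun m' =>
          2 * Csqrt ((1 - x) * x) ^ 3
          * GPL (xi l m x :: xi l' m' x :: nil) 1
          / ((-1) ^ l * Csqrt (1 - x) + (-1) ^ m * Csqrt x
             - 2 * Csqrt ((1 - x) * x) - (-1) ^ (l + m))))))).
  { transitivity (8 * pair_comb (coef_second x) x 1
      - (Csqrt (1 - x) * Csqrt x) ^ 2 * pair_comb (fun _ _ => 1) x 1).
    (* The extra constant in each coefficient multiplies a vanishing sum. *)
    - rewrite pair_comb_1 by trivial. ring.
    - transitivity (pair_comb (fun l m => 8 * coef_second x l m - (Csqrt (1 - x) * Csqrt x) ^ 2) x 1).
      + unfold pair_comb, sum01. ring.
      + rewrite pair_comb_explicit.
        apply sum01_ext. intros l Hl. apply sum01_ext. intros l' _.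
        apply sum01_ext. intros m Hm. apply sum01_ext. intros m' _.
        rewrite <- second_coefficient by trivial. unfold Cdiv. ring. }
  rewrite E in V.
  match goal with |- is_series _ ?v => match type of V with is_series _ ?w =>
    replace v with w by (unfold Cdiv; ring) end end.
  eapply is_seriesC_ext; [|exact V]. intros n. cbv beta zeta.
  rewrite ibeta_quad. fold (zscale x).
  assert (B := binom_pos (S n)). assert (Q := pos_INR (S n)).
  assert (P1 : (0 < (4 * INR (S n) + 1) * binom_4k_2k (S n))%R)
    by (apply Rmult_lt_0_compat; lra).
  assert (P3 : (0 < (4 * INR (S n) + 3) * binom_4k_2k (S n))%R)
    by (apply Rmult_lt_0_compat; lra).
  rewrite RtoC_div, RtoC_plus, !RtoC_inv by lra.
  field. split; intros F; apply RtoC_inj in F; lra.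
Qed.

Theorem theorem1p6 (x : C) :
  (* (a) *)
  ((1 <= Cmod (4 * x * (1 - x)))%R ->
   forall (M r : nat) (rs : list nat),
     (1 <= M)%nat -> (1 <= r)%nat -> length rs = M ->
     List.Forall (fun rj => (1 <= rj)%nat) rs ->
     let w := (r + 1 + list_sum rs)%nat in
     exists v : C,
       is_series (K := C_AbsRing) (V := C_NormedModule)
         (fun n : nat => let k := S n in
            RtoC (harmonic_prod rs k) / RtoC (INR k ^ (r + 1) * binom_4k_2k k)
            * (2 ^ 2 / (x * (1 - x))) ^ k) v /\
       (x <> 1 / 2 -> GPL_space 1 w w (Xi x) (Xi x) v) /\
       (x = 1 / 2 -> GPL_space_lim to_half 1 w w Xi_fun Xi_fun v))
  /\
  (* (b) *)
  ((1 < Cmod (4 * x * (1 - x)))%R ->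
   is_series (K := C_AbsRing) (V := C_NormedModule)
     (fun n : nat => let k := S n in
        RtoC (harmonic 1 k) / RtoC ((4 * INR k + 1) * binom_4k_2k k)
        * (2 ^ 2 / (x * (1 - x))) ^ k)
     (- sum01 (fun l => sum01 (fun l' => sum01 (fun m => sum01 (fun m' =>
          Csqrt ((1 - x) * x) * ((-1) ^ l * Csqrt (1 - x) - (-1) ^ m * Csqrt x)
          * GPL (xi l m x :: xi l' m' x :: nil) 1
          / (4 * (2 * x - 1)))))))
   /\
   is_series (K := C_AbsRing) (V := C_NormedModule)
     (fun n : nat => let k := S n in
        RtoC (harmonic 1 k) / RtoC ((4 * INR k + 3) * binom_4k_2k k)
        * (2 ^ 2 / (x * (1 - x))) ^ k)
     (sum01 (fun l => sum01 (fun l' => sum01 (fun m => sum01 (fun m' =>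
          2 * Csqrt ((1 - x) * x) ^ 3
          * GPL (xi l m x :: xi l' m' x :: nil) 1
          / ((-1) ^ l * Csqrt (1 - x) + (-1) ^ m * Csqrt x
             - 2 * Csqrt ((1 - x) * x) - (-1) ^ (l + m))))))
      + sum01 (fun l => sum01 (fun l' => sum01 (fun m => sum01 (fun m' =>
          Csqrt ((1 - x) * x) * ((-1) ^ l * Csqrt (1 - x) - (-1) ^ m * Csqrt x)
          * GPL (xi l m x :: xi l' m' x :: nil) 1
          / (4 * (2 * x - 1)))))))).
Proof.
  split.
  - intros Hx M r rs _ Hr _ Hrs. exact (series_power x r rs Hx Hr Hrs).
  - intros Hx. split; [exact (series_4k_1 x Hx) | exact (series_4k_3 x Hx)].
Qed.
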